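(* Let $\mathcal M=(\pi:M\to S,\mathrm p,\mathcal W,[h])$ be a twisting regular shearfree manifold of Kähler–Sasaki type, with $\dim M=n$, with $S$ projecting onto the Kähler manifold $(N,J,g_o)$ and with $\pi:M\to S$ trivial and equipped with its product flat connection. Let $(E_1,\dots,E_{n-2})$ be a frame field on an open set $\mathcal V\subset N$ and let $(X_A)=(\widehat E_1,\dots,\widehat E_{n-2},\mathrm p_o,\mathrm q_o)$ be the corresponding adapted frame field on $\mathcal U=(\pi^S\circ\pi)^{-1}(\mathcal V)\subset M$. Let $g$ be a compatible metric for $\mathcal M$, hence (on $\mathcal U$) of the form $$g=\sigma\Big\{g_{ij}\,\widehat E^i\vee\widehat E^j+\mathrm q_o^*\vee\Big(\alpha\,\mathrm p_o^*+\gamma^i g_{ik}\widehat E^k+\tfrac{\beta}{2}\,\mathrm q_o^*\Big)\Big\}$$ for smooth functions $(\sigma,\alpha,\beta,\gamma^i)$ on $\mathcal U$ with $\sigma>0$ and $\alpha\neq0$ at all points; equivalently $g(\widehat E_i,\widehat E_j)=\sigma g_{ij}$, $g(\widehat E_i,\mathrm p_o)=g(\mathrm p_o,\mathrm p_o)=0$, $g(\mathrm p_o,\mathrm q_o)=\frac{\sigma\alpha}{2}$, $g(\mathrm q_o,\widehat E_j)=\frac{\sigma}{2}\gamma^i g_{ij}$, $g(\mathrm q_o,\mathrm q_o)=\frac{\sigma\beta}{2}$. Then the Christoffel symbols $\Gamma_{AB}{}^{C}$ of the Levi-Civita connection $\nabla$ of $g$ in the frame $(X_A)$, i.e. the functions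 with $\nabla_{X_A}X_B=\Gamma_{AB}{}^C X_C$, are the following (summation over repeated indices from $1$ to $n-2$). Set $$S_{ij|k}:=\tfrac{\gamma^\ell}{4}\,\omega_{ik}\,g_{\ell j}+\tfrac{\gamma^\ell}{4}\,\omega_{jk}\,g_{\ell i}-\tfrac{\gamma^\ell}{4}\,\omega_{ij}\,g_{\ell k}.$$ Then \begin{align*} \Gamma_{ij}{}^{m}&=g^{mk}g_o(\nabla^o_{E_i}E_j,E_k)+g^{mk}S_{ij|k}+\tfrac{\gamma^m\omega_{ij}}{4}+\tfrac{1}{2\sigma}\widehat E_i(\sigma)\delta_j^m+\tfrac1{2\sigma}\widehat E_j(\sigma)\delta_i^m-\tfrac{g_{ij}}{2\sigma}\Big(g^{mk}\widehat E_k(\sigma)-\tfrac{\gamma^m}{\alpha}\mathrm p_o(\sigma)\Big),\\ \Gamma_{ij}{}^{\mathrm p_o}&=\tfrac1{2\alpha}\widehat E_i(\gamma^kg_{jk})+\tfrac1{2\alpha}\widehat E_j(\gamma^kg_{ik})-\tfrac1{4\alpha}\gamma^m\gamma^kg_{mk}\omega_{ij}-\tfrac{\gamma^m}{\alpha}g_o(\nabla^o_{E_i}E_j,E_m)-\tfrac{\gamma^m}{\alpha}S_{ij|m}\\ &\quad-\tfrac{g_{ij}}{2\sigma}\Big(\tfrac2\alpha\mathrm q_o(\sigma)+\tfrac1{\alpha^2}(\gamma^m\gamma^kg_{mk}-2\beta)\mathrm p_o(\sigma)-\tfrac{\gamma^m}{\alpha}\widehat E_m(\sigma)\Big),\\ \Gamma_{ij}{}^{\mathrm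 q_o}&=-\tfrac{\omega_{ij}}2-\tfrac{g_{ij}}{\alpha\sigma}\mathrm p_o(\sigma),\\ \Gamma_{i\mathrm p_o}{}^{m}&=\Gamma_{\mathrm p_oi}{}^{m}=\tfrac{\alpha g^{mk}\omega_{ik}}4+\tfrac1{2\sigma}\mathrm p_o(\sigma)\delta_i^m,\\ \Gamma_{i\mathrm p_o}{}^{\mathrm p_o}&=\Gamma_{\mathrm p_oi}{}^{\mathrm p_o}=\tfrac1{2\alpha}\widehat E_i(\alpha)+\tfrac1{2\alpha}\mathrm p_o(\gamma^k)g_{ik}-\tfrac{\gamma^m\omega_{im}}4+\tfrac1{2\sigma}\widehat E_i(\sigma),\\ \Gamma_{i\mathrm p_o}{}^{\mathrm q_o}&=\Gamma_{\mathrm p_oi}{}^{\mathrm q_o}=0,\\ \Gamma_{i\mathrm q_o}{}^{m}&=\Gamma_{\mathrm q_oi}{}^{m}=\tfrac{g^{mk}}4\widehat E_i(\gamma^tg_{tk})-\tfrac{g^{mk}}4\widehat E_k(\gamma^tg_{ti})-\tfrac{\gamma^\ell}4c_{ir}^tg_{t\ell}g^{mr}+\tfrac{g^{mk}\omega_{ik}}4\beta-\tfrac{\gamma^m}{4\alpha}\widehat E_i(\alpha)+\tfrac{\gamma^m}{4\alpha}\mathrm p_o(\gamma^t)g_{ti}\\ &\quad+\tfrac1{2\sigma}\mathrm q_o(\sigma)\delta_i^m-\tfrac{\gamma^t}{4\sigma}g_{ti}\Big(g^{mk}\widehat E_k(\sigma)-\tfrac{\gamma^m}\alpha\mathrm p_o(\sigma)\Big),\\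 \Gamma_{i\mathrm q_o}{}^{\mathrm p_o}&=\Gamma_{\mathrm q_oi}{}^{\mathrm p_o}=\tfrac1{2\alpha}\widehat E_i(\beta)+\tfrac1{4\alpha^2}\gamma^m\gamma^kg_{mk}\widehat E_i(\alpha)-\tfrac1{4\alpha^2}\gamma^m\gamma^kg_{mk}\mathrm p_o(\gamma^t)g_{it}-\tfrac{1}{2\alpha^2}\beta\widehat E_i(\alpha)+\tfrac1{2\alpha^2}\beta\,\mathrm p_o(\gamma^t)g_{it}\\ &\quad-\tfrac{\gamma^m}{4\alpha}\widehat E_i(\gamma^tg_{tm})+\tfrac{\gamma^m}{4\alpha}\widehat E_m(\gamma^tg_{it})+\tfrac{\gamma^m\gamma^t}{4\alpha}g_{t\ell}c^\ell_{im}-\tfrac{\gamma^m}{4\alpha}\omega_{im}\beta\\ &\quad-\tfrac{\gamma^t}{4\sigma}g_{ti}\Big(\tfrac2\alpha\mathrm q_o(\sigma)+\tfrac1{\alpha^2}(\gamma^m\gamma^kg_{mk}-2\beta)\mathrm p_o(\sigma)-\tfrac{\gamma^m}\alpha\widehat E_m(\sigma)\Big),\\ \Gamma_{i\mathrm q_o}{}^{\mathrm q_o}&=\Gamma_{\mathrm q_oi}{}^{\mathrm q_o}=\tfrac1{2\alpha}\widehat E_i(\alpha)-\tfrac1{2\alpha}\mathrm p_o(\gamma^t)g_{it}+\tfrac1{2\sigma}\widehat E_i(\sigma)-\tfrac{\gamma^tg_{ti}}{2\alpha\sigma}\mathrm p_o(\sigma),\\ \Gamma_{\mathrm p_o\mathrm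 p_o}{}^{m}&=0,\qquad\Gamma_{\mathrm p_o\mathrm p_o}{}^{\mathrm p_o}=\mathrm p_o(\log|\alpha\sigma|),\qquad\Gamma_{\mathrm p_o\mathrm p_o}{}^{\mathrm q_o}=0,\\ \Gamma_{\mathrm p_o\mathrm q_o}{}^{m}&=\Gamma_{\mathrm q_o\mathrm p_o}{}^{m}=\tfrac14\mathrm p_o(\gamma^m)-\tfrac{g^{mk}}4\widehat E_k(\alpha)-\tfrac{\alpha}{4\sigma}\Big(g^{mk}\widehat E_k(\sigma)-\tfrac{\gamma^m}\alpha\mathrm p_o(\sigma)\Big),\\ \Gamma_{\mathrm p_o\mathrm q_o}{}^{\mathrm p_o}&=\Gamma_{\mathrm q_o\mathrm p_o}{}^{\mathrm p_o}=\tfrac1{2\alpha}\mathrm p_o(\beta)-\tfrac{\gamma^m}{4\alpha}\mathrm p_o(\gamma^i)g_{im}+\tfrac{\gamma^m}{4\alpha}\widehat E_m(\alpha)+\tfrac1{2\sigma}\mathrm q_o(\sigma)\\ &\quad-\tfrac1{2\sigma}\Big(\mathrm q_o(\sigma)+\tfrac1{2\alpha}(\gamma^m\gamma^kg_{mk}-2\beta)\mathrm p_o(\sigma)-\tfrac{\gamma^m}2\widehat E_m(\sigma)\Big),\\ \Gamma_{\mathrm p_o\mathrm q_o}{}^{\mathrm q_o}&=\Gamma_{\mathrm q_o\mathrm p_o}{}^{\mathrm q_o}=0,\\ \Gamma_{\mathrm q_o\mathrm q_o}{}^{m}&=\tfrac{g^{mk}}2\mathrm q_o(\gamma^i)g_{ik}-\tfrac{g^{mk}}4\widehat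 E_k(\beta)-\tfrac{\gamma^m}{2\alpha}\mathrm q_o(\alpha)+\tfrac{\gamma^m}{4\alpha}\mathrm p_o(\beta)-\tfrac{\beta}{4\sigma}\Big(g^{mk}\widehat E_k(\sigma)-\tfrac{\gamma^m}\alpha\mathrm p_o(\sigma)\Big),\\ \Gamma_{\mathrm q_o\mathrm q_o}{}^{\mathrm p_o}&=\tfrac1{2\alpha}\mathrm q_o(\beta)+\tfrac1{2\alpha^2}\gamma^m\gamma^kg_{mk}\mathrm q_o(\alpha)-\tfrac1{4\alpha^2}\gamma^m\gamma^kg_{mk}\mathrm p_o(\beta)-\tfrac1{\alpha^2}\beta\,\mathrm q_o(\alpha)+\tfrac{\beta}{2\alpha^2}\mathrm p_o(\beta)\\ &\quad-\tfrac{\gamma^m}{2\alpha}\mathrm q_o(\gamma^i)g_{im}+\tfrac{\gamma^m}{4\alpha}\widehat E_m(\beta)-\tfrac{\beta}{2\sigma}\Big(\tfrac1\alpha\mathrm q_o(\sigma)+\tfrac1{2\alpha^2}(\gamma^m\gamma^kg_{mk}-2\beta)\mathrm p_o(\sigma)-\tfrac{\gamma^m}{2\alpha}\widehat E_m(\sigma)\Big),\\ \Gamma_{\mathrm q_o\mathrm q_o}{}^{\mathrm q_o}&=\tfrac1\alpha\mathrm q_o(\alpha)-\tfrac1{2\alpha}\mathrm p_o(\beta)+\tfrac1\sigma\mathrm q_o(\sigma)-\tfrac{\beta}{2\alpha\sigma}\mathrm p_o(\sigma). \end{align*}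
   Context: **Setting.** All objects are smooth. A regular shearfree manifold $\mathcal M=(\pi:M\to S,\mathrm p,\mathcal W,[h])$ consists of: - a principal bundle $\pi:M\to S=M/A$ with one-dimensional structure group $A=\mathbb R$ or $S^1$; - the generator $\mathrm p$ of the $A$-action (determined up to a nowhere vanishing factor); - an $A$-invariant codimension one distribution $\mathcal W\subset TM$ containing $\mathrm p$; - an $A$-invariant conformal class $[h]$ of semi-positive degenerate metrics on $\mathcal W$. A Lorentzian metric $g$ on $M$ is *compatible* with $\mathcal M$ if $\mathrm p$ is null for $g$, $\mathcal W=\mathrm p^{\perp_g}$ and $[h]=[g|_{\mathcal W\times\mathcal W}]$ (the flow of $\mathrm p$ preserving $\mathcal W$ and $[h]$). $\mathcal M$ is *twisting* if $M$ is even dimensional and the projected distribution $\mathcal W^S=\pi_*\mathcal W\subset TS$ is contact. It is *of Kähler–Sasaki type* if, in addition: - $S$ is a principal bundle $\pi^S:S\to N$ with one-dimensional structure group $A'=\mathbb R$ or $S^1$ over a Kähler manifold $(N,J,g_o)$, with Kähler form $\omega_o=g_o(J\cdot,\cdot)$; the CR structure $(\mathcal W^S,J^S)$ on $S$ is $A'$-invariant, with $J^S$ projecting to $J$; - there is an $A'$-invariant $1$-form $\theta_o$ on $S$ with $\ker\theta_o=\mathcal W^S$, $d\theta_o=(\pi^S)^*\omega_o$ and $\theta_o(\mathrm q_o^S)=1$, where $\mathrm q_o^S$ is the fundamental vector field of the $A'$-action corresponding to the standard basis element of $\mathrm{Lie}(A')=\mathbb R$ (so $\theta_o$ is a connection form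 on $S\to N$); - $[h]$ is the conformal class of $\big((\pi^S\circ\pi)^*g_o\big)|_{\mathcal W}$. Convention: $d\theta(X,Y)=X(\theta(Y))-Y(\theta(X))-\theta([X,Y])$. Standing assumption: $\pi:M\to S$ is the trivial bundle $S\times A\to S$ with its product flat connection, whose horizontal distribution is denoted $\mathcal H_o$ (this can always be achieved locally). **Adapted frames.** $\mathrm p_o$ is the fundamental vector field of the $A$-action on $M$ corresponding to the standard basis element of $\mathrm{Lie}(A)=\mathbb R$. $\mathrm q_o$ is the unique $A$-invariant vector field on $M$ with values in $\mathcal H_o$ projecting onto $\mathrm q_o^S$. For a vector field $X$ on (an open subset of) $N$, $X^{(S)}$ is its $A'$-invariant lift to $S$ with values in $\mathcal W^S$, and $\widehat X$ is the $A$-invariant vector field on $M$ with values in $\mathcal H_o$ projecting onto $X^{(S)}$; it takes values in $\mathcal H_o\cap\mathcal W$. Given a frame field $(E_i)_{1\le i\le n-2}$ on $\mathcal V\subset N$, the adapted frame field is $(\widehat E_1,\dots,\widehat E_{n-2},\mathrm p_o,\mathrm q_o)$ on $\mathcal U=(\pi^S\circ\pi)^{-1}(\mathcal V)$, and its dual coframe is $(\widehat E^1,\dots,\widehat E^{n-2},\mathrm p_o^*,\mathrm q_o^* )$. With $[E_i,E_j]=c_{ij}^kE_k$, the brackets are $$[\widehat E_i,\widehat E_j]=c_{ij}^k\widehat E_k-g_o(JE_i,E_j)\,\mathrm q_o,\qquad[\widehat E_i,\mathrm p_o]=[\widehat E_i,\mathrm q_o]=[\mathrm p_o,\mathrm q_o]=0.$$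 **Notation.** $g_{ij}=g_o(E_i,E_j)$, $(g^{ij})=(g_{ij})^{-1}$, $\omega_{ij}=g_o(JE_i,E_j)$, $\nabla^o$ is the Levi-Civita connection of $g_o$ on $N$. Functions on $\mathcal V$ (such as $g_{ij}$, $\omega_{ij}$, $c_{ij}^k$, $g_o(\nabla^o_{E_i}E_j,E_k)$) are regarded as functions on $\mathcal U$ by pull-back. For $1$-forms, $\mu\vee\nu=\frac12(\mu\otimes\nu+\nu\otimes\mu)$. Christoffel indices $i,j,m,\dots$ refer to $\widehat E_i,\widehat E_j,\widehat E_m,\dots$, and the indices $\mathrm p_o,\mathrm q_o$ refer to those vector fields; e.g. $\Gamma_{i\mathrm q_o}{}^{\mathrm p_o}$ is the $\mathrm p_o$-component of $\nabla_{\widehat E_i}\mathrm q_o$.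
   Formalization: The printed formula for Γ_ij^{p_o} is false when the frame does not commute (it is not symmetric in i,j though [Ê_i,Ê_j] has no p_o-component); the summand (1/(2α)) c_ij^k γ^t g_tk is added, and it vanishes when all c_ij^k = 0. *)

(* Defs.v *)
From HB Require Import structures.
From mathcomp Require Import all_boot all_order all_algebra.
From mathcomp Require Import all_classical all_reals all_analysis.
From mathcomp Require Import ring.
Import Order.TTheory GRing.Theory Num.Theory.
Import numFieldNormedType.Exports.

Set Implicit Arguments.
Unset Strict Implicit.
Unset Printing Implicit Defensive.

Local Open Scope classical_set_scope.
Local Open Scope ring_scope.

Section SmoothMaps.
Context {R : realType} {V W : normedModType R}.

Fixpoint Ck (k : nat) (O : set V) (f : V -> W) : Prop :=
  match k with
  | 0 => forall u, O u -> {for u, continuous f}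
  | k'.+1 => (forall u, O u -> differentiable f u) /\
             (forall v, Ck k' O ('D_v f))
  end.

Definition smooth_on (O : set V) (f : V -> W) := forall k, Ck k O f.
End SmoothMaps.

(* Manifolds are given by local parametrizations: a set of points with
   injective maps defined on open subsets of R^d and smooth transition maps.
   The topology of the manifold is the one induced by the atlas. *)
Record chart (R : realType) (T : Type) (d : nat) :=
  Chart { cdom : set 'rV[R]_d ; cmap :> 'rV[R]_d -> T }.

Record premanifold (R : realType) (d : nat) :=
  Space { points :> Type ; atlas : set (chart R points d) }.
Arguments atlas {R d} p _.

Section Manifolds.
Context {R : realType} {d : nat}.
Implicit Types (M : premanifold R d).

Definition open_in M (U : set M) :=
  forall x, atlas M x -> open (cdom x `&` (x @^-1` U)).

(* Second countability is stated as the existence of a countable subatlas. *)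
Record is_manifold M : Prop := IsManifold {
  mfd_open : forall x, atlas M x -> open (cdom x) ;
  mfd_inj : forall x u v, atlas M x -> cdom x u -> cdom x v ->
    x u = x v -> u = v ;
  mfd_transition : forall x y, atlas M x -> atlas M y ->
    let D := cdom x `&` (x @^-1` (y @` cdom y)) in
    open D /\ exists h : 'rV[R]_d -> 'rV[R]_d, smooth_on D h /\
      forall u, D u -> cdom y (h u) /\ y (h u) = x u ;
  mfd_countable : exists B : set (chart R M d),
    [/\ countable B, B `<=` atlas M &
        forall p, exists x u, [/\ B x, cdom x u & x u = p]] ;
  mfd_hausdorff : forall p q : M, p <> q ->
    exists U V : set M, [/\ open_in U, open_in V, U p, V q & U `&` V = set0]
}.

Definition smooth_at M (f : M -> R) (p : M) :=
  forall x u, atlas M x -> cdom x u -> x u = p ->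
  exists O : set 'rV[R]_d,
    [/\ open O, O u, O `<=` cdom x & smooth_on O (f \o x : _ -> R^o)].

(* A tangent vector at p is a functional on real functions.  It is only
   meaningful on functions that are smooth near p, and is required to vanish
   on the others, so that equality of tangent vectors is equality of
   functionals. *)
Definition tvec M := (M -> R) -> R.
HB.instance Definition _ M := GRing.Lmodule.copy (tvec M) ((M -> R) -> R^o).

Definition tangent M (p : M) (v : tvec M) :=
  exists x u w, [/\ atlas M x, cdom x u, x u = p &
    forall f, v f = if `[< smooth_at f p >] then 'D_w (f \o x : _ -> R^o) u
                    else 0].

Definition basis_at M (p : M) k (e : 'I_k -> tvec M) :=
  (forall i, tangent p (e i)) /\
  forall v, tangent p v -> exists! a : 'rV[R]_k, v = \sum_i a 0 i *: e i.

Definition vector_field M := forall p : M, tvec M.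
Definition tangent_dist M := forall p : M, set (tvec M).
Definition one_form M := forall p : M, tvec M -> R.
Definition two_tensor M := forall p : M, tvec M -> tvec M -> R.
Definition endo M := forall p : M, tvec M -> tvec M.

(* X restricts to a smooth vector field on U with values in W *)
Definition vfield M (W : tangent_dist M) (U : set M) (X : vector_field M) :=
  (forall p, U p -> tangent p (X p) /\ W p (X p)) /\
  (forall f p, U p -> smooth_at f p -> smooth_at (fun q => X q f) p).

Definition lie M (X Y : vector_field M) : vector_field M := fun p f =>
  if `[< smooth_at f p >] then X p (fun q => Y q f) - Y p (fun q => X q f)
  else 0.

Definition is_one_form M (U : set M) (eta : one_form M) :=
  (forall p a v w, U p -> tangent p v -> tangent p w ->
     eta p (a *: v + w) = a * eta p v + eta p w) /\
  (forall V X p, open_in V -> V `<=` U -> vfield (@tangent M) V X -> V p ->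
     smooth_at (fun q => eta q (X q)) p).

Definition ext_d M (eta : one_form M) (X Y : vector_field M) (p : M) : R :=
  X p (fun q => eta q (Y q)) - Y p (fun q => eta q (X q)) - eta p (lie X Y p).

Definition kernel_on M (W : tangent_dist M) (U : set M) (eta : one_form M) :=
  forall p, U p -> forall v, W p v <-> tangent p v /\ eta p v = 0.

Definition codim_one M (W : tangent_dist M) :=
  forall p, exists U eta, [/\ open_in U, U p, is_one_form U eta,
    (forall q, U q -> exists v, tangent q v /\ eta q v <> 0) &
    kernel_on W U eta].

(* d(eta) is nondegenerate on W for some local defining form eta *)
Definition contact M (W : tangent_dist M) :=
  codim_one W /\
  forall p, exists U eta, [/\ open_in U, U p, is_one_form U eta,
    kernel_on W U eta &
    forall q V X, open_in V -> V `<=` U -> V q -> vfield W V X -> X q <> 0 ->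
      exists V' Y, [/\ open_in V', V' `<=` V, V' q, vfield W V' Y &
                       ext_d eta X Y q <> 0]].

Record sym_form M (W : tangent_dist M) (h : two_tensor M) : Prop := SymForm {
  form_sym : forall p v w, W p v -> W p w -> h p v w = h p w v ;
  form_lin : forall p a v1 v2 w, W p v1 -> W p v2 -> W p w ->
    h p (a *: v1 + v2) w = a * h p v1 w + h p v2 w ;
  form_smooth : forall U X Y p, open_in U -> vfield W U X -> vfield W U Y ->
    U p -> smooth_at (fun q => h q (X q) (Y q)) p
}.

Definition riemannian M (g : two_tensor M) :=
  sym_form (@tangent M) g /\
  forall p v, tangent p v -> v <> 0 -> 0 < g p v v.

(* signature (-,+,...,+) *)
Definition lorentzian M (g : two_tensor M) :=
  sym_form (@tangent M) g /\
  forall p, exists e : 'I_d -> tvec M, basis_at p e /\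
    forall i j, g p (e i) (e j) =
      if i == j then (if val i == 0%N then -1 else 1) else 0.

Definition conformal M (W : tangent_dist M) (h h' : two_tensor M) :=
  exists f : M -> R, (forall p, smooth_at f p /\ 0 < f p) /\
    forall p v w, W p v -> W p w -> h' p v w = f p * h p v w.

(* Vector fields are total functions that are meaningful on an open set, so the
   axioms are required over every open set U. *)
Record levi_civita M (g : two_tensor M)
    (D : vector_field M -> vector_field M -> vector_field M) : Prop :=
    LeviCivita {
  lc_field : forall U X Y, open_in U ->
    vfield (@tangent M) U X -> vfield (@tangent M) U Y ->
    vfield (@tangent M) U (D X Y) ;
  lc_linear : forall U f X Y Z, open_in U -> (forall p, U p -> smooth_at f p) ->
    vfield (@tangent M) U X -> vfield (@tangent M) U Y ->
    vfield (@tangent M) U Z -> forall p, U p ->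
    D (fun q => f q *: X q + Y q) Z p = f p *: D X Z p + D Y Z p ;
  lc_leibniz : forall U f X Y Z, open_in U ->
    (forall p, U p -> smooth_at f p) ->
    vfield (@tangent M) U X -> vfield (@tangent M) U Y ->
    vfield (@tangent M) U Z -> forall p, U p ->
    D X (fun q => f q *: Y q + Z q) p =
      X p f *: Y p + f p *: D X Y p + D X Z p ;
  lc_torsion : forall U X Y, open_in U ->
    vfield (@tangent M) U X -> vfield (@tangent M) U Y -> forall p, U p ->
    D X Y p - D Y X p = lie X Y p ;
  lc_metric : forall U X Y Z, open_in U ->
    vfield (@tangent M) U X -> vfield (@tangent M) U Y ->
    vfield (@tangent M) U Z -> forall p, U p ->
    X p (fun q => g q (Y q) (Z q)) = g p (D X Y p) (Z p) + g p (Y p) (D X Z p)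
}.

(* Integrable CR structure (W, J).  For W the whole tangent bundle it is an
   integrable almost complex structure (vanishing Nijenhuis tensor). *)
Record cr_structure M (W : tangent_dist M) (J : endo M) : Prop := CRStructure {
  cr_stable : forall p v, W p v -> W p (J p v) ;
  cr_linear : forall p a v w, W p v -> W p w ->
    J p (a *: v + w) = a *: J p v + J p w ;
  cr_square : forall p v, W p v -> J p (J p v) = - v ;
  cr_smooth : forall U X, open_in U -> vfield W U X ->
    vfield W U (fun p => J p (X p)) ;
  cr_integrable : forall U X Y p, open_in U -> vfield W U X -> vfield W U Y ->
    U p ->
    let JX q := J q (X q) in let JY q := J q (Y q) in
    let Z := lie JX Y p + lie X JY p in
    W p Z /\ lie JX JY p - lie X Y p = J p Z
}.

Definition kaehler_form M (J : endo M) (g : two_tensor M) : two_tensor M :=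
  fun p v w => g p (J p v) w.

Definition closed_form M (om : two_tensor M) :=
  forall U X Y Z p, open_in U -> vfield (@tangent M) U X ->
    vfield (@tangent M) U Y -> vfield (@tangent M) U Z -> U p ->
    X p (fun q => om q (Y q) (Z q)) + Y p (fun q => om q (Z q) (X q))
    + Z p (fun q => om q (X q) (Y q))
    - om p (lie X Y p) (Z p) - om p (lie Y Z p) (X p)
    - om p (lie Z X p) (Y p) = 0.

Record kaehler M (J : endo M) (g : two_tensor M) : Prop := Kaehler {
  kaehler_manifold : is_manifold M ;
  kaehler_metric : riemannian g ;
  kaehler_complex : cr_structure (@tangent M) J ;
  kaehler_hermitian : forall p v w, tangent p v -> tangent p w ->
    g p (J p v) (J p w) = g p v w ;
  kaehler_closed : closed_form (kaehler_form J g)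
}.

Definition frame_field M k (V : set M) (E : 'I_k -> vector_field M) :=
  (forall i, vfield (@tangent M) V (E i)) /\
  forall p, V p -> basis_at p (fun i => E i p).
End Manifolds.

Section Maps.
Context {R : realType} {d e : nat} {M : premanifold R d}
  {N : premanifold R e}.

Definition smooth_map (U : set M) (F : M -> N) :=
  forall p x u y v, U p -> atlas M x -> cdom x u -> x u = p ->
    atlas N y -> cdom y v -> y v = F p ->
  exists (O : set 'rV[R]_d) (h : 'rV[R]_d -> 'rV[R]_e),
    [/\ open O, O u, O `<=` cdom x, smooth_on O h &
        forall u', O u' -> cdom y (h u') /\ y (h u') = F (x u')].

(* differential of F at p *)
Definition push (F : M -> N) (p : M) (v : tvec M) : tvec N := fun f =>
  if `[< smooth_at f (F p) >] then v (f \o F) else 0.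

Definition pullback (F : M -> N) (h : two_tensor N) : two_tensor M :=
  fun p v w => h (F p) (push F p v) (push F p w).

Definition prod_chart (x : chart R M d) (y : chart R N e) :
    chart R (M * N) (d + e) :=
  Chart [set w : 'rV[R]_(d + e) | cdom x (lsubmx w) /\ cdom y (rsubmx w)]
        (fun w => (x (lsubmx w), y (rsubmx w))).

Definition prod_space : premanifold R (d + e) :=
  @Space R (d + e) (M * N) [set z | exists x y,
    [/\ atlas M x, atlas N y & z = prod_chart x y]].
End Maps.
Arguments prod_space {R d e} M N.

Section StructureGroups.
Context {R : realType}.

Definition real_line : premanifold R 1 :=
  @Space R 1 R [set Chart [set: 'rV[R]_1] (fun u => u 0 0)].

Definition unit_norm (z : R * R) := z.1 ^+ 2 + z.2 ^+ 2 == 1.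

Definition circle_pt := {z : R * R | unit_norm z}.

Lemma expi_subproof (t : R) : unit_norm (cos t, sin t).
Proof. by rewrite /unit_norm /= cos2Dsin2. Qed.

Definition expi (t : R) : circle_pt := exist unit_norm _ (expi_subproof t).

Lemma circle_mul_subproof (z w : circle_pt) :
  unit_norm ((val z).1 * (val w).1 - (val z).2 * (val w).2,
             (val z).1 * (val w).2 + (val z).2 * (val w).1).
Proof.
case: z => -[a b] /= /eqP /= zP; case: w => -[a' b'] /= /eqP /= wP.
apply/eqP; rewrite /= -[RHS]mulr1 -{1}zP -wP; ring.
Qed.

(* multiplication of unit complex numbers *)
Definition circle_mul (z w : circle_pt) : circle_pt :=
  exist unit_norm _ (circle_mul_subproof z w).

Definition circle : premanifold R 1 :=
  @Space R 1 circle_pt [set x | exists a : R,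
    x = Chart [set u : 'rV[R]_1 | `|u 0 0 - a| < pi] (fun u => expi (u 0 0))].
End StructureGroups.

Inductive structure_group := RealLine | Circle.

Definition gspace (R : realType) (A : structure_group) : premanifold R 1 :=
  match A with RealLine => real_line | Circle => circle end.

Definition gmul (R : realType) (A : structure_group) :
    gspace R A -> gspace R A -> gspace R A :=
  match A with
  | RealLine => fun a b : R => a + b
  | Circle => @circle_mul R
  end.

(* exponential of t times the standard basis element of Lie(A) = R *)
Definition gexp (R : realType) (A : structure_group) : R -> gspace R A :=
  match A with RealLine => fun t => t | Circle => @expi R end.

Section PrincipalBundles.
Context {R : realType} {d e : nat} {P : premanifold R d}
  {B : premanifold R e} {A : structure_group}.
Implicit Types (pi : P -> B) (act : P -> gspace R A -> P).

Record principal_bundle pi act : Prop := PrincipalBundle {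
  pb_proj : smooth_map setT pi ;
  pb_act : smooth_map setT
    (fun z : prod_space P (gspace R A) => act z.1 z.2) ;
  pb_act1 : forall x, act x (gexp A 0) = x ;
  pb_actM : forall x a b, act (act x a) b = act x (gmul a b) ;
  pb_trivial : forall b, exists (V : set B) (tau : P -> gspace R A)
      (psi : prod_space B (gspace R A) -> P),
    [/\ open_in V /\ V b,
        smooth_map (pi @^-1` V) tau,
        smooth_map (M := prod_space B (gspace R A)) [set z | V z.1] psi,
        (forall b' a, V b' -> pi (psi (b', a)) = b' /\ tau (psi (b', a)) = a) &
        forall x, V (pi x) -> psi (pi x, tau x) = x /\
          forall a, pi (act x a) = pi x /\ tau (act x a) = gmul (tau x) a]
}.

Definition fundamental act : vector_field P := fun x f =>
  if `[< smooth_at f x >]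
  then derive1 (fun t : R => (f (act x (gexp A t)) : R^o)) 0 else 0.

Definition invariant_field act (U : set P) (X : vector_field P) :=
  forall x a, U x -> X (act x a) = push (act^~ a) x (X x).

Definition invariant_dist act (W : tangent_dist P) :=
  forall x a v, W x v -> W (act x a) (push (act^~ a) x v).

(* Xl is the invariant lift, with values in H, of the field X on U *)
Record is_lift pi act (H : tangent_dist P) (U : set B) (X : vector_field B)
    (Xl : vector_field P) : Prop := IsLift {
  lift_field : vfield H (pi @^-1` U) Xl ;
  lift_invariant : invariant_field act (pi @^-1` U) Xl ;
  lift_proj : forall x, U (pi x) -> push pi x (Xl x) = X (pi x)
}.

Definition push_dist pi (W : tangent_dist P) : tangent_dist B :=
  fun b v => exists x w, [/\ pi x = b, W x w & v = push pi x w].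

(* The generator p is determined up to a nowhere vanishing factor, and is
   normalized to be the fundamental vector field; h is a representative
   of the conformal class [h]. *)
Record regular_shearfree pi act (W : tangent_dist P) (h : two_tensor P) :
    Prop := RegularShearfree {
  rs_total : is_manifold P ;
  rs_base : is_manifold B ;
  rs_bundle : principal_bundle pi act ;
  rs_codim : codim_one W ;
  rs_generator : forall x, W x (fundamental act x) ;
  rs_W_inv : invariant_dist act W ;
  rs_form : sym_form W h ;
  rs_semipos : forall x v, W x v -> 0 <= h x v v ;
  rs_degenerate : forall x, exists v, [/\ W x v, v <> 0 &
    forall w, W x w -> h x v w = 0] ;
  rs_h_inv : forall a, conformal W h
    (fun x v w => h (act x a) (push (act^~ a) x v) (push (act^~ a) x w))
}.

Definition twisting pi (W : tangent_dist P) :=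
  ~~ odd d /\ contact (push_dist pi W).

Record compatible act (W : tangent_dist P) (h g : two_tensor P) : Prop :=
    Compatible {
  compatible_lorentzian : lorentzian g ;
  compatible_null : forall x, g x (fundamental act x) (fundamental act x) = 0 ;
  compatible_orth : forall x v,
    W x v <-> tangent x v /\ g x (fundamental act x) v = 0 ;
  compatible_conformal : conformal W h g
}.
End PrincipalBundles.

Section KaehlerSasaki.
Context {R : realType} {dM dS dN : nat} {M : premanifold R dM}
  {S : premanifold R dS} {N : premanifold R dN} {A' : structure_group}.

Record kaehler_sasaki (pi : M -> S) (W : tangent_dist M) (h : two_tensor M)
    (piS : S -> N) (actS : S -> gspace R A' -> S)
    (J : endo N) (go : two_tensor N) (JS : endo S) (theta : one_form S) :
    Prop := KaehlerSasaki {
  ks_kaehler : kaehler J go ;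
  ks_bundle : principal_bundle piS actS ;
  ks_cr : cr_structure (push_dist pi W) JS ;
  ks_W_inv : invariant_dist actS (push_dist pi W) ;
  ks_J_inv : forall s a v, push_dist pi W s v ->
    JS (actS s a) (push (actS^~ a) s v) = push (actS^~ a) s (JS s v) ;
  ks_J_proj : forall s v, push_dist pi W s v ->
    push piS s (JS s v) = J (piS s) (push piS s v) ;
  ks_theta : is_one_form setT theta ;
  ks_theta_inv : forall s a v, tangent s v ->
    theta (actS s a) (push (actS^~ a) s v) = theta s v ;
  ks_theta_ker : kernel_on (push_dist pi W) setT theta ;
  ks_theta_d : forall U X Y s, open_in U -> vfield (@tangent _ _ S) U X ->
    vfield (@tangent _ _ S) U Y -> U s ->
    ext_d theta X Y s =
      pullback piS (kaehler_form J go) s (X s) (Y s) ;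
  ks_theta_q : forall s, theta s (fundamental actS s) = 1 ;
  ks_conformal : conformal W (pullback (piS \o pi) go) h
}.
End KaehlerSasaki.

Section TrivialBundle.
Context {R : realType} {d : nat} {S : premanifold R d} {A : structure_group}.

Definition triv_proj (x : prod_space S (gspace R A)) : S := x.1.

Definition triv_act (x : prod_space S (gspace R A)) (a : gspace R A) :
  prod_space S (gspace R A) := (x.1, gmul x.2 a).

(* horizontal distribution of the product flat connection *)
Definition flat_horizontal : tangent_dist (prod_space S (gspace R A)) :=
  fun x v => tangent x v /\
    push (fun y : prod_space S (gspace R A) => y.2) x v = 0.
End TrivialBundle.

(* indices of the adapted frame (\hat E_1, ..., \hat E_k, p_o, q_o) *)
Inductive frame_index (k : nat) := Ix of 'I_k | Ip | Iq.
Arguments Ip {k}.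
Arguments Iq {k}.

(* Main.v *)
Require Import Defs.
From mathcomp Require Import all_boot all_order all_algebra.
From mathcomp Require Import all_classical all_reals all_analysis.
From mathcomp Require Import ring.
Import Order.TTheory GRing.Theory Num.Theory.
Import numFieldNormedType.Exports.
Local Open Scope classical_set_scope.
Local Open Scope ring_scope.

Set Implicit Arguments.
Unset Strict Implicit.
Unset Printing Implicit Defensive.

(* The Koszul formula gives g(nabla_{X_a} X_b, X_c) from the brackets and the
   derivatives of the Gram matrix of the adapted frame; inverting the Gram matrix,
   whose only nontrivial block is g_ij, yields the Christoffel symbols.

   The brackets are found without integrating anything: a bracket of vector fields
   on M is the torsion-free difference of two covariant derivatives, hence tangent,
   hence a combination of the frame. Its coefficients are read off by pushing it
   forward. The push-forward to N detects the coefficients of the E_i; the connection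
   form theta, applied to the push-forward to S, detects that of q_o, and
   d theta = omega_o makes it -omega_ij; a coordinate of the structure group detects
   that of p_o. *)

(** * Calculus of maps of class C^k *)

(** A tangent vector is encoded as a functional given by a direction in a chart, so tangency of a
    commutator computed by hand would require the symmetry of mixed second derivatives; the axioms
    on the connection of [g] supply it instead. Expanding a vector in the adapted frame presupposes
    that this frame spans. The tests that read off coefficients also prove independence, so spanning
    becomes a count of dimensions. The test for [p_o] must be smooth on the whole group, which
    excludes an angle on the circle; a sine takes its place.

    Smoothness is an iterated condition on directional derivatives, hence the calculus of C^k maps,
    up to the chain rule and the logarithm.

    The algebra is kept apart from the geometry: the derivatives of sigma, alpha, beta, gamma become
    free symbols over a field. The halves in the mixed products with [q_o] come from the factor 1/2
    in the symmetric product of 1-forms, and the terms in sigma are those of a conformal change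
    starting from g / sigma. *)

Lemma near_eq_differentiable (R : numFieldType) (V W : normedModType R)
    (f g : V -> W) (a : V) :
  {near a, f =1 g} -> differentiable f a -> differentiable g a.
Proof.
move=> fg /diff_locallyP[cf ef].
have ga : f a = g a := nbhs_singleton fg.
(* The first-order expansion of [f] also expands [g], since both agree near [a]; uniqueness of the
   differential then identifies ['d g a]. *)
have eg : g \o shift a = cst (g a) + 'd f a +o_ 0 id.
  apply/eqaddoP => e e0.
  have /eqaddoP/(_ _ e0) H := ef.
  have fg0 : \forall h \near (0 : V), f (h + a) = g (h + a).
    by move: fg; rewrite (near_shift 0) /= subr0.
  move: H fg0; apply: filterS2 => h + E.
  suff -> : (g \o shift a - (cst (g a) + 'd f a)) h =
            (f \o shift a - (cst (f a) + 'd f a)) h by [].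
  by rewrite !fctE /= E ga.
have dE : 'd g a = 'd f a :> (V -> W) by apply: diff_unique.
by apply/diff_locallyP; rewrite dE; split.
Qed.

Section CkCalculus.
Context {R : realType} {V : normedModType R}.
Implicit Types (O : set V) (k : nat).

Lemma Ck_sub (W : normedModType R) k (O O' : set V) (f : V -> W) :
  O' `<=` O -> Ck k O f -> Ck k O' f.
Proof.
move=> sO; elim: k f => [|k IH] f /=.
  by move=> cf u /sO; apply: cf.
by move=> [df Df]; split=> [u /sO /df|v] //; apply: IH.
Qed.

(** The rules for sums, products and composites compute ['D_v] only at points of [O]. Openness lets
    regularity pass to the actual derivative, which at each point depends on nearby values alone. *)
Lemma Ck_eq (W : normedModType R) k O (f g : V -> W) :
  open O -> (forall u, O u -> f u = g u) -> Ck k O f -> Ck k O g.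
Proof.
move=> oO; elim: k f g => [|k IH] f g fg /=.
  move=> cf u Ou; rewrite /prop_for /continuous_at -fg //.
  apply: cvg_trans (cf u Ou); apply: near_eq_cvg.
  by near do apply: fg; apply: open_nbhs_nbhs.
have nfg u : O u -> {near u, f =1 g}.
  by move=> Ou; near do apply: fg; apply: open_nbhs_nbhs.
move=> [df Df]; split=> [u Ou|v].
  exact: near_eq_differentiable (nfg _ Ou) (df _ Ou).
by apply: IH (Df v) => u Ou; apply: near_eq_derive; apply: nfg.
Unshelve. all: by end_near. Qed.

Lemma CkS (W : normedModType R) k O (f : V -> W) : Ck k.+1 O f -> Ck k O f.
Proof.
elim: k f => [|k IH] f [df Df] /=.
  by move=> u /df; apply: differentiable_continuous.
by split=> // v; apply: IH.
Qed.

Lemma Ck_cst (W : normedModType R) k O (a : W) : Ck k O (cst a : V -> W).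
Proof.
elim: k a => [|k IH] a /=; first by move=> u _; apply: cvg_cst.
split=> // v.
have -> : 'D_v (cst a : V -> W) = cst 0.
  by apply/funext => u; rewrite derive_cst.
exact: IH.
Qed.

Lemma CkD (W : normedModType R) k O (f g : V -> W) :
  open O -> Ck k O f -> Ck k O g -> Ck k O (fun u => f u + g u).
Proof.
move=> oO; elim: k f g => [|k IH] f g /=.
  by move=> cf cg u Ou; apply: cvgD; [apply: cf|apply: cg].
move=> [df Df] [dg Dg]; split=> [u Ou|v].
  by apply: differentiableD; [apply: df|apply: dg].
apply: (@Ck_eq _ k O (fun u => 'D_v f u + 'D_v g u)) => //; last exact: IH.
move=> u Ou; rewrite -deriveD //.
  exact/diff_derivable/df.
exact/diff_derivable/dg.
Qed.

Lemma CkM k O (f g : V -> R^o) :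
  open O -> Ck k O f -> Ck k O g -> Ck k O (fun u => f u * g u : R^o).
Proof.
move=> oO; elim: k f g => [|k IH] f g.
  by move=> cf cg u Ou; apply: cvgM; [apply: cf|apply: cg].
move=> sf sg; have [df Df] := sf; have [dg Dg] := sg; split=> [u Ou|v].
  by apply: differentiableM; [apply: df|apply: dg].
apply: (@Ck_eq _ k O (fun u => f u * 'D_v g u + g u * 'D_v f u : R^o)) => //.
  move=> u Ou; have := @deriveM _ _ f g u v; rewrite [X in _ -> _ -> _ = X]/=.
  by move=> ->; [|apply: diff_derivable; apply: df|apply: diff_derivable; apply: dg].
apply: (@CkD R^o k O _ _ oO).
  exact: IH (CkS sf) (Dg v).
exact: IH (CkS sg) (Df v).
Qed.

Lemma Ck_sum (W : normedModType R) k O n (f : 'I_n -> V -> W) :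
  open O -> (forall i, Ck k O (f i)) -> Ck k O (fun u => \sum_i f i u).
Proof.
move=> oO; elim: n f => [|n IH] f cf.
  by rewrite (_ : (fun u => _) = cst 0);
    [exact: Ck_cst|apply/funext => u; rewrite big_ord0].
rewrite (_ : (fun u => _) = fun u => f ord0 u + \sum_i f (lift ord0 i) u);
  last by apply/funext => u; rewrite big_ord_recl.
apply: (CkD oO); first exact: cf.
exact: (IH (fun i => f (lift ord0 i))).
Qed.

Lemma CkV k O (f : V -> R^o) : open O -> (forall u, O u -> f u != 0) ->
  Ck k O f -> Ck k O (fun u => (f u)^-1 : R^o).
Proof.
move=> oO f0; elim: k => [|k IH].
  by move=> cf u Ou; apply: cvgV; [apply: f0|apply: cf].
move=> cf; have [df Df] := cf; split=> [u Ou|v].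
  by apply: differentiableV; [apply: df|apply: f0].
apply: (@Ck_eq _ k O (fun u => -1 * (((f u)^-1 * (f u)^-1) * 'D_v f u) : R^o)) => //.
  move=> u Ou; rewrite deriveV //; [|exact: f0|exact/diff_derivable/df].
  by rewrite /= mulN1r expr2 invfM scaleNr.
have cV := IH (CkS cf).
exact: CkM oO (@Ck_cst R^o k O (-1)) (CkM oO (CkM oO cV cV) (Df v)).
Qed.

(** Near [u] the function [f] keeps its sign, so [|f|] is there the constant [Num.sg (f u)] times
    [f], and the absolute value is gone before the chain rule is applied. *)
Lemma is_derive_ln_norm (f : V -> R^o) u v : differentiable f u ->
  f u != 0 -> differentiable (fun y => @ln R `|f y| : R^o) u /\
  'D_v (fun y => @ln R `|f y| : R^o) u = (f u)^-1 * 'D_v f u.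
Proof.
move=> df fu0.
pose h : V -> R^o := fun y => Num.sg (f u) * f y.
have hu : 0 < h u by rewrite /h -normrEsg normr_gt0.
have dh : differentiable h u.
  exact: (@differentiableM _ _ (cst (Num.sg (f u))) f).
have dl : differentiable (@ln R : R^o -> R^o) (h u).
  by apply/derivable1_diffP; have [] := @is_derive1_ln R _ hu.
have Dl : 'd (@ln R : R^o -> R^o) (h u) 1 = (h u)^-1.
  rewrite -deriveE //; exact: (@derive_val _ _ _ _ _ _ _ (is_derive1_ln hu)).
have near_h : {near u, (@ln R : R^o -> R^o) \o h =1 fun y => @ln R `|f y|}.
  have : \forall y \near u, 0 < h y.
    have ch : {for u, continuous h} by exact: differentiable_continuous.
    exact: (cvgr_gt (h u) ch).
  apply: filterS => y hy /=; congr ln.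
  have := hy; rewrite /h; case: (sgrP (f u)) => [|_|_]; rewrite ?mul0r ?ltxx //.
    by rewrite mul1r => f0; rewrite gtr0_norm.
  by rewrite mulN1r => f0; rewrite ltr0_norm // -oppr_gt0.
have dlh : differentiable ((@ln R : R^o -> R^o) \o h) u by exact: differentiable_comp.
split; first exact: near_eq_differentiable near_h dlh.
rewrite -(near_eq_derive v near_h) deriveE // diff_comp //=.
have -> : 'd h u v = 'd h u v *: (1 : R^o) by rewrite /GRing.scale /= mulr1.
rewrite linearZ /= Dl -deriveE //.
have -> : 'D_v h u = Num.sg (f u) * 'D_v f u.
  have := @deriveMl _ _ f (Num.sg (f u)) u v; rewrite /h => -> //.
  exact: diff_derivable.
rewrite /h /GRing.scale /= invfM mulrAC mulrA -mulrA mulrC.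
by rewrite -mulrA mulfV ?sgr_eq0 ?mulr1 // mulrC.
Qed.

(** Beyond order 0 the derivative is [f^-1 * 'D_v f], whose regularity follows from products and
    inverses. The logarithm occurs in [Gam Ip Ip Ip]. *)
Lemma Ck_ln k O (f : V -> R^o) : open O -> (forall u, O u -> f u != 0) ->
  Ck k O f -> Ck k O (fun u => @ln R `|f u| : R^o).
Proof.
move=> oO f0; case: k => [|k] cf.
  move=> u Ou; have fu := f0 u Ou.
  have cn : {for u, continuous (fun u => `|f u|)}.
    by apply: continuous_comp; [exact: cf|exact: norm_continuous].
  apply: (@continuous_comp _ _ _ (fun u => `|f u|) (@ln R)) => //.
  by apply: continuous_ln; rewrite normr_gt0.
have [df Df] := cf; split=> [u Ou|v].
  by have [] := is_derive_ln_norm 0 (df u Ou) (f0 u Ou).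
apply: (@Ck_eq _ k O (fun u => (f u)^-1 * 'D_v f u : R^o)) => //.
  by move=> u Ou; have [_ ->] := is_derive_ln_norm v (df u Ou) (f0 u Ou).
exact: CkM oO (CkV oO f0 (CkS cf)) (Df v).
Qed.

End CkCalculus.

(** * Vector-valued maps and the chain rule *)

Section CkVectors.
Context {R : realType}.

Lemma derive_comp (V W X : normedModType R) (h : V -> W) (f : W -> X) u v :
  differentiable h u -> differentiable f (h u) ->
  'D_v (f \o h) u = 'D_('D_v h u) f (h u).
Proof.
move=> dh df; have dfh := differentiable_comp dh df.
rewrite (deriveE _ dfh) (deriveE _ df) (deriveE _ dh).
by have -> := diff_comp dh df.
Qed.

Lemma derive_linear (V W : normedModType R) (f : V -> W) u a v w :
  differentiable f u -> 'D_(a *: v + w) f u = a *: 'D_v f u + 'D_w f u.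
Proof. by move=> df; rewrite !(deriveE _ df) linearP. Qed.

Lemma derive_coords n (W : normedModType R) (f : 'rV[R]_n -> W) u w :
  differentiable f u ->
  'D_w f u = \sum_i w 0 i *: 'D_(delta_mx 0 i) f u.
Proof.
move=> df; rewrite (deriveE _ df) {1}(row_sum_delta w) linear_sum.
by apply: eq_bigr => i _; rewrite linearZ (deriveE _ df).
Qed.

Lemma differentiable_rV (V : normedModType R) n (h : V -> 'rV[R]_n) u :
  (forall i, differentiable (fun y => h y 0 i : R^o) u) -> differentiable h u.
Proof.
move=> dh; have -> : h = \sum_i (fun y => h y 0 i *: delta_mx 0 i).
  by apply/funext => y; rewrite fct_sumE -row_sum_delta.
by apply: differentiable_sum => i; apply: differentiableZl; apply: dh.
Qed.

Lemma derive_rV (V : normedModType R) n (h : V -> 'rV[R]_n) u v i :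
  differentiable h u -> 'D_v h u 0 i = 'D_v (fun y => h y 0 i : R^o) u.
Proof. by move=> dh; rewrite derive_mx ?mxE //; exact: diff_derivable. Qed.

Lemma Ck_rV (V : normedModType R) k (O : set V) n (h : V -> 'rV[R]_n) :
  open O -> (forall i, Ck k O (fun u => h u 0 i : R^o)) -> Ck k O h.
Proof.
move=> oO; elim: k h => [|k IH] h ch.
  move=> u Ou; rewrite /prop_for /continuous_at.
  have -> : h = \sum_i (fun y => h y 0 i *: delta_mx 0 i).
    by apply/funext => y; rewrite fct_sumE -row_sum_delta.
  rewrite fct_sumE; apply: cvg_big => [|i _]; first exact: add_continuous.
  by apply: cvgZr_tmp; apply: ch.
have dh u : O u -> differentiable h u.
  by move=> Ou; apply: differentiable_rV => i; have [dh _] := ch i; apply: dh.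
split=> // v; apply: IH => i; have [_ /(_ v)] := ch i.
by apply: Ck_eq => // u Ou; rewrite derive_rV //; exact: dh.
Qed.

Lemma Ck_coord (V : normedModType R) k (O : set V) n (h : V -> 'rV[R]_n) i :
  open O -> Ck k O h -> Ck k O (fun u => h u 0 i : R^o).
Proof.
move=> oO; elim: k h => [|k IH] h.
  move=> ch u Ou; apply: (@continuous_comp _ _ _ h (fun M => M 0 i)).
    exact: ch.
  exact: coord_continuous.
move=> [dh Dh]; split=> [u Ou|v].
  apply: (@differentiable_comp _ _ _ _ h (fun M : 'rV_n => M 0 i : R^o)).
    exact: dh.
  exact: differentiable_coord.
by apply: Ck_eq (IH _ (Dh v)) => // u Ou; rewrite derive_rV //; exact: dh.
Qed.

Lemma Ck_id k n (O : set 'rV[R]_n) : Ck k O id.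
Proof.
case: k => [|k]; first by move=> u _; exact: cvg_id.
split=> // v.
have -> : 'D_v (id : 'rV[R]_n -> 'rV[R]_n) = cst v.
  by apply/funext => u; rewrite derive_id.
exact: Ck_cst.
Qed.

(** The chain rule differentiates [f] in the direction ['D_v h u], which varies with [u]. Splitting
    it along the standard basis leaves derivatives of [f] in fixed directions, to which the
    induction applies. *)
Lemma Ck_comp (V : normedModType R) k (O : set V) n (O' : set 'rV[R]_n)
    (h : V -> 'rV[R]_n) (f : 'rV[R]_n -> R^o) :
  open O -> (forall u, O u -> O' (h u)) ->
  Ck k O h -> Ck k O' f -> Ck k O (f \o h).
Proof.
move=> oO hO; elim: k f => [|k IH] f.
  move=> ch cf u Ou; apply: continuous_comp; first exact: ch.
  exact/cf/hO.
move=> ch cf; have [dh Dh] := ch; have [df Df] := cf; split=> [u Ou|v].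
  by apply: differentiable_comp; [apply: dh|apply/df/hO].
apply: (@Ck_eq _ _ R^o k O (fun u => \sum_i
   ('D_v h u 0 i * 'D_(delta_mx 0 i) f (h u)) : R^o)) => //.
  move=> u Ou; have dhu := dh u Ou; have dfu := df _ (hO u Ou).
  by rewrite (derive_comp _ dhu dfu) (derive_coords _ dfu).
apply: (@Ck_sum _ _ R^o k O) => // i.
exact: CkM oO (Ck_coord i oO (Dh v)) (IH _ (CkS ch) (Df _)).
Qed.

End CkVectors.

(** * Smooth functions and tangent vectors on manifolds *)

Lemma near_open (T : topologicalType) (u : T) (P : set T) :
  (\forall u' \near u, P u') -> exists B, [/\ open B, B u & B `<=` P].
Proof.
move=> nP; exists (interior P); split; [exact: open_interior|exact: nP|].
exact: interior_subset.
Qed.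

Section ManifoldCalculus.
Context {R : realType}.

(** The common core of changing charts, composing with a smooth map, and passing to or from a factor
    of a product: near [u] the map [h] stays in [O2]. *)
Lemma smooth_on_pullback (V : normedModType R) n (O1 : set V)
    (O2 : set 'rV[R]_n) (h : V -> 'rV[R]_n) (phi : 'rV[R]_n -> R^o)
    (psi : V -> R^o) u :
  open O1 -> O1 u -> smooth_on O1 h -> open O2 -> O2 (h u) ->
  smooth_on O2 phi -> (forall u', O1 u' -> psi u' = phi (h u')) ->
  exists B, [/\ open B, B u, B `<=` O1 & smooth_on B psi].
Proof.
move=> oO1 O1u sh oO2 O2u sphi E.
have : \forall u' \near u, O1 u' /\ O2 (h u').
  apply: filterS2 (open_nbhs_nbhs (conj oO1 O1u)) _; first by move=> ? ? H; split; [|exact: H].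
  by apply: (sh 0%N u O1u); apply: open_nbhs_nbhs.
move=> /near_open[B [oB Bu sB]]; exists B; split=> //.
  by move=> u' /sB[].
move=> k; apply: (@Ck_eq _ _ R^o k B (phi \o h)) => //.
  by move=> u' /sB[/E ->].
apply: (@Ck_comp _ _ k B n O2) => //; first by move=> u' /sB[].
by apply: Ck_sub (sh k) => u' /sB[].
Qed.

Section OneManifold.
Context {d : nat} {M : premanifold R d}.
Hypothesis HM : is_manifold M.
Implicit Types (f g : M -> R) (p q : M).

Lemma chart_at p : exists x u, [/\ atlas M x, cdom x u & x u = p].
Proof.
have [B [_ sB cB]] := mfd_countable HM.
by have [x [u [Bx xu xp]]] := cB p; exists x, u; split=> //; apply: sB.
Qed.

(** [smooth_at] quantifies over every chart through the point; transition maps make a single chart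
    sufficient. *)
Lemma smooth_at_chart f x u (O : set 'rV[R]_d) :
  atlas M x -> cdom x u -> open O -> O u -> smooth_on O (f \o x : _ -> R^o) ->
  smooth_at f (x u).
Proof.
move=> ax xu oO Ou sO y v ay yv yvE.
have [oD [h [sh hE]]] := mfd_transition HM ay ax.
have Dv : (cdom y `&` (y @^-1` (x @` cdom x))) v by split=> //=; exists u.
have hv : h v = u.
  have [xhv E] := hE _ Dv; apply: (mfd_inj HM ax) => //.
  by rewrite E.
have Ohv : O (h v) by rewrite hv.
have EE (v' : 'rV[R]_d) : (cdom y `&` (y @^-1` (x @` cdom x))) v' -> (f \o y) v' = (f \o x) (h v').
  by move=> /hE[_ /= ->].
have [B [oB Bv sB sBf]] := smooth_on_pullback oD Dv sh oO Ohv sO EE.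
by exists B; split=> // u' /sB[].
Qed.

(** Nearness is tested on chart parameters, where the derivatives behind tangent vectors are taken;
    [nearm_open] supplies it from open sets of the manifold. *)
Definition nearm p (P : set M) := forall x u, atlas M x -> cdom x u ->
  x u = p -> \forall u' \near u, P (x u').

Lemma nearm_open (U : set M) p : open_in U -> U p -> nearm p U.
Proof.
move=> oU Up x u ax xu E.
have : (cdom x `&` (x @^-1` U)) u by split=> //=; rewrite E.
by move=> H; apply: filterS (open_nbhs_nbhs (conj (oU _ ax) H)) => u' [].
Qed.

Lemma nearm_impl (P Q : set M) p :
  (forall q, P q -> Q q) -> nearm p P -> nearm p Q.
Proof.
move=> PQ nP x u ax xu E; apply: filterS (nP x u ax xu E) => u'; exact: PQ.
Qed.

Lemma nearmW (P : set M) p : (forall q, P q) -> nearm p P.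
Proof. by move=> HP x u _ _ _; apply: filterE => u'; exact: HP. Qed.

Lemma nearm_here (P : set M) p : nearm p P -> P p.
Proof.
have [x [u [ax xu E]]] := chart_at p.
by move=> /(_ x u ax xu E) /nbhs_singleton; rewrite E.
Qed.

Lemma nearm_smooth f p : smooth_at f p -> nearm p (smooth_at f).
Proof.
move=> sf x u ax xu E; have [ O [oO Ou sO sOf]] := sf x u ax xu E.
apply: filterS (open_nbhs_nbhs (conj oO Ou)) => u' Ou'.
by apply: (smooth_at_chart ax (sO _ Ou') oO Ou' sOf).
Qed.

Lemma smooth_at_near f g p :
  nearm p (fun q => f q = g q) -> smooth_at f p -> smooth_at g p.
Proof.
move=> nfg sf x u ax xu E; have [ O [oO Ou sO sOf]] := sf x u ax xu E.
have : \forall u' \near u, O u' /\ f (x u') = g (x u').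
  apply: filterS2 (open_nbhs_nbhs (conj oO Ou)) (nfg x u ax xu E).
  by move=> u'; split.
move=> /near_open[B [oB Bu sB]]; exists B; split=> //.
  by move=> u' /sB[/sO].
move=> k; apply: (@Ck_eq _ _ R^o k B (f \o x)) => //.
  by move=> u' /sB[].
by apply: Ck_sub (sOf k) => u' /sB[].
Qed.

Lemma smooth_at_diff f x u : atlas M x -> cdom x u -> smooth_at f (x u) ->
  differentiable (f \o x : _ -> R^o) u.
Proof.
move=> ax xu /(_ x u ax xu erefl)[ O [oO Ou sO sOf]].
by have [df _] := sOf 1%N; apply: df.
Qed.

Lemma smooth_at_cst a p : smooth_at (fun _ : M => a) p.
Proof.
move=> x u ax xu _; exists (cdom x); split=> //; first exact: (mfd_open HM).
by move=> k; apply: (@Ck_cst _ _ R^o).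
Qed.

Lemma smooth_at_op2 (op : R -> R -> R) f g p :
  (forall k (O : set 'rV[R]_d) (a b : 'rV[R]_d -> R^o), open O ->
     Ck k O a -> Ck k O b -> Ck k O (fun u => op (a u) (b u) : R^o)) ->
  smooth_at f p -> smooth_at g p -> smooth_at (fun q => op (f q) (g q)) p.
Proof.
move=> H sf sg x u ax xu E.
have [ O [oO Ou sO sOf]] := sf x u ax xu E.
have [ O' [oO' O'u sO' sOg]] := sg x u ax xu E.
exists (O `&` O'); split=> //; first exact: openI.
  by move=> u' [/sO].
move=> k; apply: H; first exact: openI.
  by apply: Ck_sub (sOf k) => ? [].
by apply: Ck_sub (sOg k) => ? [].
Qed.

Lemma smooth_atD f g p :
  smooth_at f p -> smooth_at g p -> smooth_at (fun q => f q + g q) p.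
Proof. by apply: smooth_at_op2 => k O a b oO; exact: (@CkD _ _ R^o). Qed.

Lemma smooth_atM f g p :
  smooth_at f p -> smooth_at g p -> smooth_at (fun q => f q * g q) p.
Proof. by apply: smooth_at_op2 => k O a b oO; exact: CkM. Qed.

Lemma smooth_at_sum n (f : 'I_n -> M -> R) p :
  (forall i, smooth_at (f i) p) -> smooth_at (fun q => \sum_i f i q) p.
Proof.
elim: n f => [|n IH] f sf.
  have -> : (fun q => \sum_i f i q) = (fun=> 0).
    by apply/funext => q; rewrite big_ord0.
  exact: smooth_at_cst.
have -> : (fun q => \sum_i f i q) =
          (fun q => f ord0 q + \sum_i f (lift ord0 i) q).
  by apply/funext => q; rewrite big_ord_recl.
apply: smooth_atD => //.
exact: (IH (fun i => f (lift ord0 i))).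
Qed.

Lemma smooth_at_ln f p :
  smooth_at f p -> f p != 0 -> smooth_at (fun q => ln `|f q|) p.
Proof.
move=> sf f0 x u ax xu E; have [ O [oO Ou sO sOf]] := sf x u ax xu E.
have : \forall u' \near u, O u' /\ f (x u') != 0.
  apply: filterS2 (open_nbhs_nbhs (conj oO Ou)) _; first by move=> ? ? H; split; [|exact: H].
  have cf : {for u, continuous (f \o x : _ -> R^o)} := sOf 0%N u Ou.
  apply: (@cvgr_neq0 _ R^o _ _ _ (f \o x) (f (x u)) cf).
  by rewrite E.
move=> /near_open[B [oB Bu sB]]; exists B; split=> //.
  by move=> u' /sB[/sO].
move=> k; apply: (@Ck_ln _ _ k B (f \o x)) => //.
  by move=> u' /sB[].
by apply: Ck_sub (sOf k) => u' /sB[].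
Qed.

(** The new direction is the image of the old one under the differential of the transition map. Two
    tangent vectors at [p] can thus be written in a common chart, and added. *)
Lemma tangent_chart p v x u : tangent p v -> atlas M x -> cdom x u ->
  x u = p -> exists w, forall f,
    v f = if `[< smooth_at f p >] then 'D_w (f \o x : _ -> R^o) u else 0.
Proof.
move=> [y [u' [w [ay yu' yE vE]]]] ax xu xE.
have [oD [h [sh hE]]] := mfd_transition HM ay ax.
have Du : (cdom y `&` (y @^-1` (x @` cdom x))) u'.
  by split=> //=; exists u => //; rewrite xE.
have hu : h u' = u.
  by have [xhv E] := hE _ Du; apply: (mfd_inj HM ax) => //; rewrite E yE.
have [dh _] := sh 1%N.
exists ('D_w h u') => f; rewrite vE; case: asboolP => // sf.
have dfx : differentiable (f \o x : _ -> R^o) (h u').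
  by rewrite hu; apply: smooth_at_diff; rewrite ?xE.
rewrite -hu -(derive_comp _ (dh _ Du) dfx).
apply: near_eq_derive.
apply: filterS (open_nbhs_nbhs (conj oD Du)) => u2 /hE[_].
by rewrite /= => ->.
Qed.

Section AtPoint.
Variables (p : M) (v : tvec M).
Hypothesis Tv : tangent p v.

Lemma tangent_local f g : nearm p (fun q => f q = g q) -> v f = v g.
Proof.
move=> nfg; have [x [u [w [ax xu E vE]]]] := Tv; rewrite !vE.
(* Smoothness at [p] is itself local, so both sides take the same branch of the test. *)
have -> : `[< smooth_at f p >] = `[< smooth_at g p >].
  apply: asbool_equiv_eq; split; apply: smooth_at_near => //.
  by move: nfg; apply: nearm_impl.
by case: ifP => // _; apply: near_eq_derive; exact: nfg.
Qed.

Lemma tangent_cst a : v (fun=> a) = 0.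
Proof.
have [x [u [w [ax xu E ->]]]] := Tv; case: asboolP => // _.
exact: (@derive_cst _ _ R^o).
Qed.

Lemma tangentD f g : smooth_at f p -> smooth_at g p ->
  v (fun q => f q + g q) = v f + v g.
Proof.
move=> sf sg; have [x [u [w [ax xu E vE]]]] := Tv; rewrite !vE.
rewrite !asboolT //; last exact: smooth_atD.
subst p; have df := smooth_at_diff ax xu sf; have dg := smooth_at_diff ax xu sg.
by apply: (@deriveD _ _ R^o (f \o x) (g \o x)); exact: diff_derivable.
Qed.

Lemma tangentM f g : smooth_at f p -> smooth_at g p ->
  v (fun q => f q * g q) = v f * g p + f p * v g.
Proof.
move=> sf sg; have [x [u [w [ax xu E vE]]]] := Tv; rewrite !vE.
rewrite !asboolT //; last exact: smooth_atM.
subst p; have df := smooth_at_diff ax xu sf; have dg := smooth_at_diff ax xu sg.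
rewrite [LHS](@deriveM _ _ (f \o x) (g \o x) u w);
  try exact: diff_derivable.
by rewrite addrC mulrC.
Qed.

Lemma tangent_sum n (f : 'I_n -> M -> R) :
  (forall i, smooth_at (f i) p) ->
  v (fun q => \sum_i f i q) = \sum_i v (f i).
Proof.
elim: n f => [|n IH] f sf.
  have -> : (fun q => \sum_i f i q) = (fun=> 0).
    by apply/funext => q; rewrite big_ord0.
  by rewrite tangent_cst big_ord0.
have -> : (fun q => \sum_i f i q) =
          (fun q => f ord0 q + \sum_i f (lift ord0 i) q).
  by apply/funext => q; rewrite big_ord_recl.
rewrite tangentD //; last exact: (@smooth_at_sum _ (fun i => f (lift ord0 i))).
by rewrite big_ord_recl (IH (fun i => f (lift ord0 i))).
Qed.

Lemma tangent_ln f : smooth_at f p -> f p != 0 ->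
  v (fun q => ln `|f q|) = v f / f p.
Proof.
move=> sf f0; have [x [u [w [ax xu E vE]]]] := Tv; rewrite !vE.
rewrite !asboolT //; last exact: smooth_at_ln.
subst p; have df := smooth_at_diff ax xu sf.
by have [_ ->] := is_derive_ln_norm w df f0; rewrite mulrC.
Qed.

End AtPoint.

Lemma tangent_lin p a (v w : tvec M) : tangent p v -> tangent p w ->
  tangent p (a *: v + w).
Proof.
move=> Tv Tw; have [x [u [v' [ax xu E vE]]]] := Tv.
have [w' wE] := tangent_chart Tw ax xu E.
exists x, u, (a *: v' + w'); split=> // f.
have -> : (a *: v + w) f = a * v f + w f by [].
rewrite vE wE; case: asboolP => [sf|_]; last by rewrite mulr0 addr0.
subst p; have df := smooth_at_diff ax xu sf.
by rewrite (derive_linear _ _ _ df).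
Qed.

Lemma tangent0 p : tangent p (0 : tvec M).
Proof.
have [x [u [ax xu E]]] := chart_at p.
exists x, u, 0; split=> // f; case: asboolP => // _.
by rewrite derive0.
Qed.

Lemma tangentZ p a (v : tvec M) : tangent p v -> tangent p (a *: v).
Proof. by move=> Tv; rewrite -[_ *: _]addr0; exact: tangent_lin Tv (tangent0 p). Qed.

Lemma tangent_add p (v w : tvec M) : tangent p v -> tangent p w -> tangent p (v + w).
Proof. by move=> Tv Tw; rewrite -[v]scale1r; exact: tangent_lin. Qed.

Lemma tangent_lincomb p n (a : 'I_n -> R) (e : 'I_n -> tvec M) :
  (forall i, tangent p (e i)) -> tangent p (\sum_i a i *: e i).
Proof.
move=> Te; elim/big_rec: _ => [|i w _ Tw]; first exact: tangent0.
exact: tangent_lin.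
Qed.

End OneManifold.

(** * Push-forward along a smooth map *)

Section TwoManifolds.
Context {d e : nat} {M : premanifold R d} {N : premanifold R e}.
Hypotheses (HM : is_manifold M) (HN : is_manifold N).
Variables (U : set M) (F : M -> N) (p : M).
Hypotheses (sF : smooth_map U F) (Up : U p).

Lemma smooth_at_comp f : smooth_at f (F p) -> smooth_at (f \o F) p.
Proof.
move=> sf x u ax xu E; have [y [v [ay yv yE]]] := chart_at HN (F p).
have [ O [h [oO Ou sO sh hE]]] := sF Up ax xu E ay yv yE.
have [ O' [oO' O'u sO' sOf]] := sf y v ay yv yE.
have hu : h u = v.
  by have [xhv H] := hE _ Ou; apply: (mfd_inj HN ay) => //; rewrite H E yE.
have O'h : O' (h u) by rewrite hu.
have H u' : O u' -> ((f \o F) \o x) u' = (f \o y) (h u') by move=> /hE[_ /= ->].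
have [B [oB Bu sB sBf]] := smooth_on_pullback oO Ou sh oO' O'h sOf H.
by exists B; split=> // u' /sB/sO.
Qed.

Lemma tangent_push v : tangent p v -> tangent (F p) (push F p v).
Proof.
move=> [x [u [w [ax xu E vE]]]].
have [y [u' [ay yu' yE]]] := chart_at HN (F p).
have [ O [h [oO Ou sO sh hE]]] := sF Up ax xu E ay yu' yE.
have hu : h u = u'.
  by have [xhv H] := hE _ Ou; apply: (mfd_inj HN ay) => //; rewrite H E yE.
have [dh _] := sh 1%N.
exists y, u', ('D_w h u); split=> // f.
rewrite /push; case: asboolP => // sf; rewrite vE asboolT; last exact: smooth_at_comp.
have dfy : differentiable (f \o y : _ -> R^o) (h u).
  by rewrite hu; apply: smooth_at_diff; rewrite ?yE.
rewrite -hu -(derive_comp _ (dh _ Ou) dfy).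
apply: near_eq_derive.
apply: filterS (open_nbhs_nbhs (conj oO Ou)) => u2 /hE[_].
by rewrite /= => ->.
Qed.

Lemma push_lin a (v w : tvec M) :
  push F p (a *: v + w) = a *: push F p v + push F p w.
Proof.
apply/funext => f; rewrite /push.
have -> : (a *: (fun f => if `[< smooth_at f (F p) >] then v (f \o F) else 0)
   + (fun f => if `[< smooth_at f (F p) >] then w (f \o F) else 0) : tvec N) f
  = a * (if `[< smooth_at f (F p) >] then v (f \o F) else 0)
   + (if `[< smooth_at f (F p) >] then w (f \o F) else 0) by [].
by case: ifP => // _; rewrite mulr0 addr0.
Qed.

End TwoManifolds.

Lemma preimage_open_in d e (M : premanifold R d) (N : premanifold R e)
    (F : M -> N) (V : set N) :
  is_manifold M -> is_manifold N ->
  smooth_map setT F -> open_in V -> open_in [set p | V (F p)].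
Proof.
move=> HM HN sF oV x ax; rewrite openE => u [xu /= VFx].
have [y [v [ay yv yE]]] := chart_at HN (F (x u)).
have [ O [h [oO Ou sO sh hE]]] := sF (x u) x u y v I ax xu erefl ay yv yE.
have hu : h u = v.
  by have [xhv H] := hE _ Ou; apply: (mfd_inj HN ay) => //; rewrite H yE.
have Vv : (cdom y `&` (y @^-1` V)) v by split=> //=; rewrite yE.
have H : \forall u' \near u, (cdom y `&` (y @^-1` V)) (h u').
  apply: (sh 0%N u Ou); rewrite hu; apply: open_nbhs_nbhs; split=> //.
  exact: oV.
apply: filterS2 (open_nbhs_nbhs (conj oO Ou)) H => u' Ou' [_ /= Vh].
by split=> /=; [exact: sO|have [_ <-] := hE _ Ou'].
Qed.

End ManifoldCalculus.

(** * Push-forward of brackets, and the trivial bundle *)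

Section Related.
Context {R : realType} {d e : nat} {M : premanifold R d} {N : premanifold R e}.
Hypotheses (HM : is_manifold M) (HN : is_manifold N).
Variables (F : M -> N).
Hypothesis (sF : smooth_map setT F).

Lemma nearm_comp p (P : set N) :
  nearm (F p) P -> nearm p (fun q => P (F q)).
Proof.
move=> nP x u ax xu E; have [y [v [ay yv yE]]] := chart_at HN (F p).
have [ O [h [oO Ou sO sh hE]]] := sF I ax xu E ay yv yE.
have hu : h u = v.
  by have [xhv H] := hE _ Ou; apply: (mfd_inj HN ay) => //; rewrite H E yE.
have H : \forall u' \near u, [set v' | P (y v')] (h u').
  by apply: (sh 0%N u Ou); rewrite hu; exact: nP.
apply: filterS2 (open_nbhs_nbhs (conj oO Ou)) H => u' Ou'.
by have [_ /= ->] := hE _ Ou'.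
Qed.

Lemma push_related (X : vector_field M) (X' : vector_field N) p f :
  nearm p (fun q => push F q (X q) = X' (F q)) -> smooth_at f (F p) ->
  nearm p (fun q => X q (f \o F) = X' (F q) f).
Proof.
move=> rX sf x u ax xu E.
have := nearm_comp (nearm_smooth HN sf) ax xu E.
apply: filterS2 (rX x u ax xu E) => u' {}rX sf'.
by rewrite -rX /push asboolT.
Qed.

(** The iterated derivative differentiates [Y f] itself, so relatedness is required near [p] and not
    at [p] alone. Smoothness of [X' f] and [Y' f] keeps [push] off its default value 0. *)
Lemma push_lie (X Y : vector_field M) (X' Y' : vector_field N) p :
  tangent p (X p) -> tangent p (Y p) ->
  nearm p (fun q => push F q (X q) = X' (F q)) ->
  nearm p (fun q => push F q (Y q) = Y' (F q)) ->
  (forall f, smooth_at f (F p) -> smooth_at (fun q => X' q f) (F p)) ->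
  (forall f, smooth_at f (F p) -> smooth_at (fun q => Y' q f) (F p)) ->
  push F p (lie X Y p) = lie X' Y' (F p).
Proof.
move=> TX TY rX rY sX sY; apply/funext => f; rewrite /push /lie.
case: asboolP => // sf; rewrite asboolT; last exact: smooth_at_comp sF _ _ sf.
rewrite (tangent_local TX (push_related rY sf)).
rewrite (tangent_local TY (push_related rX sf)).
rewrite -(nearm_here HM rX) -(nearm_here HM rY) /push.
by rewrite !asboolT //; [exact: sX|exact: sY].
Qed.

End Related.

Section LieZero.
Context {R : realType} {d : nat} {M : premanifold R d}.

Lemma lie0r (X : vector_field M) p :
  tangent p (X p) -> lie X (fun=> 0) p = 0.
Proof.
move=> TX; apply/funext => f; rewrite /lie; case: ifP => // _.
by rewrite subr0 (tangent_cst TX).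
Qed.

End LieZero.

(** * Coordinates on the structure groups *)

Section GroupCharts.
Context {R : realType}.

Lemma gspace_chart1 (A : structure_group) :
  exists (y : chart R (gspace R A) 1) v,
    [/\ atlas (gspace R A) y, cdom y v & y v = gexp A 0].
Proof.
case: A => /=.
  by exists (Chart setT (fun u : 'rV[R]_1 => u 0 0)), 0; split=> //=; rewrite mxE.
exists (Chart [set u : 'rV[R]_1 | `|u 0 0 - 0| < pi] (fun u => expi (u 0 0))), 0.
split=> /=; first by exists 0.
  by rewrite mxE subr0 normr0 pi_gt0.
by rewrite mxE.
Qed.

(** Both groups are parametrized by their exponential, so translation by [gexp A t] shifts the
    parameter. As [y] is a total function, this holds even where the shifted parameter leaves the
    domain of the chart. *)
Lemma gmul_chart (A : structure_group) (y : chart R (gspace R A) 1) v t :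
  atlas (gspace R A) y -> gmul (y v) (gexp A t) = y (v + const_mx t).
Proof.
case: A y => /= y; first by move=> ->; rewrite /= !mxE.
by move=> [a ->] /=; apply: val_inj; rewrite /= !mxE cosD sinD addrC [in X in (_, X)]addrC.
Qed.

(** One induction serves both functions, each being up to sign the derivative of the other. *)
Lemma Ck_cos_sin k (O : set 'rV[R]_1) : open O ->
  Ck k O (fun u => cos (u 0 0) : R^o) /\ Ck k O (fun u => sin (u 0 0) : R^o).
Proof.
move=> oO; elim: k => [|k [IHc IHs]].
  split=> u _; apply: (@continuous_comp _ _ _ (fun M : 'rV[R]_1 => M 0 0)).
  - exact: coord_continuous.
  - exact: continuous_cos.
  - exact: coord_continuous.
  - exact: continuous_sin.
have dc (u : 'rV[R]_1) : differentiable (fun M : 'rV[R]_1 => M 0 0 : R^o) u.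
  exact: differentiable_coord.
have Dc (u v : 'rV[R]_1) : 'D_v (fun M : 'rV[R]_1 => M 0 0 : R^o) u = v 0 0.
  by rewrite -(@derive_rV _ _ _ id) // derive_id.
have Dcomp (f : R^o -> R^o) (u v : 'rV[R]_1) df : is_derive (u 0 0) 1 f df ->
  differentiable (fun M : 'rV[R]_1 => f (M 0 0) : R^o) u /\
  'D_v (fun M : 'rV[R]_1 => f (M 0 0) : R^o) u = v 0 0 * df.
  move=> Hf; have dfu : differentiable f (u 0 0).
    by apply/derivable1_diffP; have [] := Hf.
  split.
    exact: (@differentiable_comp _ _ _ _ (fun M : 'rV[R]_1 => M 0 0 : R^o) f u (dc u) dfu).
  have -> := @derive_comp _ _ _ _ (fun M : 'rV[R]_1 => M 0 0 : R^o) f u v (dc u) dfu.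
  rewrite Dc; have := derive_linear (v 0 0) (1 : R^o) (0 : R^o) dfu.
  by rewrite derive0 !addr0 (@derive_val _ _ _ _ _ _ _ Hf) [_ *: 1]mulr1.
split; split=> [u _|v].
- by have [] := Dcomp _ u 0 _ (is_derive_cos (u 0 0)).
- apply: (@Ck_eq _ _ R^o k O (fun u => (- v 0 0) * sin (u 0 0) : R^o)) => //.
    by move=> u _; have [_ ->] := Dcomp _ u v _ (is_derive_cos (u 0 0)); rewrite mulNr mulrN.
  by apply: CkM => //; exact: (@Ck_cst _ _ R^o).
- by have [] := Dcomp _ u 0 _ (is_derive_sin (u 0 0)).
- apply: (@Ck_eq _ _ R^o k O (fun u => v 0 0 * cos (u 0 0) : R^o)) => //.
    by move=> u _; have [_ ->] := Dcomp _ u v _ (is_derive_sin (u 0 0)).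
  by apply: CkM => //; exact: (@Ck_cst _ _ R^o).
Qed.

(** Restrictions of linear functions of the plane: the coordinate on the circle chosen in
    [group_coordinate] and its derivative both have this form. *)
Lemma smooth_circle (a b : R) (z : circle) :
  smooth_at (fun w : @circle R => a * (val w).1 + b * (val w).2) z.
Proof.
move=> _ u [c ->] /= ux _.
have oD : open [set u : 'rV[R]_1 | `|u 0 0 - c| < pi].
  have ct : continuous (fun u : 'rV[R]_1 => `|u 0 0 - c|).
    move=> M; apply: (@continuous_comp _ _ _ (fun u : 'rV[R]_1 => u 0 0 - c) (fun r => `|r|)).
      have oT : open [set: 'rV[R]_1] by exact: openT.
      exact: (@CkD _ _ R^o 0 _ _ _ oT (Ck_coord 0 oT (@Ck_id _ 0 1 _))
        (@Ck_cst _ _ R^o 0 _ (- c)) M I).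
    exact: norm_continuous.
  exact: (open_comp (fun M _ => ct M) (@open_lt R pi)).
exists [set u : 'rV[R]_1 | `|u 0 0 - c| < pi]; split=> // k.
have [Cc Cs] := Ck_cos_sin k oD.
apply: (@CkD _ _ R^o k _ _ _ oD); apply: CkM => //; exact: (@Ck_cst _ _ R^o).
Qed.

(* phi is a local coordinate on the group near a and phi' its derivative along the
   fundamental field. *)
Lemma group_coordinate (A : structure_group) (a : gspace R A) :
  exists phi phi' : gspace R A -> R,
    [/\ forall b, smooth_at phi b, forall b, smooth_at phi' b,
        forall b, derive1 (fun t : R => phi (gmul b (gexp A t)) : R^o) 0 = phi' b
      & phi' a != 0].
Proof.
case: A a => /= a.
  exists id, (fun=> 1); split=> [b|b|b|]; last exact: oner_neq0.
  - move=> _ u -> _ _; exists setT; split=> //; first exact: openT.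
    by move=> k; apply: (@Ck_coord _ _ k setT 1 id 0) => //; [exact: openT|exact: Ck_id].
  - move=> _ u -> _ _; exists setT; split=> //; first exact: openT.
    by move=> k; apply: (@Ck_cst _ _ R^o).
  - rewrite derive1E [LHS](deriveD (@derivable_cst _ _ _ (b : R^o) (0 : R^o) (1 : R^o))
      (@derivable_id _ _ (0 : R^o) (1 : R^o))).
    by rewrite derive_cst derive_id add0r.
(* The sine of the angle from [a] to [w]; the next witness is its cosine, which is 1 at [a]. Both
   are smooth on the whole circle. *)
exists (fun w => - (val a).2 * (val w).1 + (val a).1 * (val w).2).
exists (fun w => (val a).1 * (val w).1 + (val a).2 * (val w).2).
split; [exact: smooth_circle|exact: smooth_circle| |].
  move=> b /=; rewrite derive1E; set a1 := (val a).1; set a2 := (val a).2.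
  set b1 := (val b).1; set b2 := (val b).2.
  have -> : (fun t : R => - a2 * (b1 * cos t - b2 * sin t) +
      a1 * (b1 * sin t + b2 * cos t)) =
    (fun t => (a1 * b2 - a2 * b1) * cos t + (a1 * b1 + a2 * b2) * sin t).
    by apply/funext => t; ring.
  have H (c1 c2 : R) : is_derive (0 : R^o) (1 : R^o)
      (fun t : R^o => c1 * cos t + c2 * sin t : R^o)
      (c1 *: - sin (0 : R^o) + c2 *: cos (0 : R^o)).
    exact: (is_deriveD (is_deriveZ c1 (is_derive_cos 0))
      (is_deriveZ c2 (is_derive_sin 0))).
  rewrite (@derive_val _ _ _ _ _ _ _ (H _ _)) /GRing.scale /= sin0 cos0; ring.
by have := valP a; rewrite /unit_norm -!expr2 => /eqP ->; exact: oner_neq0.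
Qed.

End GroupCharts.

(** * The product bundle and its fundamental field *)

Section ProductBundle.
Context {R : realType} {d : nat} {S : premanifold R d} {A : structure_group}.
Let M := prod_space S (gspace R A).
Hypotheses (HM : is_manifold M) (HS : is_manifold S).

Lemma smooth_on_rsub (O : set 'rV[R]_(d + 1)) : open O -> smooth_on O rsubmx.
Proof.
move=> oO k; apply: Ck_rV => // i.
apply: (@Ck_eq _ _ R^o k O (fun u => u 0 (rshift d i) : R^o)) => //.
  by move=> u _; rewrite mxE.
exact: Ck_coord (Ck_id _ _).
Qed.

Lemma smooth_on_row (O : set 'rV[R]_d) (c : 'rV[R]_1) :
  open O -> smooth_on O (fun u => row_mx u c).
Proof.
move=> oO k; apply: Ck_rV => // i; case: (split_ordP i) => j ->.
  apply: (@Ck_eq _ _ R^o k O (fun u => u 0 j : R^o)) => //.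
    by move=> u _; rewrite row_mxEl.
  exact: Ck_coord (Ck_id _ _).
apply: (@Ck_eq _ _ R^o k O (cst (c 0 j))) => //.
  by move=> u _; rewrite row_mxEr.
exact: Ck_cst.
Qed.

Lemma smooth_at_snd (phi : gspace R A -> R) (x : M) :
  smooth_at phi x.2 -> smooth_at (fun y : M => phi y.2) x.
Proof.
move=> sphi z w az zw E; have oz := mfd_open HM az.
case: az => xs [y [axs ay zE]]; subst z x; have [xw yw] := zw.
have [ O [oO Ou sO sOphi]] := sphi y (rsubmx w) ay yw erefl.
have [B [oB Bw sB sBf]] := smooth_on_pullback oz zw (smooth_on_rsub oz) oO Ou sOphi
  (fun u' _ => erefl).
by exists B; split.
Qed.

(** Restriction to the slice through the identity of the group. It brings smoothness down from [M]
    to [S], as needed for the fundamental field of the action on [S]. *)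
Lemma smooth_at_slice (f : S -> R) s :
  smooth_at (fun y : M => f y.1) (s, gexp A 0) -> smooth_at f s.
Proof.
move=> sf x u ax xu E; have [y [v [ay yv yE]]] := @gspace_chart1 R A.
have az : atlas M (prod_chart x y) by exists x, y.
have zw : cdom (prod_chart x y) (row_mx u v) by rewrite /= row_mxKl row_mxKr.
have zE : prod_chart x y (row_mx u v) = (s, gexp A 0).
  by rewrite /= row_mxKl row_mxKr E yE.
have [ O [oO Ou sO sOf]] := sf _ _ az zw zE.
have oD := mfd_open HS ax.
have H u' : cdom x u' -> (f \o x) u' =
    ((fun y : M => f y.1) \o prod_chart x y : _ -> R^o) (row_mx u' v).
  by move=> _; rewrite /= row_mxKl.
have [B [oB Bu sB sBf]] := smooth_on_pullback oD xu (smooth_on_row v oD) oO Ou sOf H.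
by exists B; split.
Qed.

(** In a product chart the orbit is a straight line along the last coordinate, so the fundamental
    field has a constant direction there. *)
Lemma fundamental_chart (f : M -> R) x (y : chart R (gspace R A) 1) w :
  atlas (gspace R A) y ->
  derive1 (fun t : R => f (triv_act (prod_chart x y w) (gexp A t)) : R^o) 0
  = 'D_(row_mx 0 (const_mx 1)) (f \o prod_chart x y : _ -> R^o) w.
Proof.
move=> ay.
have E t : triv_act (prod_chart x y w) (gexp A t) =
    prod_chart x y (t *: row_mx 0 (const_mx 1) + w).
  rewrite /triv_act /= gmul_chart // linearD linearZ /= row_mxKl scaler0 add0r.
  rewrite linearD linearZ /= row_mxKr addrC; congr (_, y (_ + _)).
  by apply/matrixP => i j; rewrite !mxE mulr1.
rewrite /derive1 /derive.
set F1 := fun h => _; set F2 := fun h => _; suff -> : F1 = F2 by [].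
by apply/funext => h; rewrite /F1 /F2 /= !E addr0 scale0r add0r.
Qed.

Lemma tangent_fundamental (x : M) : tangent x (fundamental (@triv_act R d S A) x).
Proof.
have [z [w [az zw <-]]] := chart_at HM x.
exists z, w; case: (az) => xs [y [axs ay zE]]; subst z.
exists (row_mx 0 (const_mx 1)); split=> // f.
by rewrite /fundamental; case: asboolP => // _; rewrite fundamental_chart.
Qed.

Lemma smooth_fundamental (f : M -> R) (x : M) : smooth_at f x ->
  smooth_at (fun y => fundamental (@triv_act R d S A) y f) x.
Proof.
move=> sf z w az zw E; have [ O [oO Ow sO sOf]] := sf z w az zw E.
exists O; split=> // k.
apply: (@Ck_eq _ _ R^o k O ('D_(row_mx 0 (const_mx 1)) (f \o z : _ -> R^o))) => //.
  move=> u Ou; rewrite /= /fundamental asboolT; last first.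
    exact: (smooth_at_chart HM az (sO _ Ou) oO Ou sOf).
  by case: az => xs [y [axs ay zE]]; subst z; rewrite fundamental_chart.
by have [_] := sOf k.+1; apply.
Qed.

End ProductBundle.

(** * Frames and the Koszul formula *)

Section Frames.
Context {R : realType} {d : nat} {M : premanifold R d}.
Hypothesis HM : is_manifold M.

(** A dimension count in matrix form: the matrix [P] of the [X i] in the basis [e] has trivial left
    kernel by independence, hence is invertible, and [invmx P] converts the coordinates of [v]. *)
Lemma tangent_span p n (e : 'I_d -> tvec M) (X : 'I_n -> tvec M) v :
  n = d -> basis_at p e -> (forall i, tangent p (X i)) ->
  (forall a : 'rV[R]_n, \sum_i a 0 i *: X i = 0 -> a = 0) ->
  tangent p v -> exists a : 'I_n -> R, v = \sum_i a i *: X i.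
Proof.
move=> nd; subst n => -[_ be] TX indep Tv.
have [P0 P0U] := choice (fun i => be _ (TX i)).
have P0E i : X i = \sum_j P0 i 0 j *: e j by have [] := P0U i.
pose P := \matrix_i P0 i.
have PX (a : 'rV[R]_d) : \sum_i a 0 i *: X i = \sum_j (a *m P) 0 j *: e j.
  under eq_bigr do rewrite P0E scaler_sumr.
  rewrite exchange_big /=; apply: eq_bigr => j _.
  by rewrite !mxE scaler_suml; apply: eq_bigr => i _; rewrite mxE scalerA.
have Pu : P \in unitmx.
  rewrite -row_free_unit -kermx_eq0; apply/eqP/row_matrixP => i.
  rewrite row0; apply: indep; rewrite PX -row_mul mulmx_ker.
  by rewrite big1 // => j _; rewrite !mxE scale0r.
have [b [bE _]] := be _ Tv; exists (fun i => (b *m invmx P) 0 i).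
by rewrite PX mulmxKV.
Qed.

Section Form.
Variables (g : two_tensor M).
Hypothesis Hg : sym_form (@tangent R d M) g.
Variable p : M.
Implicit Types v w : tvec M.

Lemma symform0l w : tangent p w -> g p 0 w = 0.
Proof.
move=> Tw; have T0 := tangent0 HM p.
have := form_lin Hg 1 T0 T0 Tw; rewrite scale1r addr0 mul1r => /eqP.
by rewrite -subr_eq0 opprD addNKr oppr_eq0 => /eqP.
Qed.

Lemma symformZl a v w : tangent p v -> tangent p w -> g p (a *: v) w = a * g p v w.
Proof.
move=> Tv Tw; have := form_lin Hg a Tv (tangent0 HM p) Tw.
by rewrite addr0 symform0l // addr0.
Qed.

Lemma symformDl v v' w : tangent p v -> tangent p v' -> tangent p w ->
  g p (v + v') w = g p v w + g p v' w.
Proof. by move=> Tv Tv' Tw; have := form_lin Hg 1 Tv Tv' Tw; rewrite scale1r mul1r. Qed.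

Lemma symformBl v v' w : tangent p v -> tangent p v' -> tangent p w ->
  g p (v - v') w = g p v w - g p v' w.
Proof.
by move=> Tv Tv' Tw; rewrite addrC -scaleN1r (form_lin Hg) // mulN1r addrC.
Qed.

Lemma symform_suml n (a : 'I_n -> R) (e : 'I_n -> tvec M) w :
  (forall i, tangent p (e i)) -> tangent p w ->
  g p (\sum_i a i *: e i) w = \sum_i a i * g p (e i) w.
(* Linearity of [g] is available on tangent vectors only, so tangency of the partial sums is carried
   through the induction. *)
Proof.
move=> Te Tw; suff [] : tangent p (\sum_i a i *: e i) /\
   g p (\sum_i a i *: e i) w = \sum_i a i * g p (e i) w by [].
elim/big_rec2: _ => [|i y v _ [Tv <-]]; first by rewrite symform0l //; split=> //; exact: tangent0.
by rewrite (form_lin Hg) //; split=> //; exact: tangent_lin.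
Qed.

End Form.

(** A row in the left kernel gives a combination orthogonal to every [e j], hence to itself.
    Positivity makes the combination zero, and uniqueness of coordinates makes the row zero. *)
Lemma gram_unitmx (g : two_tensor M) p n (e : 'I_n -> tvec M) :
  riemannian g -> basis_at p e ->
  (\matrix_(i, j) g p (e i) (e j)) \in unitmx.
Proof.
move=> [Hg pos] [Te be]; rewrite -row_free_unit -kermx_eq0.
apply/eqP/row_matrixP => i; rewrite row0.
set G := \matrix_(_, _) _; set a := row i (kermx G).
have aG : a *m G = 0 by rewrite -row_mul mulmx_ker row0.
have Tv : tangent p (\sum_k a 0 k *: e k) by exact: tangent_lincomb.
have H j : g p (e j) (\sum_k a 0 k *: e k) = 0.
  rewrite (form_sym Hg) // (symform_suml Hg) //.
  transitivity ((a *m G) 0 j); last by rewrite aG mxE.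
  by rewrite mxE; apply: eq_bigr => k _; rewrite [G k j]mxE.
have v0 : \sum_k a 0 k *: e k = 0.
  apply: contrapT => /(pos p _ Tv); rewrite (symform_suml Hg) // big1 ?ltxx //.
  by move=> k _; rewrite H mulr0.
have [b [_ bU]] := be _ (tangent0 HM p).
rewrite -(bU a) ?v0 // -(bU 0) //.
by rewrite big1 // => k _; rewrite mxE scale0r.
Qed.

Lemma lie_antisym (X Y : vector_field M) p : lie Y X p = - lie X Y p.
Proof.
apply/funext => f; rewrite /lie.
have -> : (- (fun f0 => if `[< smooth_at f0 p >] then
   X p (fun q => Y q f0) - Y p (fun q => X q f0) else 0) : tvec M) f =
  - (if `[< smooth_at f p >] then
   X p (fun q => Y q f) - Y p (fun q => X q f) else 0) by [].
by case: ifP => _; rewrite ?opprB ?oppr0.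
Qed.

(** * The Koszul formula *)

Section LeviCivita.
Variables (g : two_tensor M) (D : vector_field M -> vector_field M -> vector_field M).
Hypothesis Hg : sym_form (@tangent R d M) g.
Hypothesis HD : levi_civita g D.
Variable U : set M.
Hypothesis oU : open_in U.
Local Notation vf := (vfield (@tangent R d M) U).

Lemma lc_tangent (X Y : vector_field M) p : vf X -> vf Y -> U p ->
  tangent p (D X Y p).
Proof.
by move=> vX vY Up; have [/(_ p Up)[TD _] _] := lc_field HD oU vX vY.
Qed.

Lemma lc_lie_tangent (X Y : vector_field M) p : vf X -> vf Y -> U p ->
  tangent p (lie X Y p).
Proof.
move=> vX vY Up; rewrite -(lc_torsion HD oU vX vY Up) addrC -scaleN1r.
by apply: (tangent_lin HM); exact: lc_tangent.
Qed.

(** Metric compatibility and vanishing torsion turn the right side into twelve products: ten cancel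
    in pairs, and two copies of the left side remain. *)
Lemma koszul (X Y Z : vector_field M) p : vf X -> vf Y -> vf Z -> U p ->
  g p (D X Y p) (Z p) =
  (X p (fun q => g q (Y q) (Z q)) + Y p (fun q => g q (X q) (Z q))
   - Z p (fun q => g q (X q) (Y q)) + g p (lie X Y p) (Z p)
   - g p (lie X Z p) (Y p) - g p (lie Y Z p) (X p)) / 2.
Proof.
move=> vX vY vZ Up.
have T W : vf W -> tangent p (W p) by move=> [/(_ p Up)[]].
have TX := T _ vX; have TY := T _ vY; have TZ := T _ vZ.
have TD W W' vW vW' := @lc_tangent W W' p vW vW' Up.
rewrite (lc_metric HD oU vX vY vZ Up) (lc_metric HD oU vY vX vZ Up).
rewrite (lc_metric HD oU vZ vX vY Up).
rewrite -(lc_torsion HD oU vX vY Up) -(lc_torsion HD oU vX vZ Up).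
rewrite -(lc_torsion HD oU vY vZ Up).
rewrite !(symformBl Hg) //; try exact: TD.
rewrite (form_sym Hg (v := Y p) (w := D X Z p)) //; last exact: TD.
rewrite (form_sym Hg (v := X p) (w := D Y Z p)) //; last exact: TD.
rewrite (form_sym Hg (v := X p) (w := D Z Y p)) //; last exact: TD.
by field.
Qed.

End LeviCivita.

End Frames.

(** * Inversion of the Gram matrix *)

Section LinearSystem.
Context {R : realFieldType} {d : nat}.
Variables (G Gi : 'I_d -> 'I_d -> R) (gam : 'I_d -> R) (s al be : R).

Local Notation gl i := (\sum_k gam k * G k i).
Local Notation gg := (\sum_m \sum_k gam m * gam k * G m k).

(* Coefficients of v on the adapted frame in terms of K k = g(v, E_k),
   Kp = g(v, p_o) and Kq = g(v, q_o). *)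
Definition frame_coefE (K : 'I_d -> R) (Kp : R) m :=
  (\sum_k Gi m k * K k) / s - gam m * Kp / (s * al).
Definition frame_coefp (K : 'I_d -> R) (Kp Kq : R) :=
  2 * Kq / (s * al) - (\sum_k gam k * K k) / (al * s)
  + Kp * gg / (s * al ^+ 2) - 2 * Kp * be / (s * al ^+ 2).
Definition frame_coefq (Kp : R) := 2 * Kp / (s * al).

Hypothesis Gsym : forall i j, G i j = G j i.
Hypothesis GiG : forall m j, \sum_k Gi m k * G k j = (m == j)%:R.
Hypothesis GGi : forall m j, \sum_k G m k * Gi k j = (m == j)%:R.
Hypotheses (s0 : s != 0) (al0 : al != 0).

Lemma sum_delta (u : 'I_d -> R) m : \sum_k u k * (k == m)%:R = u m.
Proof.
rewrite (bigD1 m) //= eqxx mulr1 big1 ?addr0 // => k /negbTE ->.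
by rewrite mulr0.
Qed.

Lemma Gi_gl m : \sum_k Gi m k * gl k = gam m.
Proof.
under eq_bigr do rewrite mulr_sumr.
rewrite exchange_big /= -[RHS]sum_delta; apply: eq_bigr => j _.
rewrite eq_sym -GiG mulr_sumr; apply: eq_bigr => k _; rewrite (Gsym j k); ring.
Qed.

Lemma gam_gl : \sum_k gam k * gl k = gg.
Proof.
apply: eq_bigr => m _; rewrite mulr_sumr; apply: eq_bigr => k _.
by rewrite (Gsym k m) mulrA.
Qed.

(** The system is triangular. As [p_o] is null and orthogonal to the [E_k], its equation contains
    [C] alone; inverting [G] then gives [A], and the last equation gives [B]. *)
Lemma frame_coef_system (A : 'I_d -> R) B C (K : 'I_d -> R) Kp Kq :
  [/\ forall k, \sum_m A m * (s * G m k) + C * (s / 2 * gl k) = K k,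
      C * (s * al / 2) = Kp &
      \sum_m A m * (s / 2 * gl m) + B * (s * al / 2) + C * (s * be / 2) = Kq]
  <-> (forall m, A m = frame_coefE K Kp m) /\ B = frame_coefp K Kp Kq /\ C = frame_coefq Kp.
Proof.
have gA : \sum_m A m * (s / 2 * gl m) = s / 2 * \sum_m A m * gl m.
  by rewrite mulr_sumr; apply: eq_bigr => m _; ring.
split.
- move=> [HA HC HB].
  have CE : C = frame_coefq Kp by rewrite /frame_coefq -HC; field; apply/andP.
  have rE k : \sum_m A m * G m k = K k / s - C * gl k / 2.
    rewrite -HA; have -> : \sum_m A m * (s * G m k) = s * \sum_m A m * G m k.
      by rewrite mulr_sumr; apply: eq_bigr => m _; ring.
    by field.
  have AE m : A m = (\sum_k Gi m k * K k) / s - C * gam m / 2.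
    transitivity (\sum_k Gi m k * \sum_n A n * G n k).
      under [RHS]eq_bigr do rewrite mulr_sumr.
      rewrite exchange_big /= -[LHS]sum_delta; apply: eq_bigr => j _.
      rewrite eq_sym -GiG mulr_sumr; apply: eq_bigr => k _; rewrite (Gsym j k); ring.
    under eq_bigr do rewrite rE.
    rewrite -[in RHS](Gi_gl m).
    rewrite [in RHS]mulr_suml [in RHS]mulr_sumr [in RHS]mulr_suml -sumrB.
    by apply: eq_bigr => k _; field.
  (* [B] depends on [A] only through this contraction with the lowered [gam], which is also [gam]
     contracted with the sums already known from [rE]. Hence [frame_coefp] contains [gam] and [gg]
     but no inverse matrix. *)
  have gAE : \sum_m A m * gl m = (\sum_k gam k * K k) / s - C * gg / 2.
    rewrite -gam_gl [in RHS]mulr_suml [in RHS]mulr_sumr [in RHS]mulr_suml -sumrB.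
    transitivity (\sum_k gam k * \sum_m A m * G m k).
      under eq_bigr do rewrite mulr_sumr.
      rewrite exchange_big /=; apply: eq_bigr => k _; rewrite mulr_sumr.
      by apply: eq_bigr => m _; rewrite (Gsym k m); ring.
    by apply: eq_bigr => k _; rewrite rE; ring.
  split; first by move=> m; rewrite AE CE /frame_coefE /frame_coefq; field; apply/andP.
  split=> //; rewrite /frame_coefp -HB gA gAE CE /frame_coefq; field.
  by apply/andP.
- move=> [HA [HB HC]].
  have AE m : A m = (\sum_k Gi m k * K k) / s - C * gam m / 2.
    by rewrite HA HC /frame_coefE /frame_coefq; field; apply/andP.
  have AG k : \sum_m A m * G m k = K k / s - C * gl k / 2.
    under eq_bigr do rewrite AE mulrBl.
    rewrite sumrB; congr (_ - _).
      transitivity (\sum_m (\sum_l Gi m l * K l * G m k / s)).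
        apply: eq_bigr => m _; rewrite !mulr_suml; apply: eq_bigr => l _; ring.
      rewrite exchange_big /= -[K k](sum_delta) mulr_suml; apply: eq_bigr => l _.
      rewrite eq_sym -GGi mulr_sumr mulr_suml; apply: eq_bigr => m _.
      by rewrite (Gsym k m); ring.
    by rewrite mulr_sumr mulr_suml; apply: eq_bigr => m _; ring.
  have gAE : \sum_m A m * gl m = (\sum_k gam k * K k) / s - C * gg / 2.
    rewrite -gam_gl [in RHS]mulr_suml [in RHS]mulr_sumr [in RHS]mulr_suml -sumrB.
    transitivity (\sum_k gam k * \sum_m A m * G m k).
      under eq_bigr do rewrite mulr_sumr.
      rewrite exchange_big /=; apply: eq_bigr => k _; rewrite mulr_sumr.
      by apply: eq_bigr => m _; rewrite (Gsym k m); ring.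
    by apply: eq_bigr => k _; rewrite AG; ring.
  split.
  + move=> k; transitivity (s * (\sum_m A m * G m k) + C * (s / 2 * gl k)).
      by congr (_ + _); rewrite mulr_sumr; apply: eq_bigr => m _; ring.
    by rewrite AG; field.
  + by rewrite HC /frame_coefq; field; apply/andP.
  + by rewrite gA gAE HB HC /frame_coefp /frame_coefq; field; apply/andP.
Qed.

(** [field] treats a sum as an atom, so contractions are first split into elementary sums. The
    weight [w] is a row of [Gi] for an [E]-component and [gam] for a [p_o]-component. *)
Lemma sum_lin (w u1 u2 u3 u4 u5 : 'I_d -> R) c1 c2 c3 c4 c5 :
  \sum_k w k * (c1 * u1 k + c2 * u2 k + c3 * u3 k + c4 * u4 k + c5 * u5 k) =
  c1 * (\sum_k w k * u1 k) + c2 * (\sum_k w k * u2 k) + c3 * (\sum_k w k * u3 k)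
  + c4 * (\sum_k w k * u4 k) + c5 * (\sum_k w k * u5 k).
Proof. rewrite !mulr_sumr -!big_split; apply: eq_bigr => k _ /=; ring. Qed.


Lemma sum_divl (w u : 'I_d -> R) c :
  \sum_k w k / c * u k = (\sum_k w k * u k) / c.
Proof. by rewrite mulr_suml; apply: eq_bigr => k _; rewrite mulrAC. Qed.

Lemma sum_divr (w u : 'I_d -> R) c b :
  \sum_k w k / c * u k * b = (\sum_k w k * u k) / c * b.
Proof. by rewrite -mulr_suml sum_divl. Qed.

Lemma sum_mulr (w u : 'I_d -> R) c b :
  \sum_k w k * u k / c * b = (\sum_k w k * u k) / c * b.
Proof. by rewrite -mulr_suml -mulr_suml. Qed.

Lemma Gi_low (u : 'I_d -> R) m : \sum_k Gi m k * (\sum_t u t * G k t) = u m.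
Proof.
under eq_bigr do rewrite mulr_sumr.
rewrite exchange_big /= -[RHS]sum_delta; apply: eq_bigr => j _.
rewrite eq_sym -GiG mulr_sumr; apply: eq_bigr => k _; ring.
Qed.

(** * Components of the covariant derivatives from their Koszul products *)

Variables (N0 : 'I_d -> 'I_d -> 'I_d -> R) (om : 'I_d -> 'I_d -> R)
  (cc : 'I_d -> 'I_d -> 'I_d -> R) (sE aE bE gP gQ : 'I_d -> R)
  (sP aP bP sQ aQ bQ : R) (dgl : 'I_d -> 'I_d -> R).

Local Notation pg i := (\sum_t gP t * G i t).
Local Notation qg i := (\sum_t gQ t * G i t).
Local Notation Sf i j k := (\sum_l (gam l / 4 * om i k * G l j
  + gam l / 4 * om j k * G l i - gam l / 4 * om i j * G l k)).
(** [sm], [sp] and [2 / al * sP] are the [E]-, [p_o]- and [q_o]-components of the gradient of sigma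
    for the metric g / sigma. With it the sigma-terms below are those of a conformal change, 1/(2
    sigma) times X(sigma) Y + Y(sigma) X - (g / sigma)(X, Y) grad sigma. *)
Local Notation sm m := (\sum_k Gi m k * sE k - gam m / al * sP).
Local Notation sp := (2 / al * sQ + (al ^+ 2)^-1 * (gg - 2 * be) * sP
  - \sum_m gam m / al * sE m).
Local Notation cgl i k := (\sum_t cc i k t * gl t).

Lemma structure_sumE i m :
  \sum_l \sum_r \sum_t gam l / 4 * cc i r t * G t l * Gi m r =
  (\sum_r Gi m r * cgl i r) / 4.
Proof.
rewrite exchange_big /= mulr_suml; apply: eq_bigr => r _.
rewrite exchange_big /= mulr_sumr mulr_suml; apply: eq_bigr => t _.
rewrite !mulr_sumr mulr_suml; apply: eq_bigr => l _; rewrite (Gsym l t); ring.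
Qed.

Lemma structure_sump i c :
  \sum_m \sum_t \sum_l gam m * gam t / c * G t l * cc i m l =
  (\sum_m gam m * cgl i m) / c.
Proof.
rewrite mulr_suml; apply: eq_bigr => m _.
rewrite exchange_big /= mulr_sumr mulr_suml; apply: eq_bigr => l _.
rewrite !mulr_sumr mulr_suml; apply: eq_bigr => t _; ring.
Qed.

(* For a pair (X, Y) of frame fields, K, Kp and Kq are the products of nabla_X Y with
   E_k, p_o and q_o given by the Koszul formula. Here sE, sP, sQ (and similarly aE, ...)
   stand for the derivatives of sigma along E_i, p_o, q_o, and dgl i k for the
   derivative of gamma^t g_tk along E_i. *)
Definition K_EE i j k := s * N0 i j k + (sE i * G j k + sE j * G i k - sE k * G i j) / 2
  + s * Sf i j k.
Definition Kp_EE i j := - (sP * G i j + s * al / 2 * om i j) / 2.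
Definition Kq_EE i j := ((sE i * gl j + s * dgl i j) / 2 + (sE j * gl i + s * dgl j i) / 2
  - sQ * G i j + s / 2 * cgl i j - om i j * (s * be / 2)) / 2.

Lemma K_EE_sum (w : 'I_d -> R) i j : \sum_k w k * K_EE i j k =
  s * (\sum_k w k * N0 i j k) + sE i / 2 * (\sum_k w k * G k j)
  + sE j / 2 * (\sum_k w k * G k i) + - G i j / 2 * (\sum_k w k * sE k)
  + s * (\sum_k w k * Sf i j k).
Proof.
rewrite -sum_lin; apply: eq_bigr => k _.
by rewrite /K_EE (Gsym j k) (Gsym i k); congr (_ * _); field.
Qed.

(** The summand [gam m * om i j / 4] and the part of [sm m] with [sP] come from the correction by
    [Kp] in [frame_coefE], that is, from [q_o] not being orthogonal to the [E_k]. *)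
Lemma frame_coefE_EE i j m : frame_coefE (K_EE i j) (Kp_EE i j) m =
  \sum_k Gi m k * N0 i j k + \sum_k Gi m k * Sf i j k + gam m * om i j / 4
  + (2 * s)^-1 * sE i * (j == m)%:R + (2 * s)^-1 * sE j * (i == m)%:R
  - G i j / (2 * s) * sm m.
Proof.
rewrite /frame_coefE K_EE_sum !GiG /Kp_EE (eq_sym j) (eq_sym i).
by field; apply/andP.
Qed.

(** The summand with [cgl] comes from the [E]-components of the bracket, which pair with [q_o]
    through [gam]. The two contributions in [om i j * be], one from the bracket and one from the
    correction by [Kp], cancel. *)
Lemma frame_coefp_EE i j : frame_coefp (K_EE i j) (Kp_EE i j) (Kq_EE i j) =
  (2 * al)^-1 * dgl i j + (2 * al)^-1 * dgl j i + (2 * al)^-1 * cgl i j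
  - (4 * al)^-1 * gg * om i j - \sum_m gam m / al * N0 i j m
  - \sum_m gam m / al * Sf i j m - G i j / (2 * s) * sp.
Proof.
rewrite /frame_coefp K_EE_sum /Kp_EE /Kq_EE !sum_divl.
by field; apply/andP.
Qed.

Lemma frame_coefq_EE i j : frame_coefq (Kp_EE i j) =
  - (om i j / 2) - G i j / (al * s) * sP.
Proof. by rewrite /frame_coefq /Kp_EE; field; apply/andP. Qed.

Definition K_Ep i k := (sP * G i k + om i k * (s * al / 2)) / 2.
Definition Kq_Ep i := ((sE i * al + s * aE i) / 2 + (sP * gl i + s * pg i) / 2) / 2.

Lemma K_Ep_sum (w : 'I_d -> R) i : \sum_k w k * K_Ep i k =
  sP / 2 * (\sum_k w k * G k i) + s * al / 4 * (\sum_k w k * om i k).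
Proof.
rewrite !mulr_sumr -big_split; apply: eq_bigr => k _ /=.
by rewrite /K_Ep (Gsym i k); field.
Qed.

Lemma frame_coefE_Ep i m : frame_coefE (K_Ep i) 0 m =
  al / 4 * (\sum_k Gi m k * om i k) + (2 * s)^-1 * sP * (i == m)%:R.
Proof. by rewrite /frame_coefE K_Ep_sum GiG (eq_sym i); field; apply/andP. Qed.

Lemma frame_coefp_Ep i : frame_coefp (K_Ep i) 0 (Kq_Ep i) =
  (2 * al)^-1 * aE i + (2 * al)^-1 * pg i - (\sum_m gam m * om i m) / 4
  + (2 * s)^-1 * sE i.
Proof. by rewrite /frame_coefp K_Ep_sum /Kq_Ep; field; apply/andP. Qed.

Lemma frame_coefq0 : frame_coefq 0 = 0.
Proof. by rewrite /frame_coefq mulr0 mul0r. Qed.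

Definition K_Eq i k := ((sE i * gl k + s * dgl i k) / 2 + sQ * G i k
  - (sE k * gl i + s * dgl k i) / 2 - (s / 2 * cgl i k - om i k * (s * be / 2))) / 2.
Definition Kp_Eq i := ((sE i * al + s * aE i) / 2 - (sP * gl i + s * pg i) / 2) / 2.
Definition Kq_Eq i := (sE i * be + s * bE i) / 4.

Lemma K_Eq_sum (w : 'I_d -> R) i : \sum_k w k * K_Eq i k =
  sE i / 4 * (\sum_k w k * gl k) + s / 4 * (\sum_k w k * dgl i k)
  + sQ / 2 * (\sum_k w k * G k i) + - gl i / 4 * (\sum_k w k * sE k)
  + - s / 4 * (\sum_k w k * dgl k i)
  + (- s / 4 * (\sum_k w k * cgl i k) + s * be / 4 * (\sum_k w k * om i k)).
Proof.
rewrite -sum_lin !mulr_sumr -!big_split; apply: eq_bigr => k _ /=.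
by rewrite /K_Eq (Gsym i k); field.
Qed.

Lemma frame_coefE_Eq i m : frame_coefE (K_Eq i) (Kp_Eq i) m =
  \sum_k Gi m k / 4 * dgl i k - \sum_k Gi m k / 4 * dgl k i
  - \sum_l \sum_r \sum_t gam l / 4 * cc i r t * G t l * Gi m r
  + \sum_k Gi m k * om i k / 4 * be - gam m / (4 * al) * aE i
  + gam m / (4 * al) * pg i + (2 * s)^-1 * sQ * (i == m)%:R
  - gl i / (4 * s) * sm m.
Proof.
rewrite /frame_coefE K_Eq_sum GiG Gi_gl /Kp_Eq (eq_sym i) structure_sumE sum_mulr !sum_divl.
by field; apply/andP.
Qed.

Lemma frame_coefp_Eq i : frame_coefp (K_Eq i) (Kp_Eq i) (Kq_Eq i) =
  (2 * al)^-1 * bE i + (4 * al ^+ 2)^-1 * gg * aE i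
  - (4 * al ^+ 2)^-1 * gg * pg i - (2 * al ^+ 2)^-1 * be * aE i
  + (2 * al ^+ 2)^-1 * be * pg i - \sum_m gam m / (4 * al) * dgl i m
  + \sum_m gam m / (4 * al) * dgl m i
  + \sum_m \sum_t \sum_l gam m * gam t / (4 * al) * G t l * cc i m l
  - \sum_m gam m / (4 * al) * om i m * be - gl i / (4 * s) * sp.
Proof.
rewrite /frame_coefp K_Eq_sum gam_gl /Kp_Eq /Kq_Eq structure_sump !sum_divr !sum_divl.
by field; apply/andP.
Qed.

Lemma frame_coefq_Eq i : frame_coefq (Kp_Eq i) =
  (2 * al)^-1 * aE i - (2 * al)^-1 * pg i + (2 * s)^-1 * sE i
  - gl i / (2 * al * s) * sP.
Proof. by rewrite /frame_coefq /Kp_Eq; field; apply/andP. Qed.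

Lemma frame_coefE_pp m : frame_coefE (fun=> 0) 0 m = 0.
Proof. by rewrite /frame_coefE big1 ?mul0r ?mulr0 ?mul0r ?subr0 // => k _; rewrite mulr0. Qed.

Lemma frame_coefp_pp : frame_coefp (fun=> 0) 0 ((sP * al + s * aP) / 2) = sP / s + aP / al.
Proof.
have z : \sum_k gam k * 0 = 0 by rewrite big1 // => k _; rewrite mulr0.
by rewrite /frame_coefp z; field; apply/andP.
Qed.

Definition K_pq k := ((sP * gl k + s * pg k) / 2 - (sE k * al + s * aE k) / 2) / 2.
Definition Kq_pq := (sP * be + s * bP) / 4.

Lemma K_pq_sum (w : 'I_d -> R) : \sum_k w k * K_pq k =
  sP / 4 * (\sum_k w k * gl k) + s / 4 * (\sum_k w k * pg k)
  + - al / 4 * (\sum_k w k * sE k) + - s / 4 * (\sum_k w k * aE k).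
Proof.
rewrite !mulr_sumr -!big_split; apply: eq_bigr => k _ /=.
by rewrite /K_pq; field.
Qed.

Lemma frame_coefE_pq m : frame_coefE K_pq 0 m =
  gP m / 4 - \sum_k Gi m k / 4 * aE k - al / (4 * s) * sm m.
Proof.
rewrite /frame_coefE K_pq_sum Gi_gl Gi_low !sum_divl.
by field; apply/andP.
Qed.

(** The last bracket is [al / 2 * sp], the factor being the product of [p_o] and [q_o] for g /
    sigma; its term [sQ] cancels the one before it. *)
Lemma frame_coefp_pq : frame_coefp K_pq 0 Kq_pq =
  (2 * al)^-1 * bP - \sum_m gam m / (4 * al) * pg m
  + \sum_m gam m / (4 * al) * aE m + (2 * s)^-1 * sQ
  - (2 * s)^-1 * (sQ + (2 * al)^-1 * (gg - 2 * be) * sP - \sum_m gam m / 2 * sE m).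
Proof.
rewrite /frame_coefp K_pq_sum gam_gl /Kq_pq !sum_divl.
by field; apply/andP.
Qed.

Definition K_qq k := (sQ * gl k + s * qg k) / 2 - (sE k * be + s * bE k) / 4.
Definition Kp_qq := (sQ * al + s * aQ) / 2 - (sP * be + s * bP) / 4.
Definition Kq_qq := (sQ * be + s * bQ) / 4.

Lemma K_qq_sum (w : 'I_d -> R) : \sum_k w k * K_qq k =
  sQ / 2 * (\sum_k w k * gl k) + s / 2 * (\sum_k w k * qg k)
  + - be / 4 * (\sum_k w k * sE k) + - s / 4 * (\sum_k w k * bE k).
Proof.
rewrite !mulr_sumr -!big_split; apply: eq_bigr => k _ /=.
by rewrite /K_qq; field.
Qed.

Lemma frame_coefE_qq m : frame_coefE K_qq Kp_qq m =
  \sum_k Gi m k / 2 * qg k - \sum_k Gi m k / 4 * bE k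
  - gam m / (2 * al) * aQ + gam m / (4 * al) * bP - be / (4 * s) * sm m.
Proof.
rewrite /frame_coefE K_qq_sum Gi_gl /Kp_qq !sum_divl.
by field; apply/andP.
Qed.

Lemma frame_coefp_qq : frame_coefp K_qq Kp_qq Kq_qq =
  (2 * al)^-1 * bQ + (2 * al ^+ 2)^-1 * gg * aQ - (4 * al ^+ 2)^-1 * gg * bP
  - (al ^+ 2)^-1 * be * aQ + be / (2 * al ^+ 2) * bP
  - \sum_m gam m / (2 * al) * qg m + \sum_m gam m / (4 * al) * bE m
  - be / (2 * s) * (al^-1 * sQ + (2 * al ^+ 2)^-1 * (gg - 2 * be) * sP
                    - \sum_m gam m / (2 * al) * sE m).
Proof.
rewrite /frame_coefp K_qq_sum gam_gl /Kp_qq /Kq_qq !sum_divl.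
by field; apply/andP.
Qed.

Lemma frame_coefq_qq : frame_coefq Kp_qq =
  al^-1 * aQ - (2 * al)^-1 * bP + s^-1 * sQ - be / (2 * al * s) * sP.
Proof. by rewrite /frame_coefq /Kp_qq; field; apply/andP. Qed.

End LinearSystem.

(** * The adapted frame *)

Section PushLinear.
Context {R : realType} {d e : nat} {M : premanifold R d} {N : premanifold R e}.
Variables (F : M -> N) (p : M).

Lemma push0 : push F p 0 = 0 :> tvec N.
Proof. by apply/funext => f; rewrite /push; case: ifP. Qed.

Lemma pushZ a (v : tvec M) : push F p (a *: v) = a *: push F p v.
Proof. by have := push_lin F p a v 0; rewrite push0 !addr0. Qed.

Lemma pushD (v w : tvec M) : push F p (v + w) = push F p v + push F p w.
Proof. by have := push_lin F p 1 v w; rewrite !scale1r. Qed.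

Lemma push_lincomb n (a : 'I_n -> R) (e0 : 'I_n -> tvec M) :
  push F p (\sum_i a i *: e0 i) = \sum_i a i *: push F p (e0 i).
Proof.
elim/big_rec2: _ => [|i y v _ <-]; first exact: push0.
by rewrite push_lin.
Qed.

Lemma one_form0 (eta : one_form M) :
  is_manifold M -> is_one_form setT eta -> eta p 0 = 0.
Proof.
move=> HM [Leta _]; have T0 := tangent0 HM p; have := Leta p 1 0 0 I T0 T0.
rewrite scale1r addr0 mul1r => /eqP.
by rewrite -subr_eq0 opprD addNKr oppr_eq0 => /eqP.
Qed.

Lemma one_form_lincomb (eta : one_form M) n (a : 'I_n -> R) (e0 : 'I_n -> tvec M) :
  is_manifold M -> is_one_form setT eta -> (forall i, tangent p (e0 i)) ->
  eta p (\sum_i a i *: e0 i) = \sum_i a i * eta p (e0 i).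
Proof.
move=> HM Heta Te.
suff [] : tangent p (\sum_i a i *: e0 i) /\
   eta p (\sum_i a i *: e0 i) = \sum_i a i * eta p (e0 i) by [].
elim/big_rec2: _ => [|i y v _ [Tv <-]].
  by split; [exact: tangent0|exact: one_form0].
by have [Leta _] := Heta; rewrite Leta //; split=> //; exact: tangent_lin.
Qed.

End PushLinear.

Section AdaptedFrame.
Context {R : realType} {d : nat} {N : premanifold R d} {S : premanifold R d.+1}
  {A A' : structure_group}.
Local Notation M := (prod_space S (gspace R A)).
Local Notation pi := (@triv_proj R d.+1 S A).
Local Notation act := (@triv_act R d.+1 S A).
Local Notation po := (fundamental act).
Variables (W : tangent_dist M) (h : two_tensor M).
Variables (J : endo N) (go : two_tensor N).
Variables (piS : S -> N) (actS : S -> gspace R A' -> S).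
Variables (JS : endo S) (theta : one_form S).
Variables (V : set N) (E : 'I_d -> vector_field N) (c : 'I_d -> 'I_d -> 'I_d -> N -> R).
Variables (ES : 'I_d -> vector_field S) (Eh : 'I_d -> vector_field M) (qo : vector_field M).
Variables (g : two_tensor M).
Variable nabla : vector_field M -> vector_field M -> vector_field M.
Local Notation U := ([set x | V (piS (pi x))]).
Local Notation qS := (fundamental actS).

Hypothesis HR : regular_shearfree pi act W h.
Hypothesis HK : kaehler_sasaki pi W h piS actS J go JS theta.
Hypothesis oV : open_in V.
Hypothesis HE : frame_field V E.
Hypothesis Hc : forall i j p, V p -> lie (E i) (E j) p = \sum_k c i j k p *: E k p.
Hypothesis HES : forall i, is_lift piS actS (push_dist pi W) V (E i) (ES i).
Hypothesis HEh : forall i, is_lift pi act (@flat_horizontal R d.+1 S A)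
                     [set s | V (piS s)] (ES i) (Eh i).
Hypothesis Hqo : is_lift pi act (@flat_horizontal R d.+1 S A) setT qS qo.
Hypothesis Hg : lorentzian g.
Hypothesis Hnabla : levi_civita g nabla.

Let HM : is_manifold M := rs_total HR.
Let HS : is_manifold S := rs_base HR.
Let HN : is_manifold N := kaehler_manifold (ks_kaehler HK).
Let spi : smooth_map setT pi := pb_proj (rs_bundle HR).
Let spiS : smooth_map setT piS := pb_proj (ks_bundle HK).

Lemma open_US : open_in [set s | V (piS s)].
Proof. exact: preimage_open_in HS HN spiS oV. Qed.

Lemma open_U : open_in (M := M) U.
Proof. exact: (preimage_open_in HM HS spi open_US). Qed.

Lemma vfield_tangent (d' : nat) (M' : premanifold R d') (W' : tangent_dist M') (U' : set M') X :
  vfield W' U' X -> vfield (@tangent R d' M') U' X.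
Proof. by move=> [H1 H2]; split=> // p Up; have [T _] := H1 p Up. Qed.

Lemma vfield_Eh i : vfield (@tangent _ _ M) U (Eh i).
Proof. exact: vfield_tangent (lift_field (HEh i)). Qed.

Lemma vfield_qo : vfield (@tangent _ _ M) U qo.
Proof.
by have [H1 H2] := vfield_tangent (lift_field Hqo); split=> [p _|f p _]; [exact: H1|exact: H2].
Qed.

Lemma vfield_po : vfield (@tangent _ _ M) U po.
Proof.
by split=> [p _|f p _]; [split; exact: tangent_fundamental|exact: smooth_fundamental].
Qed.

Lemma vfield_ES i : vfield (@tangent _ _ S) [set s | V (piS s)] (ES i).
Proof. exact: vfield_tangent (lift_field (HES i)). Qed.

Lemma push_Eh i x : U x -> push pi x (Eh i x) = ES i (pi x).
Proof. exact: (lift_proj (HEh i)). Qed.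

Lemma push_qo x : push pi x (qo x) = qS (pi x).
Proof. exact: (lift_proj Hqo). Qed.

Lemma push_po x : push pi x (po x) = 0.
Proof.
apply/funext => f; rewrite /push; case: ifP => // _.
rewrite /fundamental; case: ifP => // _.
have -> : (fun t => (f \o pi) (act x (gexp A t)) : R^o) = cst (f x.1).
  by apply/funext => t.
by rewrite [LHS](@derive1_cst _ R^o).
Qed.

Lemma push_ES i s : V (piS s) -> push piS s (ES i s) = E i (piS s).
Proof. exact: (lift_proj (HES i)). Qed.

(** In the definition of a principal bundle this is recorded inside the local trivializations. *)
Lemma piS_act s a : piS (actS s a) = piS s.
Proof.
have [V' [tau [psi [[_ V's] _ _ _ H]]]] := pb_trivial (ks_bundle HK) (piS s).
by have [_ /(_ a)[]] := H s V's.
Qed.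

Lemma push_qS s : push piS s (qS s) = 0.
Proof.
apply/funext => f; rewrite /push; case: ifP => // _.
rewrite /fundamental; case: ifP => // _.
have -> : (fun t => (f \o piS) (actS s (gexp A' t)) : R^o) = cst (f (piS s)).
  by apply/funext => t; rewrite /= piS_act.
by rewrite [LHS](@derive1_cst _ R^o).
Qed.

(** The action on [S] is abstract, with no chart adapted to its orbits. Tangency is inherited from
    the lift [qo] at a point above [s]. *)
Lemma tangent_qS s : tangent s (qS s).
Proof.
have [T _] := (vfield_tangent (lift_field Hqo)).1 (s, gexp A 0) I.
have := tangent_push HS spi (p := (s, gexp A 0) : M) I T.
by rewrite push_qo.
Qed.

Lemma smooth_qS f s : smooth_at f s -> smooth_at (fun q => qS q f) s.
Proof.
move=> sf; apply: (smooth_at_slice (A := A) HS).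
have sf' : smooth_at (f \o pi) (s, gexp A 0).
  by apply: (smooth_at_comp HS spi).
apply: smooth_at_near ((vfield_tangent (lift_field Hqo)).2 _ _ I sf').
apply: (push_related HS spi) => //.
by apply: nearmW => q; exact: push_qo.
Qed.

Lemma vfield_qS U' : vfield (@tangent _ _ S) U' qS.
Proof.
by split=> [s _|f s _]; [split; exact: tangent_qS|exact: smooth_qS].
Qed.

Lemma theta_ES i s : V (piS s) -> theta s (ES i s) = 0.
Proof.
move=> Vs; have [_ Wk] := (lift_field (HES i)).1 s Vs.
by have [/(_ Wk)[]] := ks_theta_ker HK (p := s) I (ES i s).
Qed.

Lemma theta0 s : theta s 0 = 0.
Proof. exact: one_form0 HS (ks_theta HK). Qed.

Lemma theta_lin_ES (a : 'I_d -> R) b s : V (piS s) ->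
  theta s (\sum_k a k *: ES k s + b *: qS s) = b.
Proof.
move=> Vs; have [Lt _] := ks_theta HK.
have TES k : tangent s (ES k s) by have [T _] := (vfield_ES k).1 s Vs.
have Tq := tangent_qS s.
rewrite addrC Lt //; last exact: tangent_lincomb.
rewrite (ks_theta_q HK) mulr1 (one_form_lincomb _ HS (ks_theta HK)) //.
by rewrite big1 ?addr0 // => k _; rewrite theta_ES // mulr0.
Qed.

Lemma Eh_snd i x phi : U x -> smooth_at phi x.2 ->
  Eh i x (fun y : M => phi y.2) = 0.
Proof.
move=> Ux sphi; have [_ [_ H]] := (lift_field (HEh i)).1 x Ux.
by have := congr1 (fun v : tvec _ => v phi) H; rewrite /push asboolT.
Qed.

Lemma qo_snd x phi : smooth_at phi x.2 -> qo x (fun y : M => phi y.2) = 0.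
Proof.
move=> sphi; have [_ [_ H]] := (lift_field Hqo).1 x I.
by have := congr1 (fun v : tvec _ => v phi) H; rewrite /push asboolT.
Qed.

Lemma po_snd phi x : smooth_at phi x.2 ->
  po x (fun y : M => phi y.2) = derive1 (fun t : R => phi (gmul x.2 (gexp A t)) : R^o) 0.
Proof.
move=> sphi; rewrite /fundamental asboolT //.
exact: (smooth_at_snd HM).
Qed.

Lemma TEh i x : U x -> tangent x (Eh i x).
Proof. by move=> Ux; have [T _] := (vfield_Eh i).1 x Ux. Qed.

Lemma Tqo x : tangent x (qo x).
Proof. by have [T _] := (vfield_tangent (lift_field Hqo)).1 x I. Qed.

Lemma Tpo (x : M) : tangent x (po x).
Proof. exact: tangent_fundamental. Qed.

(** * Tests that read off the coefficients of a combination of the frame *)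

Section Coordinates.
Variables (x : M) (a : 'I_d -> R) (b e : R).
Hypothesis Ux : U x.
Let Z : tvec M := \sum_k a k *: Eh k x + b *: po x + e *: qo x.

Lemma push_frame : push pi x Z = \sum_k a k *: ES k (pi x) + e *: qS (pi x).
Proof.
rewrite /Z !pushD !pushZ push_lincomb push_po push_qo scaler0 addr0.
by congr (_ + _); apply: eq_bigr => k _; rewrite push_Eh.
Qed.

Lemma pushS_frame : push piS (pi x) (push pi x Z) = \sum_k a k *: E k (piS (pi x)).
Proof.
rewrite push_frame pushD pushZ push_lincomb push_qS scaler0 addr0.
by apply: eq_bigr => k _; rewrite push_ES.
Qed.

Lemma theta_frame : theta (pi x) (push pi x Z) = e.
Proof. by rewrite push_frame theta_lin_ES. Qed.

Lemma snd_frame phi : smooth_at phi x.2 ->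
  Z (fun y : M => phi y.2) =
  b * derive1 (fun t : R => phi (gmul x.2 (gexp A t)) : R^o) 0.
Proof.
move=> sphi; rewrite -po_snd //.
have -> : Z (fun y : M => phi y.2) = (\sum_k a k *: Eh k x : tvec M) (fun y : M => phi y.2)
   + b * po x (fun y : M => phi y.2) + e * qo x (fun y : M => phi y.2) by [].
rewrite qo_snd // mulr0 addr0 -[RHS]add0r; congr (_ + _).
elim/big_ind: _ => // [v w vE wE|k _].
  by rewrite -[LHS]/(v _ + w _) vE wE addr0.
by rewrite -[LHS]/(a k * Eh k x _) Eh_snd // mulr0.
Qed.

End Coordinates.

Lemma E_free p (a b : 'I_d -> R) : V p ->
  \sum_k a k *: E k p = \sum_k b k *: E k p -> a =1 b.
Proof.
move=> Vp ab k; have [TE bE] := HE.2 p Vp.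
have [r [rE rU]] := bE _ (tangent_lincomb HN b TE).
have H (u : 'I_d -> R) : \sum_k b k *: E k p = \sum_k u k *: E k p -> r = \row_k u k.
  by move=> H; apply: rU; rewrite H; apply: eq_bigr => j _; rewrite mxE.
have Ha := H a (esym ab); have Hb := H b erefl.
by have := congr1 (fun r : 'rV_d => r 0 k) (etrans (esym Ha) Hb); rewrite !mxE.
Qed.

(** The three tests give independence, and the orthonormal basis in the definition of a Lorentzian
    metric fixes the dimension; spanning follows by counting. *)
Lemma frame_span x v : U x -> tangent x v -> exists (a : 'I_d -> R) b e,
  v = \sum_k a k *: Eh k x + b *: po x + e *: qo x.
Proof.
move=> Ux Tv; have [e0 [be0 _]] := Hg.2 x.
(* The index type is the dimension of the product as written: index 0 of the first block is [p_o],
   its other indices are the lifts of the [E_k], and the second block is [q_o]. *)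
pose X (i : 'I_(d.+1 + 1)) : tvec M := match fintype.split i with
  | inl j => if unlift ord0 j is Some k then Eh k x else po x
  | inr _ => qo x end.
have XE (a : 'I_(d.+1 + 1) -> R) : \sum_i a i *: X i =
   \sum_k a (lshift 1 (lift ord0 k)) *: Eh k x + a (lshift 1 ord0) *: po x
   + a (rshift d.+1 ord0) *: qo x.
  rewrite big_split_ord big_ord1 /= big_ord_recl.
  have Sl j : fintype.split (lshift 1 j : 'I_(d.+1 + 1)) = inl j by exact: (unsplitK (inl j)).
  have Sr j : fintype.split (rshift d.+1 j : 'I_(d.+1 + 1)) = inr j by exact: (unsplitK (inr j)).
  congr (_ + _); last by rewrite /X Sr.
  rewrite addrC; congr (_ + _); last by rewrite /X Sl unlift_none.
  by apply: eq_bigr => k _; rewrite /X Sl liftK.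
have TX i : tangent x (X i).
  rewrite /X; case: fintype.split => [j|_]; last exact: Tqo.
  by case: unlift => [k|]; [exact: TEh|exact: Tpo].
have [|a ->] := tangent_span erefl be0 TX _ Tv; last first.
  by rewrite XE; eexists; eexists; eexists; reflexivity.
move=> a; rewrite XE => Z0.
have [phi [phi' [sphi _ dphi phi0]]] := group_coordinate x.2.
have aE k : a 0 (lshift 1 (lift ord0 k)) = 0.
  apply: (@E_free (piS (pi x)) (fun k => a 0 (lshift 1 (lift ord0 k))) (fun=> 0)) => //.
  rewrite -(pushS_frame (fun k => a 0 (lshift 1 (lift ord0 k)))
    (a 0 (lshift 1 ord0)) (a 0 (rshift d.+1 ord0)) Ux) Z0 !push0.
  by rewrite big1 // => j _; rewrite scale0r.
have ap : a 0 (lshift 1 ord0) = 0.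
  have := snd_frame (fun k => a 0 (lshift 1 (lift ord0 k))) (a 0 (lshift 1 ord0))
     (a 0 (rshift d.+1 ord0)) Ux (sphi x.2).
  rewrite Z0 dphi => /esym/eqP.
  by rewrite mulf_eq0 (negbTE phi0) orbF => /eqP.
have aq : a 0 (rshift d.+1 ord0) = 0.
  by rewrite -(theta_frame (fun k => a 0 (lshift 1 (lift ord0 k))) (a 0 (lshift 1 ord0))
     (a 0 (rshift d.+1 ord0)) Ux) Z0 push0 theta0.
apply/rowP => i; rewrite mxE; case: (split_ordP i) => j ->; last by rewrite ord1.
by case: (unliftP ord0 j) => [k|] ->.
Qed.

(** The last test provides [phi'] together with [phi], because a bracket with [p_o] differentiates
    [phi] into [phi'] before the other field acts. *)
Lemma frame_eq x v (a : 'I_d -> R) e : U x -> tangent x v ->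
  push piS (pi x) (push pi x v) = \sum_k a k *: E k (piS (pi x)) ->
  theta (pi x) (push pi x v) = e ->
  (forall phi phi', (forall b, smooth_at phi b) -> (forall b, smooth_at phi' b) ->
     (forall b, derive1 (fun t : R => phi (gmul b (gexp A t)) : R^o) 0 = phi' b) ->
     v (fun y : M => phi y.2) = 0) ->
  v = \sum_k a k *: Eh k x + e *: qo x.
Proof.
move=> Ux Tv; have [a' [b' [e' vE]]] := frame_span Ux Tv.
rewrite vE pushS_frame // theta_frame // => aE eE H.
have [phi [phi' [sphi sphi' dphi phi0]]] := group_coordinate x.2.
have := H phi phi' sphi sphi' dphi.
rewrite snd_frame // dphi => /eqP; rewrite mulf_eq0 (negbTE phi0) orbF => /eqP ->.
rewrite scale0r addr0 eE; congr (_ + _); apply: eq_bigr => k _.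
by rewrite (E_free Ux aE).
Qed.

Lemma pull_push (f : S -> R) x v : smooth_at f (pi x) ->
  v (f \o pi) = push pi x v f.
Proof. by move=> sf; rewrite /push asboolT. Qed.

Lemma smooth_piS phi s : smooth_at phi (piS s) -> smooth_at (phi \o piS) s.
Proof. by move=> sphi; apply: (smooth_at_comp HN spiS). Qed.

Lemma smooth_pull phi x : smooth_at phi (piS (pi x)) ->
  smooth_at (fun y : M => phi (piS (pi y))) x.
Proof.
by move=> /smooth_piS sphi; apply: (smooth_at_comp HS spi _ sphi).
Qed.

Lemma Eh_pull i x phi : U x -> smooth_at phi (piS (pi x)) ->
  Eh i x (fun y : M => phi (piS (pi y))) = E i (piS (pi x)) phi.
Proof.
move=> Ux sphi; have sphi' := smooth_piS sphi.
rewrite [LHS](@pull_push (phi \o piS) x) // push_Eh // -push_ES //.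
by rewrite /push asboolT.
Qed.

Lemma po_pull x phi : smooth_at phi (piS (pi x)) ->
  po x (fun y : M => phi (piS (pi y))) = 0.
Proof.
move=> sphi; have sphi' := smooth_piS sphi.
by rewrite [LHS](@pull_push (phi \o piS) x) // push_po.
Qed.

Lemma qo_pull x phi : smooth_at phi (piS (pi x)) ->
  qo x (fun y : M => phi (piS (pi y))) = 0.
Proof.
move=> sphi; have sphi' := smooth_piS sphi.
rewrite [LHS](@pull_push (phi \o piS) x) // push_qo.
transitivity (push piS (pi x) (qS (pi x)) phi); last by rewrite push_qS.
by rewrite /push asboolT.
Qed.

(** * Brackets of the adapted frame *)

Lemma near_push_Eh i x : U x -> nearm x (fun q => push pi q (Eh i q) = ES i (pi q)).
Proof. by move=> Ux; apply: nearm_impl (nearm_open open_U Ux) => q; exact: push_Eh. Qed.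

Lemma near_push_ES i s : V (piS s) ->
  nearm s (fun q => push piS q (ES i q) = E i (piS q)).
Proof. by move=> Vs; apply: nearm_impl (nearm_open open_US Vs) => q; exact: push_ES. Qed.

Lemma TES i s : V (piS s) -> tangent s (ES i s).
Proof. by move=> Vs; have [T _] := (vfield_ES i).1 s Vs. Qed.

Lemma smooth_0 (d' : nat) (M' : premanifold R d') (f : M' -> R) p :
  is_manifold M' -> smooth_at (fun q : M' => (fun=> 0 : tvec M') q f) p.
Proof. by move=> H; exact: smooth_at_cst. Qed.

(** [psi] will be [phi'] when [Y] is [p_o] and zero when [Y] is horizontal. In both cases [X]
    annihilates it, and the other iterated derivative starts from the zero function. *)
Lemma lie_snd (X Y : vector_field M) x phi psi : U x ->
  tangent x (X x) -> tangent x (Y x) ->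
  (forall q, U q -> X q (fun y : M => phi y.2) = 0) ->
  (forall q, U q -> X q (fun y : M => psi y.2) = 0) ->
  (forall q, U q -> Y q (fun y : M => phi y.2) = psi q.2) ->
  lie X Y x (fun y : M => phi y.2) = 0.
Proof.
move=> Ux TX TY Xphi Xpsi Yphi; rewrite /lie; case: ifP => // _.
rewrite (tangent_local TX (g := fun q : M => psi q.2)); last first.
  exact: nearm_impl (nearm_open open_U Ux).
rewrite (tangent_local TY (g := fun=> 0)); last first.
  exact: nearm_impl (nearm_open open_U Ux).
by rewrite Xpsi // (tangent_cst TY) subr0.
Qed.

Lemma frame_eq0 x v : U x -> tangent x v ->
  push piS (pi x) (push pi x v) = 0 -> theta (pi x) (push pi x v) = 0 ->
  (forall phi phi', (forall b, smooth_at phi b) -> (forall b, smooth_at phi' b) ->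
     (forall b, derive1 (fun t : R => phi (gmul b (gexp A t)) : R^o) 0 = phi' b) ->
     v (fun y : M => phi y.2) = 0) -> v = 0.
Proof.
move=> Ux Tv pv tv H; rewrite (@frame_eq x v (fun=> 0) 0 Ux Tv _ tv H).
  by rewrite scale0r addr0 big1 // => k _; rewrite scale0r.
by rewrite pv big1 // => k _; rewrite scale0r.
Qed.

Lemma lie_Eh_po i x : U x -> lie (Eh i) po x = 0.
Proof.
move=> Ux; have Tl := lc_lie_tangent HM Hnabla open_U (vfield_Eh i) vfield_po Ux.
have pl : push pi x (lie (Eh i) po x) = 0.
  rewrite (push_lie HM HS spi (X' := ES i) (Y' := fun=> 0)).
  - exact: lie0r (TES i Ux).
  - exact: TEh.
  - exact: Tpo.
  - exact: near_push_Eh.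
  - by apply: nearmW => q; exact: push_po.
  - by move=> f; exact: (vfield_ES i).2.
  - by move=> f _; exact: smooth_0.
apply: (frame_eq0 Ux Tl); rewrite ?pl ?push0 ?theta0 // => phi phi' sphi sphi' dphi.
apply: (lie_snd (psi := phi')) => //; [exact: TEh|exact: Tpo| | |].
- by move=> q Uq; exact: Eh_snd.
- by move=> q Uq; exact: Eh_snd.
- by move=> q Uq; rewrite po_snd.
Qed.

Lemma lie_qo_po x : U x -> lie qo po x = 0.
Proof.
move=> Ux; have Tl := lc_lie_tangent HM Hnabla open_U vfield_qo vfield_po Ux.
have pl : push pi x (lie qo po x) = 0.
  rewrite (push_lie HM HS spi (X' := qS) (Y' := fun=> 0)).
  - exact: lie0r (tangent_qS _).
  - exact: Tqo.
  - exact: Tpo.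
  - by apply: nearmW => q; exact: push_qo.
  - by apply: nearmW => q; exact: push_po.
  - by move=> f; exact: smooth_qS.
  - by move=> f _; exact: smooth_0.
apply: (frame_eq0 Ux Tl); rewrite ?pl ?push0 ?theta0 // => phi phi' sphi sphi' dphi.
apply: (lie_snd (psi := phi')) => //; [exact: Tqo|exact: Tpo| | |].
- by move=> q Uq; exact: qo_snd.
- by move=> q Uq; exact: qo_snd.
- by move=> q Uq; rewrite po_snd.
Qed.

(** Constant values of [theta] on the two fields reduce its exterior derivative to minus [theta] of
    the bracket: this is the source of the sign in the [q_o]-component of the brackets. *)
Lemma theta_lie (X Y : vector_field S) s a b : V (piS s) ->
  vfield (@tangent _ _ S) [set s | V (piS s)] X ->
  vfield (@tangent _ _ S) [set s | V (piS s)] Y ->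
  (forall q, V (piS q) -> theta q (X q) = a) ->
  (forall q, V (piS q) -> theta q (Y q) = b) ->
  theta s (lie X Y s) = - pullback piS (kaehler_form J go) s (X s) (Y s).
Proof.
move=> Vs vX vY tX tY; rewrite -(ks_theta_d HK open_US vX vY Vs) /ext_d.
have TX : tangent s (X s) by have [T _] := vX.1 s Vs.
have TY : tangent s (Y s) by have [T _] := vY.1 s Vs.
rewrite (tangent_local TX (g := fun=> b)); last first.
  exact: nearm_impl (nearm_open open_US Vs).
rewrite (tangent_local TY (g := fun=> a)); last first.
  exact: nearm_impl (nearm_open open_US Vs).
by rewrite (tangent_cst TX) (tangent_cst TY) subr0 sub0r opprK.
Qed.

Lemma lie_Eh_qo i x : U x -> lie (Eh i) qo x = 0.
Proof.
move=> Ux; have Tl := lc_lie_tangent HM Hnabla open_U (vfield_Eh i) vfield_qo Ux.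
have pl : push pi x (lie (Eh i) qo x) = lie (ES i) qS (pi x).
  apply: (push_lie HM HS spi).
  - exact: TEh.
  - exact: Tqo.
  - exact: near_push_Eh.
  - by apply: nearmW => q; exact: push_qo.
  - by move=> f; exact: (vfield_ES i).2.
  - by move=> f; exact: smooth_qS.
apply: (frame_eq0 Ux Tl); rewrite ?pl.
- rewrite (push_lie HS HN spiS (X' := E i) (Y' := fun=> 0)).
  + by apply: lie0r; have [T _] := (HE.1 i).1 _ Ux.
  + exact: TES.
  + exact: tangent_qS.
  + exact: near_push_ES.
  + by apply: nearmW => q; exact: push_qS.
  + by move=> f; exact: (HE.1 i).2.
  + by move=> f _; exact: smooth_0.
- rewrite (theta_lie (a := 0) (b := 1)) //.
  (* The field [qS] is vertical over [N], so the Kaehler form is evaluated on a zero vector. *)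
  + rewrite /pullback /kaehler_form push_qS push_ES //.
    have TE : tangent (piS (pi x)) (E i (piS (pi x))) by have [T _] := (HE.1 i).1 _ Ux.
    have [HJ _] := kaehler_complex (ks_kaehler HK); have TJ := HJ _ _ TE.
    have [Hgo _] := kaehler_metric (ks_kaehler HK).
    have T0 := tangent0 HN (piS (pi x)).
    by rewrite (form_sym Hgo) // (symform0l HN Hgo) // oppr0.
  + exact: vfield_ES.
  + exact: vfield_qS.
  + by move=> q; exact: theta_ES.
  + by move=> q _; exact: (ks_theta_q HK).
- move=> phi phi' sphi sphi' dphi.
  apply: (lie_snd (psi := fun=> 0)) => //; [exact: TEh|exact: Tqo| | |].
  + by move=> q Uq; exact: Eh_snd.
  + by move=> q Uq; exact: (tangent_cst (TEh i Uq)).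
  + by move=> q Uq; exact: qo_snd.
Qed.

Lemma lie_Eh i j x : U x -> lie (Eh i) (Eh j) x =
  \sum_k c i j k (piS (pi x)) *: Eh k x
  + (- kaehler_form J go (piS (pi x)) (E i (piS (pi x))) (E j (piS (pi x)))) *: qo x.
Proof.
move=> Ux; have Tl := lc_lie_tangent HM Hnabla open_U (vfield_Eh i) (vfield_Eh j) Ux.
have pl : push pi x (lie (Eh i) (Eh j) x) = lie (ES i) (ES j) (pi x).
  apply: (push_lie HM HS spi); try exact: TEh; try exact: near_push_Eh.
  - by move=> f; exact: (vfield_ES i).2.
  - by move=> f; exact: (vfield_ES j).2.
apply: (frame_eq Ux Tl); rewrite ?pl.
- rewrite (push_lie HS HN spiS (X' := E i) (Y' := E j)); first exact: Hc.
  + exact: TES.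
  + exact: TES.
  + exact: near_push_ES.
  + exact: near_push_ES.
  + by move=> f; exact: (HE.1 i).2.
  + by move=> f; exact: (HE.1 j).2.
- rewrite (theta_lie (a := 0) (b := 0)) //.
  + by rewrite /pullback !push_ES.
  + exact: vfield_ES.
  + exact: vfield_ES.
  + by move=> q; exact: theta_ES.
  + by move=> q; exact: theta_ES.
- move=> phi phi' sphi sphi' dphi.
  apply: (lie_snd (psi := fun=> 0)) => //; try exact: TEh.
  + by move=> q Uq; exact: Eh_snd.
  + by move=> q Uq; exact: (tangent_cst (TEh i Uq)).
  + by move=> q Uq; exact: Eh_snd.
Qed.


(** * Derivatives of the Gram matrix of the adapted frame *)

Variables (sigma alpha beta : M -> R) (gamma : 'I_d -> M -> R).
Variable nabla0 : vector_field N -> vector_field N -> vector_field N.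

Local Notation Gm i j x := (go (piS (pi x)) (E i (piS (pi x))) (E j (piS (pi x)))).
Local Notation omm i j x :=
  (kaehler_form J go (piS (pi x)) (E i (piS (pi x))) (E j (piS (pi x)))).
Local Notation N0m i j k x :=
  (go (piS (pi x)) (nabla0 (E i) (E j) (piS (pi x))) (E k (piS (pi x)))).
Local Notation glm i := (fun y : M => \sum_k gamma k y * Gm k i y).

Hypothesis Hsm : forall x, U x ->
  [/\ smooth_at sigma x, smooth_at alpha x, smooth_at beta x &
      forall i, smooth_at (gamma i) x].
Hypothesis Hpos : forall x, U x -> 0 < sigma x /\ alpha x != 0.
Hypothesis Hform : forall x, U x ->
  (forall i j, g x (Eh i x) (Eh j x) = sigma x * Gm i j x) /\
  (forall i, g x (Eh i x) (po x) = 0) /\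
  g x (po x) (po x) = 0 /\
  g x (po x) (qo x) = sigma x * alpha x / 2 /\
  (forall j, g x (qo x) (Eh j x) = sigma x / 2 * \sum_i gamma i x * Gm i j x) /\
  g x (qo x) (qo x) = sigma x * beta x / 2.
Hypothesis Hnabla0 : levi_civita go nabla0.

Let Hgo : sym_form (@tangent R d N) go := (kaehler_metric (ks_kaehler HK)).1.
Let Sg : sym_form (@tangent _ _ M) g := Hg.1.

Lemma TE i x : U x -> tangent (piS (pi x)) (E i (piS (pi x))).
Proof. by move=> Ux; have [T _] := (HE.1 i).1 _ Ux. Qed.

Lemma G_sym i j x : U x -> Gm i j x = Gm j i x.
Proof. by move=> Ux; rewrite (form_sym Hgo) //; exact: TE. Qed.

Lemma smooth_go i j p : V p -> smooth_at (fun p => go p (E i p) (E j p)) p.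
Proof. exact: form_smooth Hgo _ _ _ _ oV (HE.1 i) (HE.1 j). Qed.

Lemma smooth_G i j x : U x -> smooth_at (fun y : M => Gm i j y) x.
Proof.
move=> Ux; apply: (@smooth_pull (fun p => go p (E i p) (E j p))).
exact: smooth_go.
Qed.

Lemma smooth_gl j x : U x -> smooth_at (glm j) x.
Proof.
move=> Ux; have [_ _ _ sg] := Hsm Ux; apply: (smooth_at_sum HM) => k.
by apply: smooth_atM => //; exact: smooth_G.
Qed.

(** Derivatives of the base metric are traded for covariant derivatives on [N], as [N0_torsion] does
    for the structure functions. In the Koszul formula on [M] they recombine into the single term
    [N0 i j k]. *)
Lemma Eh_G k i j x : U x ->
  Eh k x (fun y : M => Gm i j y) = N0m k i j x + N0m k j i x.
Proof.
move=> Ux; rewrite (@Eh_pull k x (fun p => go p (E i p) (E j p)) Ux); last first.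
  exact: smooth_go.
rewrite (lc_metric Hnabla0 oV (HE.1 k) (HE.1 i) (HE.1 j) Ux); congr (_ + _).
apply: (form_sym Hgo); first exact: TE.
have Vx : V (piS (pi x)) := Ux.
exact: (lc_tangent Hnabla0 oV (HE.1 k) (HE.1 j) Vx).
Qed.

Lemma po_G i j x : U x -> po x (fun y : M => Gm i j y) = 0.
Proof.
move=> Ux; apply: (@po_pull x (fun p => go p (E i p) (E j p))).
exact: smooth_go.
Qed.

Lemma qo_G i j x : U x -> qo x (fun y : M => Gm i j y) = 0.
Proof.
move=> Ux; apply: (@qo_pull x (fun p => go p (E i p) (E j p))).
exact: smooth_go.
Qed.

(** [p_o] and [q_o] annihilate functions pulled back from [N], so only the [gamma t] are
    differentiated, which produces [pg] and [qg]. Along the [Eh i] the metric varies, and the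
    derivative of [glm j] stays unexpanded. *)
Lemma vertical_gl (v : tvec M) j x : U x -> tangent x v ->
  (forall i k, v (fun y : M => Gm i k y) = 0) ->
  v (glm j) = \sum_t v (gamma t) * Gm j t x.
Proof.
move=> Ux Tv vG; have [_ _ _ sg] := Hsm Ux.
rewrite (tangent_sum HM Tv); last first.
  by move=> k; apply: smooth_atM => //; exact: smooth_G.
apply: eq_bigr => t _; rewrite (tangentM Tv) //; last exact: smooth_G.
by rewrite vG mulr0 addr0 G_sym.
Qed.

Lemma N0_torsion i j k x : U x ->
  \sum_l c i j l (piS (pi x)) * Gm l k x = N0m i j k x - N0m j i k x.
Proof.
move=> Ux; have Vx : V (piS (pi x)) := Ux.
have vE := HE.1; have Tn a b := lc_tangent Hnabla0 oV (vE a) (vE b) Vx.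
rewrite -(symformBl Hgo (Tn i j) (Tn j i) (TE k Ux)).
rewrite (lc_torsion Hnabla0 oV (vE i) (vE j) Vx) (Hc i j Vx).
by rewrite (symform_suml HN Hgo) // => *; exact: TE.
Qed.

Section GramDerivatives.
Variables (x : M) (v : tvec M).
Hypotheses (Ux : U x) (Tv : tangent x v).

Lemma tangent_eqU (f1 f2 : M -> R) : (forall y, U y -> f1 y = f2 y) -> v f1 = v f2.
Proof.
by move=> H; apply: (tangent_local Tv); apply: nearm_impl (nearm_open open_U Ux).
Qed.

Lemma tangent_half f1 f2 : smooth_at f1 x -> smooth_at f2 x ->
  v (fun y => f1 y * f2 y / 2) = (v f1 * f2 x + f1 x * v f2) / 2.
Proof.
move=> s1 s2; rewrite (tangentM (g := fun=> 2^-1) Tv); last first.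
- exact: smooth_at_cst.
- exact: smooth_atM.
by rewrite (tangent_cst Tv) mulr0 addr0 (tangentM Tv).
Qed.

Lemma gram_EE j k : v (fun y => g y (Eh j y) (Eh k y)) =
  v sigma * Gm j k x + sigma x * v (fun y : M => Gm j k y).
Proof.
have [ss _ _ _] := Hsm Ux; rewrite -(tangentM Tv ss (smooth_G j k Ux)).
by apply: tangent_eqU => y Uy; have [-> _] := Hform Uy.
Qed.

Lemma gram_Ep j : v (fun y => g y (Eh j y) (po y)) = 0.
Proof.
rewrite -(tangent_cst Tv 0); apply: tangent_eqU => y Uy.
by have [_ [-> _]] := Hform Uy.
Qed.

Lemma gram_pE j : v (fun y => g y (po y) (Eh j y)) = 0.
Proof.
rewrite -(gram_Ep j); apply: tangent_eqU => y Uy.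
by apply: (form_sym Sg); [exact: Tpo|exact: TEh].
Qed.

Lemma gram_pp : v (fun y => g y (po y) (po y)) = 0.
Proof.
rewrite -(tangent_cst Tv 0); apply: tangent_eqU => y Uy.
by have [_ [_ [-> _]]] := Hform Uy.
Qed.

Lemma gram_pq : v (fun y => g y (po y) (qo y)) =
  (v sigma * alpha x + sigma x * v alpha) / 2.
Proof.
have [ss sa _ _] := Hsm Ux; rewrite -tangent_half //; apply: tangent_eqU => y Uy.
by have [_ [_ [_ [-> _]]]] := Hform Uy.
Qed.

Lemma gram_qp : v (fun y => g y (qo y) (po y)) =
  (v sigma * alpha x + sigma x * v alpha) / 2.
Proof.
rewrite -gram_pq; apply: tangent_eqU => y Uy.
by apply: (form_sym Sg); [exact: Tqo|exact: Tpo].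
Qed.

Lemma gram_qE j : v (fun y => g y (qo y) (Eh j y)) =
  (v sigma * glm j x + sigma x * v (glm j)) / 2.
Proof.
have [ss _ _ _] := Hsm Ux; rewrite -tangent_half //; last exact: smooth_gl.
apply: tangent_eqU => y Uy.
by have [_ [_ [_ [_ [-> _]]]]] := Hform Uy; rewrite mulrAC.
Qed.

Lemma gram_Eq j : v (fun y => g y (Eh j y) (qo y)) =
  (v sigma * glm j x + sigma x * v (glm j)) / 2.
Proof.
rewrite -gram_qE; apply: tangent_eqU => y Uy.
by apply: (form_sym Sg); [exact: TEh|exact: Tqo].
Qed.

Lemma gram_qq : v (fun y => g y (qo y) (qo y)) =
  (v sigma * beta x + sigma x * v beta) / 2.
Proof.
have [ss _ sb _] := Hsm Ux; rewrite -tangent_half //; apply: tangent_eqU => y Uy.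
by have [_ [_ [_ [_ [_ ->]]]]] := Hform Uy.
Qed.

End GramDerivatives.

(** * Koszul products of the adapted frame at a point *)

Section AtPoint.
Variable x : M.
Hypothesis Ux : U x.

Local Notation G := (fun i j => Gm i j x).
Local Notation om := (fun i j => omm i j x).
Local Notation N0 := (fun i j k => N0m i j k x).
Local Notation cc := (fun i j k => c i j k (piS (pi x))).
Local Notation gam := (fun i => gamma i x).
Local Notation sE := (fun i => Eh i x sigma).
Local Notation aE := (fun i => Eh i x alpha).
Local Notation bE := (fun i => Eh i x beta).
Local Notation gP := (fun t => po x (gamma t)).
Local Notation gQ := (fun t => qo x (gamma t)).
Local Notation dgl := (fun i j => Eh i x (glm j)).
Local Notation Gi := (fun i j => invmx (\matrix_(k, l) Gm k l x) i j).

Let vE := vfield_Eh.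
Let vp := vfield_po.
Let vq := vfield_qo.
Let KZ (X Y Z : vector_field M) vX vY vZ :=
  @koszul _ _ M g nabla Sg Hnabla U open_U X Y Z x vX vY vZ Ux.

Lemma G_pE i : g x (po x) (Eh i x) = 0.
Proof.
rewrite (form_sym Sg) //; last exact: TEh; last exact: Tpo.
by have [_ [-> _]] := Hform Ux.
Qed.

Lemma G_qp : g x (qo x) (po x) = sigma x * alpha x / 2.
Proof.
rewrite (form_sym Sg) //; last exact: Tpo; last exact: Tqo.
by have [_ [_ [_ [-> _]]]] := Hform Ux.
Qed.

Lemma G_Eq i : g x (Eh i x) (qo x) = sigma x / 2 * glm i x.
Proof.
rewrite (form_sym Sg) //; last exact: Tqo; last exact: TEh.
by have [_ [_ [_ [_ [-> _]]]]] := Hform Ux.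
Qed.

Lemma g_lie_EE i j (w : tvec M) : tangent x w -> g x (lie (Eh i) (Eh j) x) w =
  \sum_k c i j k (piS (pi x)) * g x (Eh k x) w - omm i j x * g x (qo x) w.
Proof.
move=> Tw; rewrite lie_Eh // (symformDl Sg) //; last first.
- exact: (tangentZ HM) (Tqo x).
- by apply: (tangent_lincomb HM) => k; exact: TEh.
rewrite (symform_suml HM Sg) //; last by move=> k; exact: TEh.
by rewrite (symformZl HM Sg) // ?mulNr //; exact: Tqo.
Qed.

Lemma g_lie_EE_E i j k : g x (lie (Eh i) (Eh j) x) (Eh k x) =
  sigma x * (N0m i j k x - N0m j i k x) - omm i j x * (sigma x / 2 * glm k x).
Proof.
rewrite g_lie_EE; last exact: TEh.
have [gE [_ [_ [_ [gq _]]]]] := Hform Ux; rewrite gq; congr (_ - _).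
by rewrite -N0_torsion // mulr_sumr; apply: eq_bigr => l _; rewrite gE mulrCA.
Qed.

Lemma g_lie_EE_p i j : g x (lie (Eh i) (Eh j) x) (po x) =
  - omm i j x * (sigma x * alpha x / 2).
Proof.
rewrite g_lie_EE ?G_qp; last exact: Tpo.
have [_ [gp _]] := Hform Ux.
by rewrite big1 ?sub0r ?mulNr // => k _; rewrite gp mulr0.
Qed.

Lemma g_lie_EE_q i j : g x (lie (Eh i) (Eh j) x) (qo x) =
  sigma x / 2 * (\sum_t c i j t (piS (pi x)) * glm t x)
  - omm i j x * (sigma x * beta x / 2).
Proof.
rewrite g_lie_EE; last exact: Tqo.
have [_ [_ [_ [_ [_ ->]]]]] := Hform Ux; congr (_ - _).
by rewrite mulr_sumr; apply: eq_bigr => k _; rewrite G_Eq mulrCA.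
Qed.

Lemma lie_po_Eh i : lie po (Eh i) x = 0.
Proof. by rewrite lie_antisym lie_Eh_po // oppr0. Qed.

Lemma lie_qo_Eh i : lie qo (Eh i) x = 0.
Proof. by rewrite lie_antisym lie_Eh_qo // oppr0. Qed.

Lemma lie_po_qo : lie po qo x = 0.
Proof. by rewrite lie_antisym lie_qo_po // oppr0. Qed.

Lemma lie_self (X : vector_field M) : lie X X x = 0.
Proof. by apply/funext => f; rewrite /lie subrr; case: ifP. Qed.

Lemma g0l (w : tvec M) : tangent x w -> g x 0 w = 0.
Proof. exact: (symform0l HM Sg). Qed.

Let lieE := (lie_Eh_po, lie_Eh_qo, lie_qo_po, lie_po_Eh, lie_qo_Eh, lie_po_qo, lie_self).

(** The terms from [N] reproduce the Koszul formula of [go]. The [q_o]-components of the three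
    brackets, paired with the lifts through [gamma], add up to the tensor S_ij|k. *)
Lemma Kos_EE_E i j k : g x (nabla (Eh i) (Eh j) x) (Eh k x) =
  K_EE G gam (sigma x) N0 om sE i j k.
Proof.
have TEx a := TEh a Ux.
rewrite (KZ (vE i) (vE j) (vE k)) !(gram_EE Ux) // !Eh_G // !g_lie_EE_E /K_EE.
have -> : \sum_l (gamma l x / 4 * omm i k x * Gm l j x
   + gamma l x / 4 * omm j k x * Gm l i x - gamma l x / 4 * omm i j x * Gm l k x) =
   omm i k x / 4 * glm j x + omm j k x / 4 * glm i x - omm i j x / 4 * glm k x.
  by rewrite !mulr_sumr -big_split -sumrB; apply: eq_bigr => l _ /=; field.
by field.
Qed.

Lemma Kos_EE_p i j : g x (nabla (Eh i) (Eh j) x) (po x) =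
  Kp_EE G (sigma x) (alpha x) om (po x sigma) i j.
Proof.
have TEx a := TEh a Ux; have Tpx := Tpo x.
rewrite (KZ (vE i) (vE j) vp) !(gram_Ep Ux) // (gram_EE Ux) // po_G //.
by rewrite g_lie_EE_p !lieE // !g0l // /Kp_EE; field.
Qed.

Lemma Kos_EE_q i j : g x (nabla (Eh i) (Eh j) x) (qo x) =
  Kq_EE G gam (sigma x) (beta x) om cc sE (qo x sigma) dgl i j.
Proof.
have TEx a := TEh a Ux; have Tqx := Tqo x.
rewrite (KZ (vE i) (vE j) vq) !(gram_Eq Ux) // (gram_EE Ux) // qo_G //.
by rewrite g_lie_EE_q !lieE // !g0l // /Kq_EE; field.
Qed.

(** The twist enters here: the [q_o]-component of the bracket of [Eh i] and [Eh k] pairs with [p_o],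
    giving the term in omega. *)
Lemma Kos_Ep_E i k : g x (nabla (Eh i) po x) (Eh k x) =
  K_Ep G (sigma x) (alpha x) om (po x sigma) i k.
Proof.
have TEx a := TEh a Ux; have Tpx := Tpo x.
rewrite (KZ (vE i) vp (vE k)) (gram_pE Ux) // (gram_EE Ux) // (gram_Ep Ux) // po_G //.
by rewrite g_lie_EE_p !lieE // !g0l // /K_Ep; field.
Qed.

Lemma Kos_Ep_p i : g x (nabla (Eh i) po x) (po x) = 0.
Proof.
have TEx a := TEh a Ux; have Tpx := Tpo x.
rewrite (KZ (vE i) vp vp) (gram_pp Ux) // !(gram_Ep Ux) //.
by rewrite !lieE // !g0l //; field.
Qed.

Lemma Kos_Ep_q i : g x (nabla (Eh i) po x) (qo x) =
  Kq_Ep G gam (sigma x) (alpha x) sE aE gP (po x sigma) i.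
Proof.
have TEx a := TEh a Ux; have Tpx := Tpo x; have Tqx := Tqo x.
rewrite (KZ (vE i) vp vq) (gram_pq Ux) // (gram_Eq Ux) // (gram_Ep Ux) //.
rewrite (vertical_gl _ Ux Tpx) => [|a b]; last exact: po_G.
by rewrite !lieE // !g0l // /Kq_Ep; field.
Qed.

(** It transposes the pairs that involve [p_o] or [q_o], so six Koszul computations cover the nine
    kinds of pairs. *)
Lemma nabla_comm (X Y : vector_field M) :
  vfield (@tangent _ _ M) U X -> vfield (@tangent _ _ M) U Y ->
  lie X Y x = 0 -> nabla X Y x = nabla Y X x.
Proof.
by move=> vX vY L0; apply/eqP; rewrite -subr_eq0 (lc_torsion Hnabla open_U vX vY Ux) L0.
Qed.

Lemma Kos_Eq_E i k : g x (nabla (Eh i) qo x) (Eh k x) =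
  K_Eq G gam (sigma x) (beta x) om cc sE (qo x sigma) dgl i k.
Proof.
have TEx a := TEh a Ux; have Tqx := Tqo x.
rewrite (KZ (vE i) vq (vE k)) (gram_qE Ux) // (gram_EE Ux) // (gram_Eq Ux) // qo_G //.
by rewrite g_lie_EE_q !lieE // !g0l // /K_Eq; field.
Qed.

Lemma Kos_Eq_p i : g x (nabla (Eh i) qo x) (po x) =
  Kp_Eq G gam (sigma x) (alpha x) sE aE gP (po x sigma) i.
Proof.
have TEx a := TEh a Ux; have Tpx := Tpo x; have Tqx := Tqo x.
rewrite (KZ (vE i) vq vp) (gram_qp Ux) // (gram_Ep Ux) // (gram_Eq Ux) //.
rewrite (vertical_gl _ Ux Tpx) => [|a b]; last exact: po_G.
by rewrite !lieE // !g0l // /Kp_Eq; field.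
Qed.

Lemma Kos_Eq_q i : g x (nabla (Eh i) qo x) (qo x) =
  Kq_Eq (sigma x) (beta x) sE bE i.
Proof.
have TEx a := TEh a Ux; have Tqx := Tqo x.
rewrite (KZ (vE i) vq vq) (gram_qq Ux) // !(gram_Eq Ux) //.
by rewrite !lieE // !g0l // /Kq_Eq; field.
Qed.

(** With [Kos_pp_p] this says that the derivative of [p_o] along itself is orthogonal to [p_o] and
    to all lifts, hence a multiple of [p_o]: the orbits are null geodesics up to parametrization. *)
Lemma Kos_pp_E k : g x (nabla po po x) (Eh k x) = 0.
Proof.
have TEx a := TEh a Ux; have Tpx := Tpo x.
rewrite (KZ vp vp (vE k)) (gram_pp Ux) // !(gram_pE Ux) //.
by rewrite !lieE // !g0l //; field.
Qed.

Lemma Kos_pp_p : g x (nabla po po x) (po x) = 0.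
Proof.
have Tpx := Tpo x.
by rewrite (KZ vp vp vp) !(gram_pp Ux) // !lieE // !g0l //; field.
Qed.

Lemma Kos_pp_q : g x (nabla po po x) (qo x) =
  (po x sigma * alpha x + sigma x * po x alpha) / 2.
Proof.
have Tpx := Tpo x; have Tqx := Tqo x.
by rewrite (KZ vp vp vq) !(gram_pp Ux) // (gram_pq Ux) // !lieE // !g0l //; field.
Qed.

Lemma Kos_pq_E k : g x (nabla po qo x) (Eh k x) =
  K_pq G gam (sigma x) (alpha x) sE aE gP (po x sigma) k.
Proof.
have TEx a := TEh a Ux; have Tpx := Tpo x; have Tqx := Tqo x.
rewrite (KZ vp vq (vE k)) (gram_qE Ux) // (gram_pE Ux) // (gram_pq Ux) //.
rewrite (vertical_gl _ Ux Tpx) => [|a b]; last exact: po_G.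
by rewrite !lieE // !g0l // /K_pq; field.
Qed.

Lemma Kos_pq_p : g x (nabla po qo x) (po x) = 0.
Proof.
have Tpx := Tpo x; have Tqx := Tqo x.
rewrite (KZ vp vq vp) (gram_qp Ux) // (gram_pp Ux) // (gram_pq Ux) //.
by rewrite !lieE // !g0l //; field.
Qed.

Lemma Kos_pq_q : g x (nabla po qo x) (qo x) =
  Kq_pq (sigma x) (beta x) (po x sigma) (po x beta).
Proof.
have Tpx := Tpo x; have Tqx := Tqo x.
rewrite (KZ vp vq vq) (gram_qq Ux) // !(gram_pq Ux) //.
by rewrite !lieE // !g0l // /Kq_pq; field.
Qed.

Lemma Kos_qq_E k : g x (nabla qo qo x) (Eh k x) =
  K_qq G gam (sigma x) (beta x) sE bE gQ (qo x sigma) k.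
Proof.
have TEx a := TEh a Ux; have Tqx := Tqo x.
rewrite (KZ vq vq (vE k)) !(gram_qE Ux) // (gram_qq Ux) //.
rewrite (vertical_gl _ Ux Tqx) => [|a b]; last exact: qo_G.
by rewrite !lieE // !g0l // /K_qq; field.
Qed.

Lemma Kos_qq_p : g x (nabla qo qo x) (po x) =
  Kp_qq (sigma x) (alpha x) (beta x) (po x sigma) (po x beta) (qo x sigma) (qo x alpha).
Proof.
have Tpx := Tpo x; have Tqx := Tqo x.
rewrite (KZ vq vq vp) !(gram_qp Ux) // (gram_qq Ux) //.
by rewrite !lieE // !g0l // /Kp_qq; field.
Qed.

Lemma Kos_qq_q : g x (nabla qo qo x) (qo x) =
  Kq_qq (sigma x) (beta x) (qo x sigma) (qo x beta).
Proof.
have Tqx := Tqo x.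
by rewrite (KZ vq vq vq) !(gram_qq Ux) // !lieE // !g0l // /Kq_qq; field.
Qed.

(** * Expansion of the covariant derivatives in the adapted frame *)

Local Notation s := (sigma x).
Local Notation al := (alpha x).
Local Notation be := (beta x).

Lemma G_unitmx : (\matrix_(k, l) Gm k l x) \in unitmx.
Proof. exact: (gram_unitmx HN (kaehler_metric (ks_kaehler HK)) (HE.2 (piS (pi x)) Ux)). Qed.

Lemma GiG m j : \sum_k Gi m k * G k j = (m == j)%:R.
Proof.
have := congr1 (fun Z : 'M[R]_d => Z m j) (mulVmx G_unitmx); rewrite !mxE => <-.
by apply: eq_bigr => k _; rewrite [in RHS]mxE.
Qed.

Lemma GGi m j : \sum_k G m k * Gi k j = (m == j)%:R.
Proof.
have := congr1 (fun Z : 'M[R]_d => Z m j) (mulmxV G_unitmx); rewrite !mxE => <-.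
by apply: eq_bigr => k _; rewrite [in RHS]mxE.
Qed.

Lemma sigma_neq0 : s != 0.
Proof. by have [/lt0r_neq0] := Hpos Ux. Qed.

Lemma alpha_neq0 : al != 0.
Proof. by have [] := Hpos Ux. Qed.

(** For the converse, [frame_span] gives some expansion of [v]; its coefficients obey the same
    formulas as the given ones, so the two agree. *)
Lemma frame_coefs (v : tvec M) (a : 'I_d -> R) b e : tangent x v ->
  v = \sum_k a k *: Eh k x + b *: po x + e *: qo x <->
  (forall m, a m = frame_coefE Gi gam s al (fun k => g x v (Eh k x)) (g x v (po x)) m) /\
  b = frame_coefp G gam s al be (fun k => g x v (Eh k x)) (g x v (po x)) (g x v (qo x)) /\
  e = frame_coefq s al (g x v (po x)).
Proof.
have TEx k := TEh k Ux; have Tpx := Tpo x; have Tqx := Tqo x.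
have forward w a' b' e' : w = \sum_k a' k *: Eh k x + b' *: po x + e' *: qo x ->
  (forall m, a' m = frame_coefE Gi gam s al (fun k => g x w (Eh k x)) (g x w (po x)) m) /\
  b' = frame_coefp G gam s al be (fun k => g x w (Eh k x)) (g x w (po x)) (g x w (qo x)) /\
  e' = frame_coefq s al (g x w (po x)).
  move=> wE.
  have gw u : tangent x u -> g x w u =
      \sum_k a' k * g x (Eh k x) u + b' * g x (po x) u + e' * g x (qo x) u.
    move=> Tu; have Ts : tangent x (\sum_k a' k *: Eh k x) by exact: tangent_lincomb.
    rewrite wE (symformDl Sg) //; last exact: (tangentZ HM).
    - rewrite (symformDl Sg) //; last exact: (tangentZ HM).
      by rewrite (symform_suml HM Sg) // !(symformZl HM Sg).
    - by apply: (tangent_add HM) => //; exact: (tangentZ HM).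
  have [gE [gp [gpp [gpq [gq gqq]]]]] := Hform Ux.
  apply: (proj1 (@frame_coef_system _ _ G Gi gam s al be
    (fun i j => G_sym i j Ux) GiG GGi sigma_neq0 alpha_neq0 _ _ _ _ _ _)).
  split=> [k||]; rewrite gw //.
  - rewrite G_pE mulr0 addr0 gq; congr (_ + _).
    by apply: eq_bigr => m _; rewrite gE.
  - rewrite gpp mulr0 addr0 G_qp big1 ?add0r // => m _.
    by rewrite gp mulr0.
  - rewrite gpq gqq; congr (_ + _ + _).
    by apply: eq_bigr => m _; rewrite G_Eq.
move=> Tv; split; first exact: forward.
have [a' [b' [e' vZ]]] := frame_span Ux Tv.
have [aZ [bZ eZ]] := forward _ _ _ _ vZ.
move=> [aZ' [-> ->]]; rewrite -bZ -eZ {1}vZ; congr (_ + _ + _).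
by apply: eq_bigr => k _; rewrite aZ' -aZ.
Qed.

Let Tn (X Y : vector_field M) vX vY := @lc_tangent _ _ M g nabla Hnabla U open_U X Y x vX vY Ux.

Section Expansions.
Variables (a : 'I_d -> R) (b e : R).
Local Notation expand v := (v = \sum_k a k *: Eh k x + b *: po x + e *: qo x).
Local Notation coefs K Kp Kq :=
  ((forall m, a m = frame_coefE Gi gam s al K Kp m) /\ b = frame_coefp G gam s al be K Kp Kq
    /\ e = frame_coefq s al Kp).

Lemma expand_EE i j : expand (nabla (Eh i) (Eh j) x) <->
  coefs (K_EE G gam s N0 om sE i j) (Kp_EE G s al om (po x sigma) i j)
        (Kq_EE G gam s be om cc sE (qo x sigma) dgl i j).
Proof.
rewrite (frame_coefs _ _ _ (Tn (vE i) (vE j))) Kos_EE_p Kos_EE_q.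
by have -> : (fun k => g x (nabla (Eh i) (Eh j) x) (Eh k x)) =
  K_EE G gam s N0 om sE i j by apply/funext => k; exact: Kos_EE_E.
Qed.

Lemma expand_Ep i : expand (nabla (Eh i) po x) <->
  coefs (K_Ep G s al om (po x sigma) i) 0 (Kq_Ep G gam s al sE aE gP (po x sigma) i).
Proof.
rewrite (frame_coefs _ _ _ (Tn (vE i) vp)) Kos_Ep_p Kos_Ep_q.
by have -> : (fun k => g x (nabla (Eh i) po x) (Eh k x)) =
  K_Ep G s al om (po x sigma) i by apply/funext => k; exact: Kos_Ep_E.
Qed.

Lemma expand_Eq i : expand (nabla (Eh i) qo x) <->
  coefs (K_Eq G gam s be om cc sE (qo x sigma) dgl i)
    (Kp_Eq G gam s al sE aE gP (po x sigma) i) (Kq_Eq s be sE bE i).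
Proof.
rewrite (frame_coefs _ _ _ (Tn (vE i) vq)) Kos_Eq_p Kos_Eq_q.
by have -> : (fun k => g x (nabla (Eh i) qo x) (Eh k x)) =
  K_Eq G gam s be om cc sE (qo x sigma) dgl i by apply/funext => k; exact: Kos_Eq_E.
Qed.

Lemma expand_pp : expand (nabla po po x) <->
  coefs (fun=> 0) 0 ((po x sigma * al + s * po x alpha) / 2).
Proof.
rewrite (frame_coefs _ _ _ (Tn vp vp)) Kos_pp_p Kos_pp_q.
by have -> : (fun k => g x (nabla po po x) (Eh k x)) = fun=> 0
  by apply/funext => k; exact: Kos_pp_E.
Qed.

Lemma expand_pq : expand (nabla po qo x) <->
  coefs (K_pq G gam s al sE aE gP (po x sigma)) 0 (Kq_pq s be (po x sigma) (po x beta)).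
Proof.
rewrite (frame_coefs _ _ _ (Tn vp vq)) Kos_pq_p Kos_pq_q.
by have -> : (fun k => g x (nabla po qo x) (Eh k x)) =
  K_pq G gam s al sE aE gP (po x sigma) by apply/funext => k; exact: Kos_pq_E.
Qed.

Lemma expand_qq : expand (nabla qo qo x) <->
  coefs (K_qq G gam s be sE bE gQ (qo x sigma))
    (Kp_qq s al be (po x sigma) (po x beta) (qo x sigma) (qo x alpha))
    (Kq_qq s be (qo x sigma) (qo x beta)).
Proof.
rewrite (frame_coefs _ _ _ (Tn vq vq)) Kos_qq_p Kos_qq_q.
by have -> : (fun k => g x (nabla qo qo x) (Eh k x)) =
  K_qq G gam s be sE bE gQ (qo x sigma) by apply/funext => k; exact: Kos_qq_E.
Qed.

End Expansions.

Lemma nabla_pE i : nabla po (Eh i) x = nabla (Eh i) po x.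
Proof. exact: nabla_comm vp (vE i) (lie_po_Eh i). Qed.

Lemma nabla_qE i : nabla qo (Eh i) x = nabla (Eh i) qo x.
Proof. exact: nabla_comm vq (vE i) (lie_qo_Eh i). Qed.

Lemma nabla_qp : nabla qo po x = nabla po qo x.
Proof. exact: nabla_comm vq vp (lie_qo_po Ux). Qed.

(** The Koszul formula yields a sum of two logarithmic derivatives, which is the form of the symbol
    [Gam Ip Ip Ip] to be matched. *)
Lemma po_ln : po x (fun y => ln `|alpha y * sigma y|) = po x sigma / s + po x alpha / al.
Proof.
have [ss sa _ _] := Hsm Ux.
have as0 : al * s != 0 by rewrite mulf_neq0 ?alpha_neq0 ?sigma_neq0.
rewrite (tangent_ln (Tpo x) (smooth_atM sa ss) as0) (tangentM (Tpo x)) //.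
by field; rewrite sigma_neq0 alpha_neq0.
Qed.

End AtPoint.

End AdaptedFrame.

(* M = S x A has dimension n = d + 2, where d is the dimension of N.

   In the formula for Gam (Ix i) (Ix j) Ip the summand
   1/(2 alpha) c_ij^k gamma^t g_tk is absent from the source.  It is produced
   by the Koszul formula, and without it that symbol would not be symmetric
   in i, j when the c_ij^k are not zero, although [E_i, E_j] has no
   p_o-component. *)
Theorem theorem3p1 (R : realType) (d : nat)
  (N : premanifold R d) (S : premanifold R d.+1) (A A' : structure_group)
  (* the shearfree structure *)
  (W : tangent_dist (prod_space S (gspace R A)))
  (h : two_tensor (prod_space S (gspace R A)))
  (* the Kaehler-Sasaki structure *)
  (J : endo N) (go : two_tensor N)
  (piS : S -> N) (actS : S -> gspace R A' -> S)
  (JS : endo S) (theta : one_form S)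
  (* the frame field on V, and the adapted frame field *)
  (V : set N) (E : 'I_d -> vector_field N) (c : 'I_d -> 'I_d -> 'I_d -> N -> R)
  (ES : 'I_d -> vector_field S)
  (Eh : 'I_d -> vector_field (prod_space S (gspace R A)))
  (qo : vector_field (prod_space S (gspace R A)))
  (* the compatible metric *)
  (g : two_tensor (prod_space S (gspace R A)))
  (sigma alpha beta : prod_space S (gspace R A) -> R)
  (gamma : 'I_d -> prod_space S (gspace R A) -> R)
  (* the Levi-Civita connections of go and g *)
  (nabla0 : vector_field N -> vector_field N -> vector_field N)
  (nabla : vector_field (prod_space S (gspace R A)) ->
           vector_field (prod_space S (gspace R A)) ->
           vector_field (prod_space S (gspace R A)))
  (Gam : frame_index d -> frame_index d -> frame_index d ->
         prod_space S (gspace R A) -> R) :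
  let M := prod_space S (gspace R A) in
  let pi : M -> S := @triv_proj R d.+1 S A in
  let act : M -> gspace R A -> M := @triv_act R d.+1 S A in
  let U : set M := [set x | V (piS (pi x))] in
  let po : vector_field M := fundamental act in
  let X (a : frame_index d) : vector_field M :=
    match a with Ix i => Eh i | Ip => po | Iq => qo end in
  (* functions on V, pulled back to U *)
  let G i j (x : M) : R :=
    go (piS (pi x)) (E i (piS (pi x))) (E j (piS (pi x))) in
  let Gi i j (x : M) : R := invmx (\matrix_(k, l) G k l x) i j in
  let om i j (x : M) : R :=
    kaehler_form J go (piS (pi x)) (E i (piS (pi x))) (E j (piS (pi x))) in
  let cc i j k (x : M) : R := c i j k (piS (pi x)) in
  let N0 i j k (x : M) : R :=
    go (piS (pi x)) (nabla0 (E i) (E j) (piS (pi x))) (E k (piS (pi x))) in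
  regular_shearfree pi act W h ->
  twisting pi W ->
  kaehler_sasaki pi W h piS actS J go JS theta ->
  open_in V -> frame_field V E ->
  (forall i j p, V p -> lie (E i) (E j) p = \sum_k c i j k p *: E k p) ->
  (forall i, is_lift piS actS (push_dist pi W) V (E i) (ES i)) ->
  (forall i, is_lift pi act (@flat_horizontal R d.+1 S A)
                     [set s | V (piS s)] (ES i) (Eh i)) ->
  is_lift pi act (@flat_horizontal R d.+1 S A) setT (fundamental actS) qo ->
  compatible act W h g ->
  (forall x, U x -> [/\ smooth_at sigma x, smooth_at alpha x, smooth_at beta x &
                        forall i, smooth_at (gamma i) x]) ->
  (forall x, U x -> 0 < sigma x /\ alpha x != 0) ->
  (forall x, U x ->
     (forall i j, g x (Eh i x) (Eh j x) = sigma x * G i j x) /\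
     (forall i, g x (Eh i x) (po x) = 0) /\
     g x (po x) (po x) = 0 /\
     g x (po x) (qo x) = sigma x * alpha x / 2 /\
     (forall j, g x (qo x) (Eh j x) =
        sigma x / 2 * \sum_i gamma i x * G i j x) /\
     g x (qo x) (qo x) = sigma x * beta x / 2) ->
  levi_civita go nabla0 ->
  levi_civita g nabla ->
  (* abbreviations: gamma^k g_ki, gamma^m gamma^k g_mk, p_o(gamma^t) g_it,
     q_o(gamma^t) g_it, S_ij|k, and the two brackets in the sigma-terms *)
  let gl i (x : M) : R := \sum_k gamma k x * G k i x in
  let gg x : R := \sum_m \sum_k gamma m x * gamma k x * G m k x in
  let pg i x : R := \sum_t po x (gamma t) * G i t x in
  let qg i x : R := \sum_t qo x (gamma t) * G i t x in
  let Sf i j k x : R :=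
    \sum_l (gamma l x / 4 * om i k x * G l j x
            + gamma l x / 4 * om j k x * G l i x
            - gamma l x / 4 * om i j x * G l k x) in
  let sm m x : R :=
    \sum_k Gi m k x * Eh k x sigma - gamma m x / alpha x * po x sigma in
  let sp x : R :=
    2 / alpha x * qo x sigma
    + (alpha x ^+ 2)^-1 * (gg x - 2 * beta x) * po x sigma
    - \sum_m gamma m x / alpha x * Eh m x sigma in
  (* Gam are the Christoffel symbols iff they are the following functions *)
  (forall a b x, U x ->
     nabla (X a) (X b) x =
       \sum_k Gam a b (Ix k) x *: Eh k x
       + Gam a b Ip x *: po x + Gam a b Iq x *: qo x)
  <->
  (forall x, U x ->
    (forall i j m, Gam (Ix i) (Ix j) (Ix m) x =
       \sum_k Gi m k x * N0 i j k x
       + \sum_k Gi m k x * Sf i j k x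
       + gamma m x * om i j x / 4
       + (2 * sigma x)^-1 * Eh i x sigma * (j == m)%:R
       + (2 * sigma x)^-1 * Eh j x sigma * (i == m)%:R
       - G i j x / (2 * sigma x) * sm m x) /\
    (forall i j, Gam (Ix i) (Ix j) Ip x =
       (2 * alpha x)^-1 * Eh i x (gl j)
       + (2 * alpha x)^-1 * Eh j x (gl i)
       + (2 * alpha x)^-1 * \sum_k cc i j k x * gl k x
       - (4 * alpha x)^-1 * gg x * om i j x
       - \sum_m gamma m x / alpha x * N0 i j m x
       - \sum_m gamma m x / alpha x * Sf i j m x
       - G i j x / (2 * sigma x) * sp x) /\
    (forall i j, Gam (Ix i) (Ix j) Iq x =
       - (om i j x / 2) - G i j x / (alpha x * sigma x) * po x sigma) /\
    (forall i m, Gam (Ix i) Ip (Ix m) x = Gam Ip (Ix i) (Ix m) x /\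
       Gam Ip (Ix i) (Ix m) x =
       alpha x / 4 * (\sum_k Gi m k x * om i k x)
       + (2 * sigma x)^-1 * po x sigma * (i == m)%:R) /\
    (forall i, Gam (Ix i) Ip Ip x = Gam Ip (Ix i) Ip x /\
       Gam Ip (Ix i) Ip x =
       (2 * alpha x)^-1 * Eh i x alpha
       + (2 * alpha x)^-1 * pg i x
       - (\sum_m gamma m x * om i m x) / 4
       + (2 * sigma x)^-1 * Eh i x sigma) /\
    (forall i, Gam (Ix i) Ip Iq x = Gam Ip (Ix i) Iq x /\
       Gam Ip (Ix i) Iq x = 0) /\
    (forall i m, Gam (Ix i) Iq (Ix m) x = Gam Iq (Ix i) (Ix m) x /\
       Gam Iq (Ix i) (Ix m) x =
       \sum_k Gi m k x / 4 * Eh i x (gl k)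
       - \sum_k Gi m k x / 4 * Eh k x (gl i)
       - \sum_l \sum_r \sum_t
           gamma l x / 4 * cc i r t x * G t l x * Gi m r x
       + \sum_k Gi m k x * om i k x / 4 * beta x
       - gamma m x / (4 * alpha x) * Eh i x alpha
       + gamma m x / (4 * alpha x) * pg i x
       + (2 * sigma x)^-1 * qo x sigma * (i == m)%:R
       - gl i x / (4 * sigma x) * sm m x) /\
    (forall i, Gam (Ix i) Iq Ip x = Gam Iq (Ix i) Ip x /\
       Gam Iq (Ix i) Ip x =
       (2 * alpha x)^-1 * Eh i x beta
       + (4 * alpha x ^+ 2)^-1 * gg x * Eh i x alpha
       - (4 * alpha x ^+ 2)^-1 * gg x * pg i x
       - (2 * alpha x ^+ 2)^-1 * beta x * Eh i x alpha
       + (2 * alpha x ^+ 2)^-1 * beta x * pg i x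
       - \sum_m gamma m x / (4 * alpha x) * Eh i x (gl m)
       + \sum_m gamma m x / (4 * alpha x) * Eh m x (gl i)
       + \sum_m \sum_t \sum_l
           gamma m x * gamma t x / (4 * alpha x) * G t l x * cc i m l x
       - \sum_m gamma m x / (4 * alpha x) * om i m x * beta x
       - gl i x / (4 * sigma x) * sp x) /\
    (forall i, Gam (Ix i) Iq Iq x = Gam Iq (Ix i) Iq x /\
       Gam Iq (Ix i) Iq x =
       (2 * alpha x)^-1 * Eh i x alpha
       - (2 * alpha x)^-1 * pg i x
       + (2 * sigma x)^-1 * Eh i x sigma
       - gl i x / (2 * alpha x * sigma x) * po x sigma) /\
    (forall m, Gam Ip Ip (Ix m) x = 0) /\
    Gam Ip Ip Ip x = po x (fun y => ln `|alpha y * sigma y|) /\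
    Gam Ip Ip Iq x = 0 /\
    (forall m, Gam Ip Iq (Ix m) x = Gam Iq Ip (Ix m) x /\
       Gam Iq Ip (Ix m) x =
       po x (gamma m) / 4
       - \sum_k Gi m k x / 4 * Eh k x alpha
       - alpha x / (4 * sigma x) * sm m x) /\
    (Gam Ip Iq Ip x = Gam Iq Ip Ip x /\
     Gam Iq Ip Ip x =
       (2 * alpha x)^-1 * po x beta
       - \sum_m gamma m x / (4 * alpha x) * pg m x
       + \sum_m gamma m x / (4 * alpha x) * Eh m x alpha
       + (2 * sigma x)^-1 * qo x sigma
       - (2 * sigma x)^-1 *
         (qo x sigma
          + (2 * alpha x)^-1 * (gg x - 2 * beta x) * po x sigma
          - \sum_m gamma m x / 2 * Eh m x sigma)) /\
    (Gam Ip Iq Iq x = Gam Iq Ip Iq x /\ Gam Iq Ip Iq x = 0) /\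
    (forall m, Gam Iq Iq (Ix m) x =
       \sum_k Gi m k x / 2 * qg k x
       - \sum_k Gi m k x / 4 * Eh k x beta
       - gamma m x / (2 * alpha x) * qo x alpha
       + gamma m x / (4 * alpha x) * po x beta
       - beta x / (4 * sigma x) * sm m x) /\
    Gam Iq Iq Ip x =
       (2 * alpha x)^-1 * qo x beta
       + (2 * alpha x ^+ 2)^-1 * gg x * qo x alpha
       - (4 * alpha x ^+ 2)^-1 * gg x * po x beta
       - (alpha x ^+ 2)^-1 * beta x * qo x alpha
       + beta x / (2 * alpha x ^+ 2) * po x beta
       - \sum_m gamma m x / (2 * alpha x) * qg m x
       + \sum_m gamma m x / (4 * alpha x) * Eh m x beta
       - beta x / (2 * sigma x) *
         ((alpha x)^-1 * qo x sigma
          + (2 * alpha x ^+ 2)^-1 * (gg x - 2 * beta x) * po x sigma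
          - \sum_m gamma m x / (2 * alpha x) * Eh m x sigma) /\
    Gam Iq Iq Iq x =
       (alpha x)^-1 * qo x alpha
       - (2 * alpha x)^-1 * po x beta
       + (sigma x)^-1 * qo x sigma
       - beta x / (2 * alpha x * sigma x) * po x sigma).
Proof.
move=> M pi act U po X G Gi om cc N0 HR _ HK oV HE Hc HES HEh Hqo Hcomp Hsm Hpos
  Hform Hn0 Hn gl gg pg qg Sf sm sp.
have Hg := compatible_lorentzian Hcomp.
have Gs x (Ux : U x) i j : G i j x = G j i x := G_sym HK HE i j Ux.
have GiG x (Ux : U x) m j : \sum_k Gi m k x * G k j x = (m == j)%:R :=
  GiG HK HE Ux m j.
have s0 x (Ux : U x) : sigma x != 0 by have [/lt0r_neq0] := Hpos x Ux.
have al0 x (Ux : U x) : alpha x != 0 by have [] := Hpos x Ux.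
(* These facts are equivalences for arbitrary coefficients, so each serves both directions of the
   theorem. *)
have EE x (Ux : U x) a b e i j :=
  expand_EE HR HK oV HE Hc HES HEh Hqo Hg Hn Hsm Hpos Hform Hn0 Ux a b e i j.
have Ep x (Ux : U x) a b e i :=
  expand_Ep HR HK oV HE Hc HES HEh Hqo Hg Hn Hsm Hpos Hform Ux a b e i.
have Eq x (Ux : U x) a b e i :=
  expand_Eq HR HK oV HE Hc HES HEh Hqo Hg Hn Hsm Hpos Hform Ux a b e i.
have pp x (Ux : U x) a b e :=
  expand_pp HR HK oV HE HES HEh Hqo Hg Hn Hsm Hpos Hform Ux a b e.
have pq x (Ux : U x) a b e :=
  expand_pq HR HK oV HE HES HEh Hqo Hg Hn Hsm Hpos Hform Ux a b e.
have qq x (Ux : U x) a b e :=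
  expand_qq HR HK oV HE HES HEh Hqo Hg Hn Hsm Hpos Hform Ux a b e.
have pE x (Ux : U x) i := nabla_pE HR HK oV HE HES HEh Hqo Hg Hn Ux i.
have qE x (Ux : U x) i := nabla_qE HR HK oV HE HES HEh Hqo Hg Hn Ux i.
have qp x (Ux : U x) := nabla_qp HR HK oV HE HES HEh Hqo Hg Hn Ux.
have ln_po x (Ux : U x) := po_ln (piS := piS) (V := V) HR Hsm Hpos Ux.
split=> [H x Ux|H a b x Ux].
- have G' := Gs x Ux; have D := GiG x Ux; have s0' := s0 x Ux; have al0' := al0 x Ux.
  have fEE i j := proj1 (EE x Ux _ _ _ i j) (H (Ix i) (Ix j) x Ux).
  have fEp i := proj1 (Ep x Ux _ _ _ i) (H (Ix i) Ip x Ux).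
  (* The derivative along [p_o] is replaced by the transposed one; both orders of the indices then
     satisfy the same formulas, whence the stated symmetries. *)
  have fpE i := proj1 (Ep x Ux _ _ _ i) (etrans (esym (pE x Ux i)) (H Ip (Ix i) x Ux)).
  have fEq i := proj1 (Eq x Ux _ _ _ i) (H (Ix i) Iq x Ux).
  have fqE i := proj1 (Eq x Ux _ _ _ i) (etrans (esym (qE x Ux i)) (H Iq (Ix i) x Ux)).
  have [ppE [ppp ppq]] := proj1 (pp x Ux _ _ _) (H Ip Ip x Ux).
  have [pqE [pqp pqq]] := proj1 (pq x Ux _ _ _) (H Ip Iq x Ux).
  have [qpE [qpp qpq]] := proj1 (pq x Ux _ _ _) (etrans (esym (qp x Ux)) (H Iq Ip x Ux)).
  have [qqE [qqp qqq]] := proj1 (qq x Ux _ _ _) (H Iq Iq x Ux).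
  split=> [i j m|].
    by have [e _] := fEE i j; apply: etrans (e m) _; exact: frame_coefE_EE.
  split=> [i j|].
    by have [_ [e _]] := fEE i j; apply: etrans e _; exact: frame_coefp_EE.
  split=> [i j|].
    by have [_ [_ e]] := fEE i j; apply: etrans e _; exact: frame_coefq_EE.
  split=> [i m|].
    have [e1 _] := fEp i; have [e2 _] := fpE i.
    by split; [exact: etrans (e1 m) (esym (e2 m))|apply: etrans (e2 m) _; exact: frame_coefE_Ep].
  split=> [i|].
    have [_ [e1 _]] := fEp i; have [_ [e2 _]] := fpE i.
    by split; [exact: etrans e1 (esym e2)|apply: etrans e2 _; exact: frame_coefp_Ep].
  split=> [i|].
    have [_ [_ e1]] := fEp i; have [_ [_ e2]] := fpE i.
    by split; [exact: etrans e1 (esym e2)|apply: etrans e2 _; exact: frame_coefq0].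
  split=> [i m|].
    have [e1 _] := fEq i; have [e2 _] := fqE i.
    by split; [exact: etrans (e1 m) (esym (e2 m))|apply: etrans (e2 m) _; exact: frame_coefE_Eq].
  split=> [i|].
    have [_ [e1 _]] := fEq i; have [_ [e2 _]] := fqE i.
    by split; [exact: etrans e1 (esym e2)|apply: etrans e2 _; exact: frame_coefp_Eq].
  split=> [i|].
    have [_ [_ e1]] := fEq i; have [_ [_ e2]] := fqE i.
    by split; [exact: etrans e1 (esym e2)|apply: etrans e2 _; exact: frame_coefq_Eq].
  split=> [m|]; first by apply: etrans (ppE m) _; exact: frame_coefE_pp.
  split; first by apply: etrans ppp (etrans _ (esym (ln_po x Ux))); exact: frame_coefp_pp.
  split; first by apply: etrans ppq _; exact: frame_coefq0.
  split=> [m|].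
    by split; [exact: etrans (pqE m) (esym (qpE m))|apply: etrans (qpE m) _; exact: frame_coefE_pq].
  split.
    by split; [exact: etrans pqp (esym qpp)|apply: etrans qpp _; exact: frame_coefp_pq].
  split.
    by split; [exact: etrans pqq (esym qpq)|apply: etrans qpq _; exact: frame_coefq0].
  split=> [m|]; first by apply: etrans (qqE m) _; exact: frame_coefE_qq.
  split; first by apply: etrans qqp _; exact: frame_coefp_qq.
  by apply: etrans qqq _; exact: frame_coefq_qq.
- have G' := Gs x Ux; have D := GiG x Ux; have s0' := s0 x Ux; have al0' := al0 x Ux.
  have [hEE [hEEp [hEEq [hEp [hEpp [hEpq [hEq [hEqp [hEqq H']]]]]]]]] := H x Ux.
  have [hpp [hppp [hppq [hpq [[hpqp hpqp'] [[hpqq hpqq'] [hqq [hqqp hqqq]]]]]]]] := H'.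
  case: a b => [i||] [j||] /=.
  + apply/(EE x Ux); split=> [m|]; last split.
    * by apply: etrans (hEE i j m) (esym _); exact: frame_coefE_EE.
    * by apply: etrans (hEEp i j) (esym _); exact: frame_coefp_EE.
    * by apply: etrans (hEEq i j) (esym _); exact: frame_coefq_EE.
  + apply/(Ep x Ux); split=> [m|]; last split.
    * by have [e1 e2] := hEp i m; apply: etrans (etrans e1 e2) (esym _); exact: frame_coefE_Ep.
    * by have [e1 e2] := hEpp i; apply: etrans (etrans e1 e2) (esym _); exact: frame_coefp_Ep.
    * by have [e1 e2] := hEpq i; apply: etrans (etrans e1 e2) (esym _); exact: frame_coefq0.
  + apply/(Eq x Ux); split=> [m|]; last split.
    * by have [e1 e2] := hEq i m; apply: etrans (etrans e1 e2) (esym _); exact: frame_coefE_Eq.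
    * by have [e1 e2] := hEqp i; apply: etrans (etrans e1 e2) (esym _); exact: frame_coefp_Eq.
    * by have [e1 e2] := hEqq i; apply: etrans (etrans e1 e2) (esym _); exact: frame_coefq_Eq.
  + apply: etrans (pE x Ux j) _; apply/(Ep x Ux); split=> [m|]; last split.
    * by have [_ e] := hEp j m; apply: etrans e (esym _); exact: frame_coefE_Ep.
    * by have [_ e] := hEpp j; apply: etrans e (esym _); exact: frame_coefp_Ep.
    * by have [_ e] := hEpq j; apply: etrans e (esym _); exact: frame_coefq0.
  + apply/(pp x Ux); split=> [m|]; last split.
    * by apply: etrans (hpp m) (esym _); exact: frame_coefE_pp.
    * by apply: etrans hppp (etrans (ln_po x Ux) (esym _)); exact: frame_coefp_pp.
    * by apply: etrans hppq (esym _); exact: frame_coefq0.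
  + apply/(pq x Ux); split=> [m|]; last split.
    * by have [e1 e2] := hpq m; apply: etrans (etrans e1 e2) (esym _); exact: frame_coefE_pq.
    * by apply: etrans (etrans hpqp hpqp') (esym _); exact: frame_coefp_pq.
    * by apply: etrans (etrans hpqq hpqq') (esym _); exact: frame_coefq0.
  + apply: etrans (qE x Ux j) _; apply/(Eq x Ux); split=> [m|]; last split.
    * by have [_ e] := hEq j m; apply: etrans e (esym _); exact: frame_coefE_Eq.
    * by have [_ e] := hEqp j; apply: etrans e (esym _); exact: frame_coefp_Eq.
    * by have [_ e] := hEqq j; apply: etrans e (esym _); exact: frame_coefq_Eq.
  + apply: etrans (qp x Ux) _; apply/(pq x Ux); split=> [m|]; last split.
    * by have [_ e] := hpq m; apply: etrans e (esym _); exact: frame_coefE_pq.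
    * by apply: etrans hpqp' (esym _); exact: frame_coefp_pq.
    * by apply: etrans hpqq' (esym _); exact: frame_coefq0.
  + apply/(qq x Ux); split=> [m|]; last split.
    * by apply: etrans (hqq m) (esym _); exact: frame_coefE_qq.
    * by apply: etrans hqqp (esym _); exact: frame_coefp_qq.
    * by apply: etrans hqqq (esym _); exact: frame_coefq_qq.
Qed.
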